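(* The following are equivalent: (a) the system $\varphi_1,\varphi_2,\varphi_3,\ldots$ is complete in $L^2(0,1)$; (b) the function $S\varphi$ is cyclic in $\mathcal{H}$, that is, the subspace $S\varphi\,\mathcal{M}=\{S\varphi\cdot m: m\in\mathcal{M}\}$ is dense in $\mathcal{H}$; (c) the function $\mathfrak{Q}S\varphi$ is cyclic in $H^2(\mathbb{D}^\infty)$.
   Context: $\varphi\in L^2(0,1)$ is given, extended to the real line as an odd periodic function of period 2, with sine expansion $\varphi(x)=\sum_{n=1}^\infty a_n\sqrt2\sin(n\pi x)$ on $(0,1)$, normalized by $a_1=1$; $\varphi_n(x)=\varphi(nx)$, and $S\varphi(s)=\sum_{n=1}^\infty a_n n^{-s}$. A system is complete if its linear span is dense. $\mathcal{H}$ is the Hilbert space of Dirichlet series $f(s)=\sum_{n=1}^\infty c_n n^{-s}$ with $\|f\|_{\mathcal{H}}^2=\sum_n|c_n|^2<+\infty$, regarded as analytic functions on $\Re s>\frac12$. $\mathcal{M}$ is the set of multipliers of $\mathcal{H}$: holomorphic $m$ on $\Re s>\frac12$ with $mf\in\mathcal{H}$ for all $f\in\mathcal{H}$. A function $f\in\mathcal{H}$ is cyclic in $\mathcal{H}$ if the functions $fg$, with $g$ a finite Dirichlet series, are dense in $\mathcal{H}$ (equivalently, the smallest closed subspace containing $f$ and invariant under multiplication by finite Dirichlet series is $\mathcal{H}$; such closed subspaces are also invariant under multiplication by $\mathcal{M}$). $\mathbb{D}^\infty$ is the set of sequences $z=(z_1,z_2,\ldots)$ with $|z_m|<1$ for every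 $m$. For $f(s)=\sum_n c_n n^{-s}\in\mathcal{H}$, $\mathfrak{Q}f$ is the function on $\mathbb{D}^\infty\cap l^2(\mathbb{N})$ given by $\mathfrak{Q}f(z)=\sum_{n=1}^\infty c_n z_1^{\nu_1(n)}z_2^{\nu_2(n)}\cdots$, where $n=\prod_m p_m^{\nu_m(n)}$ is the prime factorization of $n$ and $p_m$ is the $m$-th prime (the series converges absolutely there). $H^2(\mathbb{D}^\infty)$ is the space of all functions $\mathfrak{Q}f$, $f\in\mathcal{H}$, with the Hilbert space structure induced from $\mathcal{H}$ (so $\mathfrak{Q}$ is an isometric isomorphism). A function $F\in H^2(\mathbb{D}^\infty)$ is cyclic if the smallest closed subspace of $H^2(\mathbb{D}^\infty)$ containing $F$ and invariant under multiplication by polynomials in the coordinate functions $z_1,z_2,\ldots$ is all of $H^2(\mathbb{D}^\infty)$. *)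

(* Defs.v *)
From HB Require Import structures.
From mathcomp Require Import all_boot all_order all_algebra.
From mathcomp Require Import complex.
From mathcomp Require Import all_classical all_reals all_analysis.
From mathcomp Require mpoly.

Set Implicit Arguments.
Unset Strict Implicit.
Unset Printing Implicit Defensive.

Import Order.TTheory GRing.Theory Num.Theory.
Import numFieldNormedType.Exports.
Import Normc.

Local Open Scope classical_set_scope.
Local Open Scope complex_scope.
Local Open Scope ring_scope.

(* Function spaces are sets of representatives: functions defined on a whole
   type, of which only the values on the relevant domain (the interval ]0,1[,
   the half-plane Re s > 1/2, the infinite polydisc) matter.  Accordingly, the
   norms below are only meaningful (and only used) on the corresponding space. *)
Section NormedSpans.
Variables (R : realType) (V : lmodType R[i]) (norm : V -> R) (X : set V).

Definition dense_in (A : set V) : Prop :=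
  A `<=` X /\
  forall f, X f -> forall e : R, 0 < e -> exists2 g, A g & norm (f - g) < e.

(* The last clause makes E closed under change of representative as well. *)
Definition closed_subspace (E : set V) : Prop :=
  [/\ E `<=` X,
      E 0,
      (forall (c : R[i]) f g, E f -> E g -> E (c *: f + g)) &
      (forall f, X f ->
         (forall e : R, 0 < e -> exists2 g, E g & norm (f - g) < e) -> E f)].

(* Linear span of u_1, u_2, u_3, ...; the term u_0 is ignored. *)
Definition lin_span (u : nat -> V) : set V :=
  [set f | exists (N : nat) (c : nat -> R[i]),
             f = \sum_(1 <= n < N.+1) c n *: u n].

Definition complete_system (u : nat -> V) : Prop := dense_in (lin_span u).

End NormedSpans.

Section L2.
Variable R : realType.
Notation mu := (@lebesgue_measure R).
Implicit Types f phi : R -> R[i].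

Definition L2_sqnorm f : \bar R :=
  (\int[mu]_(x in `]0%R, 1%R[) (normc (f x) ^+ 2)%:E)%E.

Definition L2 : set (R -> R[i]) :=
  [set f | [/\ measurable_fun (`]0%R, 1%R[ : set R) (fun x => complex.Re (f x)),
               measurable_fun (`]0%R, 1%R[ : set R) (fun x => complex.Im (f x)) &
               (L2_sqnorm f < +oo)%E]].

Definition L2_norm f : R := Num.sqrt (fine (L2_sqnorm f)).

(* Only the values of phi on ]0,1[ are used; oddness and 2-periodicity force
   the value 0 at the integers. *)
Definition odd_periodic_ext phi (x : R) : R[i] :=
  let y := x - 2 * (Num.floor (x / 2))%:~R in
  if 0 < y < 1 then phi y else if 1 < y < 2 then - phi (2 - y) else 0.

Definition dilate phi (n : nat) (x : R) : R[i] :=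
  odd_periodic_ext phi (n%:R * x).

Definition sine_term (n : nat) (x : R) : R[i] :=
  (Num.sqrt 2 * sin (n%:R * pi * x))%:C.

(* phi = \sum_(n >= 1) a n *: sine_term n, with convergence in L^2(0,1). *)
Definition sine_expansion phi (a : nat -> R[i]) : Prop :=
  (fun N : nat => L2_norm (phi - \sum_(1 <= n < N.+1) a n *: sine_term n))
    @ \oo --> (0 : R).

End L2.

Section DirichletSeries.
Variable R : realType.
Implicit Types (c : nat -> R[i]) (s z : R[i]) (f g m : R[i] -> R[i]).

Definition cexp z : R[i] :=
  (expR (complex.Re z))%:C * (cos (complex.Im z) +i* sin (complex.Im z)).

Definition nat_cpow (n : nat) s : R[i] := cexp (s * (ln n%:R)%:C).

Definition half_plane : set R[i] := [set s | 2^-1 < complex.Re s].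

(* Coefficient sequences are indexed by n >= 1; the value c 0 is ignored. *)
Definition coef_sqnorm c : \bar R :=
  (\sum_(1 <= n <oo) (normc (c n) ^+ 2)%:E)%E.

Definition dirichlet_series c s : R[i] :=
  limn (fun N : nat => \sum_(1 <= n < N.+1) c n * nat_cpow n (- s) : R[i]^o).

Definition is_coef f c : Prop :=
  (coef_sqnorm c < +oo)%E /\
  forall s, half_plane s -> f s = dirichlet_series c s.

Definition Hspace : set (R[i] -> R[i]) := [set f | exists c, is_coef f c].

(* On Hspace, the coefficients of index n >= 1 are unique. *)
Definition coef f : nat -> R[i] := xget (cst 0) (is_coef f).

Definition Hnorm f : R := Num.sqrt (fine (coef_sqnorm (coef f))).

Definition holomorphic_half_plane m : Prop :=
  forall s, half_plane s -> derivable (m : R[i]^o -> R[i]^o) s 1.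

Definition multiplier : set (R[i] -> R[i]) :=
  [set m | holomorphic_half_plane m /\
           forall f, Hspace f -> Hspace (m \* f)].

Definition finite_dirichlet : set (R[i] -> R[i]) :=
  [set g | exists (N : nat) c,
             g = fun s => \sum_(1 <= n < N.+1) c n * nat_cpow n (- s)].

Definition cyclic_H f : Prop :=
  dense_in Hnorm Hspace [set f \* g | g in finite_dirichlet].

Definition multiples_dense f : Prop :=
  dense_in Hnorm Hspace [set f \* m | m in multiplier].

End DirichletSeries.

Lemma ex_prime_above (n : nat) : exists p, (n < p)%N && prime p.
Proof. by have [p np pp] := prime_above n; exists p; rewrite np. Qed.

Definition next_prime (n : nat) : nat := ex_minn (ex_prime_above n).

(* Indexed from 0: nth_prime 0 = 2. *)
Definition nth_prime (m : nat) : nat := iter m.+1 next_prime 0%N.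

Section Polydisc.
Variable R : realType.
(* Variables are indexed from 0: z m belongs to the prime nth_prime m. *)
Implicit Types (z : nat -> R[i]) (F G P : (nat -> R[i]) -> R[i]).

Definition polydisc_l2 : set (nat -> R[i]) :=
  [set z | (forall m, normc (z m) < 1) /\
           (\sum_(0 <= m <oo) (normc (z m) ^+ 2)%:E < +oo)%E].

(* Only primes nth_prime m with m < n can divide n. *)
Definition bohr_monomial (n : nat) z : R[i] :=
  \prod_(m < n) z m ^+ logn (nth_prime m) n.

Definition bohr (f : R[i] -> R[i]) z : R[i] :=
  limn (fun N : nat =>
          \sum_(1 <= n < N.+1) coef f n * bohr_monomial n z : R[i]^o).

Definition is_bohr_lift F (f : R[i] -> R[i]) : Prop :=
  Hspace f /\ forall z, polydisc_l2 z -> F z = bohr f z.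

Definition H2 : set ((nat -> R[i]) -> R[i]) :=
  [set F | exists f, is_bohr_lift F f].

Definition H2_norm F : R := Hnorm (xget (cst 0) (is_bohr_lift F)).

Definition coord_polynomial : set ((nat -> R[i]) -> R[i]) :=
  [set P | exists (n : nat) (p : mpoly.mpoly n R[i]),
             P = fun z => mpoly.meval (fun i : 'I_n => z i) p].

Definition poly_invariant (E : set ((nat -> R[i]) -> R[i])) : Prop :=
  forall P F, coord_polynomial P -> E F -> E (P \* F).

Definition cyclic_H2 F : Prop :=
  smallest [set E | closed_subspace H2_norm H2 E /\ poly_invariant E] [set F]
  = H2.

End Polydisc.

(* Main.v *)
Require Import Defs.
From mathcomp Require Import all_boot all_order all_algebra.
From mathcomp Require Import complex.
From mathcomp Require Import all_classical all_reals all_analysis.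
From mathcomp Require Import measurable_realfun.
From mathcomp Require mpoly.
Import -(notations) mpoly.
From mathcomp Require Import ring lra zify.

(** Let [a] be the sequence of coefficients of [phi].  Each of the conditions says
the same thing about [a], namely [cyclic_seq a]: every square-summable sequence
is a limit of finite combinations of the shifts [dshift k a], where [dshift k]
is the isometry of l^2 that moves the coefficient of index [n] to the index
[k n].  Indeed [dshift k] is the dilation [phi(x) |-> phi(kx)] on sine
coefficients, the multiplication by [k^{-s}] on Dirichlet coefficients, and the
multiplication by the monomial of [k] in the variables [z_m] on the polydisc.

On the interval, this is because the functions [sqrt 2 sin(n pi x)] form an
orthonormal basis ([sqint_rsine_sum], [sines_complete]).  Completeness is a
monotone class argument: the bounded functions that multiply the closed span of
the sines into itself form an algebra, closed under bounded pointwise limits,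
that contains [cos(pi x)]; since the cosine is decreasing on [0,1], this algebra
contains the indicators of the intervals, hence of all the Borel sets.

In the space of Dirichlet series, coefficients are unique because the values at
large integers detect the first nonzero one ([dirichlet_growth],
[dirichlet_vanish]); these estimates also identify the coefficients of a product
[m f] with the Dirichlet convolution of those of [f] and [m] ([multiplier_coef]).
The series converge because [n |-> n^{-s}] is square-summable for [Re s > 1/2].
On the polydisc the monomials are square-summable by an Euler product
([l2_bohr_monomial]), and the points [z_m = p_m^{-s}] bring uniqueness back to
Dirichlet series.

The only inclusion that is not a matter of translation is that products
[f m] by a multiplier [m] are limits of products of [f] by finite Dirichlet
series ([dmul_approx]).  A multiplier acts boundedly, by a gliding hump
([dmul_bounded]).  Grading the integers by the sum of their prime factors, an
additive function with finite level sets, the Cesaro means of [m] are finite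
Dirichlet series whose operators are bounded uniformly ([cesaro_bounded]), so
that they converge strongly to the operator of [m]. *)

Set Implicit Arguments.
Unset Strict Implicit.
Unset Printing Implicit Defensive.

Import Order.TTheory GRing.Theory Num.Theory.
Import numFieldNormedType.Exports.
Import Normc.

Local Open Scope classical_set_scope.
Local Open Scope complex_scope.
Local Open Scope ring_scope.

(** * Complex limits and square-summable sequences *)

Section ComplexLimits.
Variable R : realType.
Implicit Types (z w : R[i]) (u : nat -> R[i]).

Lemma normcE_norm z : (`|z| : R[i]) = (normc z)%:C.
Proof. by case: z. Qed.

Lemma normc_ge0 z : 0 <= normc z.
Proof. by case: z => x y; exact: sqrtr_ge0. Qed.

Lemma sqr_normcE z : normc z ^+ 2 = complex.Re z ^+ 2 + complex.Im z ^+ 2.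
Proof. by case: z => x y /=; rewrite sqr_sqrtr// addr_ge0 ?sqr_ge0. Qed.

Lemma normc_real (x : R) : normc x%:C = `|x|.
Proof. by rewrite /= expr0n /= addr0 sqrtr_sqr. Qed.

Lemma normc_Re z : `|complex.Re z| <= normc z.
Proof.
case: z => x y /=; rewrite -(sqrtr_sqr x) ler_wsqrtr// lerDl sqr_ge0//.
Qed.

Lemma normc_Im z : `|complex.Im z| <= normc z.
Proof.
case: z => x y /=; rewrite -(sqrtr_sqr y) ler_wsqrtr// lerDr sqr_ge0//.
Qed.

Lemma normc_ReIm z : normc z <= `|complex.Re z| + `|complex.Im z|.
Proof.
rewrite -(@ler_pXn2r _ 2) ?nnegrE ?normc_ge0 ?addr_ge0//.
rewrite sqr_normcE -(real_normK (num_real (complex.Re z))).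
rewrite -(real_normK (num_real (complex.Im z))) sqrrD lerD2r lerDl.
by rewrite mulrn_wge0// mulr_ge0.
Qed.

Lemma ler_normc_sum (I : Type) (r : seq I) (P : pred I) (F : I -> R[i]) :
  normc (\sum_(i <- r | P i) F i) <= \sum_(i <- r | P i) normc (F i).
Proof.
elim/big_rec2: _ => [|i x y _ h]; first by rewrite normc0.
by apply: le_trans (le_normcD _ _) _; rewrite lerD2l.
Qed.

(** Serves as the triangle inequality for square-summable objects: density and
boundedness are insensitive to constants, and no square root has to be taken. *)
Lemma sqr_normcD z w : normc (z + w) ^+ 2 <= 2 * normc z ^+ 2 + 2 * normc w ^+ 2.
Proof.
case: z => x y; case: w => x' y'; rewrite !sqr_normcE /=.
have := sqr_ge0 (x - x'); have := sqr_ge0 (y - y'); nra.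
Qed.

Lemma cvgC_P u (l : R[i]) :
  (u : nat -> R[i]^o) @ \oo --> (l : R[i]^o) <->
  forall e : R, 0 < e -> \forall n \near \oo, normc (l - u n) < e.
Proof.
split=> [/cvgrPdist_lt ul e e0|ul].
  have e0' : 0 < e%:C :> R[i] by rewrite ltcR.
  by apply: filterS (ul _ e0') => n; rewrite normcE_norm ltcR.
apply/cvgrPdist_lt => e e0.
have /complex_realP[e' ee'] : e \is Num.real by rewrite gtr0_real.
have e'0 : 0 < e' by rewrite ee' ltcR in e0.
by apply: filterS (ul _ e'0) => n; rewrite normcE_norm ee' ltcR.
Qed.

Lemma cvgC_ReIm u (l : R[i]) :
  (fun n => complex.Re (u n)) @ \oo --> complex.Re l ->
  (fun n => complex.Im (u n)) @ \oo --> complex.Im l ->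
  (u : nat -> R[i]^o) @ \oo --> (l : R[i]^o).
Proof.
move=> /cvgrPdist_lt ur /cvgrPdist_lt ui; apply/cvgC_P => e e0.
have e20 : 0 < e / 2 by rewrite divr_gt0.
near=> n; apply: le_lt_trans (normc_ReIm _) _; rewrite (splitr e) !raddfB /=.
by apply: ltrD; near: n; [exact: ur|exact: ui].
Unshelve. all: by end_near. Qed.

Lemma normc_lim_le u (l : R[i]) (M : R) :
  (u : nat -> R[i]^o) @ \oo --> (l : R[i]^o) ->
  (\forall n \near \oo, normc (u n) <= M) -> normc l <= M.
Proof.
move=> /cvgC_P ul uM; apply/ler_addgt0Pr => e e0.
have [n [un]] : exists n, normc (u n) <= M /\ normc (l - u n) < e.
  by apply: (@filter_ex _ \oo); near=> n; split; near: n => //; exact: ul.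
move=> /ltW lu; rewrite -(subrK (u n) l) addrC.
by apply: le_trans (le_normcD _ _) _; rewrite lerD.
Unshelve. all: by end_near. Qed.

Lemma cvgC_unique u (l l' : R[i]) :
  (u : nat -> R[i]^o) @ \oo --> (l : R[i]^o) ->
  (u : nat -> R[i]^o) @ \oo --> (l' : R[i]^o) -> l = l'.
Proof. exact: (@cvg_unique _ (@norm_hausdorff _ R[i]^o)). Qed.

Lemma limC u (l : R[i]) :
  (u : nat -> R[i]^o) @ \oo --> (l : R[i]^o) -> limn (u : nat -> R[i]^o) = l.
Proof. exact: (@cvg_lim _ (@norm_hausdorff _ R[i]^o)). Qed.

Lemma cvgCZ u (k l : R[i]) :
  (u : nat -> R[i]^o) @ \oo --> (l : R[i]^o) ->
  (fun n => k * u n : R[i]^o) @ \oo --> (k * l : R[i]^o).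
Proof. exact: (@cvgZl_tmp _ R[i]^o). Qed.

End ComplexLimits.

Section BoundedSums.
Variable R : realType.

Lemma cvg_bounded_sum (u : nat -> R) (M : R) :
  (forall N, \sum_(1 <= n < N.+1) `|u n| <= M) ->
  cvgn (fun N => \sum_(1 <= n < N.+1) u n).
Proof.
move=> uM; pose v n := u n.+1.
have sE (f : nat -> R) N : \sum_(1 <= n < N.+1) f n = series (fun n => f n.+1) N.
  by rewrite /series /= big_add1.
rewrite (_ : (fun N => _) = series v); last by apply/funext => N; exact: sE.
apply: normed_cvg; apply: nondecreasing_is_cvgn.
  by apply/nondecreasing_seqP => n; rewrite /= !seriesEnat /= big_nat_recr//= lerDl.
exists M => _ [N _ <-]; have := uM N.
by rewrite (sE (fun n => `|u n|)).
Qed.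

(** Absolute convergence, obtained from that of the real and imaginary parts. *)
Lemma cvg_bounded_sumC (u : nat -> R[i]) (M : R) :
  (forall N, \sum_(1 <= n < N.+1) normc (u n) <= M) ->
  exists l : R[i],
    (fun N => \sum_(1 <= n < N.+1) u n : R[i]^o) @ \oo --> (l : R[i]^o).
Proof.
move=> uM.
have h (p : R[i] -> R) : (forall z, `|p z| <= normc z) ->
    cvgn (fun N => \sum_(1 <= n < N.+1) p (u n)).
  move=> pn; apply: (@cvg_bounded_sum _ M) => N.
  by apply: le_trans (uM N); apply: ler_sum => n _; exact: pn.
have rs (F : nat -> R[i]) (s : seq nat) :
  complex.Re (\sum_(n <- s) F n) = \sum_(n <- s) complex.Re (F n).
  by elim/big_ind2: _ => // a b c d <- <-; rewrite raddfD.
have is' (F : nat -> R[i]) (s : seq nat) :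
  complex.Im (\sum_(n <- s) F n) = \sum_(n <- s) complex.Im (F n).
  by elim/big_ind2: _ => // a b c d <- <-; rewrite raddfD.
have hr := h _ (@normc_Re R); have hi := h _ (@normc_Im R).
exists (limn (fun N => \sum_(1 <= n < N.+1) complex.Re (u n)) +i*
        limn (fun N => \sum_(1 <= n < N.+1) complex.Im (u n))).
apply: cvgC_ReIm => /=.
  by under eq_fun do rewrite rs; exact: hr.
by under eq_fun do rewrite is'; exact: hi.
Qed.

End BoundedSums.

Section SquareSummable.
Variable R : realType.
Implicit Types (c d b : nat -> R[i]) (M : R).

(** Norms are handled through real upper bounds of all the partial sums, so that
estimates compose without convergence or finiteness side conditions. *)
Definition sqsum_le c M := forall N, \sum_(1 <= n < N.+1) normc (c n) ^+ 2 <= M.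

Definition l2 c := exists M, sqsum_le c M.

Lemma sqsum_le_ge0 c M : sqsum_le c M -> 0 <= M.
Proof. by move=> /(_ 0%N); rewrite big_geq. Qed.

Lemma sqsum_le_le c M M' : M <= M' -> sqsum_le c M -> sqsum_le c M'.
Proof. by move=> MM' cM N; exact: le_trans MM'. Qed.

Lemma sqsum_le_mono c d M : (forall n, (0 < n)%N -> normc (c n) <= normc (d n)) ->
  sqsum_le d M -> sqsum_le c M.
Proof.
move=> cd dM N; apply: le_trans (dM N); apply: ler_sum_nat => n /andP[n0 _].
by rewrite lerXn2r ?nnegrE ?normc_ge0// cd.
Qed.

Lemma sqsum_le_eq c d M : (forall n, (0 < n)%N -> c n = d n) -> sqsum_le d M -> sqsum_le c M.
Proof. by move=> cd; apply: sqsum_le_mono => n n0; rewrite cd. Qed.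

Lemma sqsum_leD c d M M' : sqsum_le c M -> sqsum_le d M' -> sqsum_le (c + d) (2 * M + 2 * M').
Proof.
move=> cM dM N; apply: (@le_trans _ _
    (\sum_(1 <= n < N.+1) (2 * normc (c n) ^+ 2 + 2 * normc (d n) ^+ 2))).
  by apply: ler_sum => n _; exact: sqr_normcD.
by rewrite big_split /= -!mulr_sumr lerD// ler_pM2l.
Qed.

Lemma sqsum_leZ (k : R[i]) c M : sqsum_le c M -> sqsum_le (k *: c) (normc k ^+ 2 * M).
Proof.
move=> cM N; under eq_bigr do rewrite /GRing.scale /= normcM exprMn.
by rewrite -mulr_sumr ler_wpM2l ?sqr_ge0.
Qed.

Lemma sqsum_leN c M : sqsum_le c M -> sqsum_le (- c) M.
Proof. by move=> cM N; under eq_bigr do rewrite normcN; exact: cM. Qed.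

Lemma sqsum_le0 M : 0 <= M -> sqsum_le 0 M.
Proof.
by move=> M0 N; rewrite big1// => n _; rewrite normc0 expr0n.
Qed.

Lemma l2D c d : l2 c -> l2 d -> l2 (c + d).
Proof. by move=> [M cM] [M' dM]; eexists; exact: sqsum_leD cM dM. Qed.

Lemma l2Z k c : l2 c -> l2 (k *: c).
Proof. by move=> [M cM]; eexists; exact: sqsum_leZ cM. Qed.

Lemma l2B c d : l2 c -> l2 d -> l2 (c - d).
Proof. by move=> hc hd; rewrite -scaleN1r; apply: l2D => //; exact: l2Z. Qed.

Lemma l20 : l2 0.
Proof. by exists 0; exact: sqsum_le0. Qed.

Lemma coef_sqnorm_leP c M : (coef_sqnorm c <= M%:E)%E <-> sqsum_le c M.
Proof.
rewrite /coef_sqnorm; split=> [h N|h].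
  rewrite -lee_fin -sumEFin; apply: le_trans h.
  by apply: nneseries_lim_ge => // n _ _; rewrite lee_fin sqr_ge0.
apply: lime_le.
  by apply: is_cvg_nneseries => // n _ _; rewrite lee_fin sqr_ge0.
apply: nearW => -[|N]; first by rewrite big_geq// lee_fin; exact: sqsum_le_ge0 h.
by rewrite sumEFin lee_fin.
Qed.

Lemma coef_sqnorm_ge0 c : (0 <= coef_sqnorm c)%E.
Proof. by apply: nneseries_ge0 => n _ _; rewrite lee_fin sqr_ge0. Qed.

Lemma coef_sqnorm_ltP c : (coef_sqnorm c < +oo)%E <-> l2 c.
Proof.
split=> [h|[M /coef_sqnorm_leP h]]; last exact: le_lt_trans h (ltry _).
exists (fine (coef_sqnorm c)); apply/coef_sqnorm_leP.
by rewrite fineK// ge0_fin_numE// coef_sqnorm_ge0.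
Qed.

End SquareSummable.

(** * Series against completely multiplicative functions *)

Section CharacterSeries.
Variable R : realType.
Implicit Types (c d b chi : nat -> R[i]) (M : R) (l : R[i]).

Definition is_ser c chi l :=
  (fun N => \sum_(1 <= n < N.+1) c n * chi n : R[i]^o) @ \oo --> (l : R[i]^o).

Definition ser c chi : R[i] :=
  limn (fun N => \sum_(1 <= n < N.+1) c n * chi n : R[i]^o).

(** Complete multiplicativity at positive integers; the value at 0 is arbitrary
because all sums start at 1. *)
Definition is_char chi :=
  chi 1%N = 1 /\
  forall k n, (0 < k)%N -> (0 < n)%N -> chi (k * n)%N = chi k * chi n.

Lemma is_ser_lim c chi l : is_ser c chi l -> ser c chi = l.
Proof. exact: limC. Qed.

(** The arithmetic-geometric mean inequality [2 |c chi| <= |c|^2 + |chi|^2] is a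
sufficient substitute for Cauchy-Schwarz. *)
Lemma sum_normc_le c chi M M' N : sqsum_le c M -> sqsum_le chi M' ->
  \sum_(1 <= n < N.+1) normc (c n * chi n) <= 2^-1 * (M + M').
Proof.
move=> cM chiM; apply: (@le_trans _ _
  (\sum_(1 <= n < N.+1) 2^-1 * (normc (c n) ^+ 2 + normc (chi n) ^+ 2))).
  apply: ler_sum => n _; rewrite normcM.
  have := sqr_ge0 (normc (c n) - normc (chi n)); nra.
by rewrite -mulr_sumr big_split /= ler_pM2l ?invr_gt0// lerD.
Qed.

Lemma is_ser_ser c chi : l2 c -> l2 chi -> is_ser c chi (ser c chi).
Proof.
move=> [M cM] [M' chiM].
have [l cl] := @cvg_bounded_sumC R (fun n => c n * chi n) (2^-1 * (M + M'))
  (fun N => sum_normc_le N cM chiM).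
by rewrite (is_ser_lim cl).
Qed.

Lemma normc_ser_le c chi M M' : sqsum_le c M -> sqsum_le chi M' ->
  normc (ser c chi) <= 2^-1 * (M + M').
Proof.
move=> cM chiM; have h : is_ser c chi (ser c chi).
  by apply: is_ser_ser; [exists M|exists M'].
apply: (normc_lim_le h); apply: nearW => N.
by apply: le_trans (sum_normc_le N cM chiM); exact: ler_normc_sum.
Qed.

Lemma is_serD c d chi l l' :
  is_ser c chi l -> is_ser d chi l' -> is_ser (c + d) chi (l + l').
Proof.
move=> cl dl; rewrite /is_ser.
under eq_fun => N do under eq_bigr do rewrite /GRing.add /= mulrDl.
by under eq_fun do rewrite big_split; exact: (@cvgD _ R[i]^o _ _ _ _ _ _ _ cl dl).
Qed.

Lemma is_serZ (k : R[i]) c chi l : is_ser c chi l -> is_ser (k *: c) chi (k * l).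
Proof.
move=> cl; rewrite /is_ser.
under eq_fun => N do under eq_bigr do rewrite /GRing.scale /= -mulrA.
under eq_fun do rewrite -mulr_sumr.
exact: cvgCZ.
Qed.

Lemma is_ser_eq c d chi psi l : (forall n, (0 < n)%N -> c n = d n) ->
  (forall n, (0 < n)%N -> chi n = psi n) ->
  is_ser c chi l -> is_ser d psi l.
Proof.
move=> cd cp; rewrite /is_ser.
suff -> : (fun N => \sum_(1 <= n < N.+1) c n * chi n) =
  (fun N => \sum_(1 <= n < N.+1) d n * psi n) by [].
apply/funext => N; apply: eq_big_nat => n /andP[n0 _].
by rewrite cd ?cp.
Qed.

(** The coefficients of [k^{-s} * \sum_n c_n n^{-s}]. *)
Definition dshift (k : nat) c : nat -> R[i] :=
  fun n => if (k %| n)%N then c (n %/ k)%N else 0.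

(** Only the multiples of [k] contribute, and [n = k m <= N] means [m <= N / k]. *)
Lemma dshift_sum (V : nmodType) (F : nat -> R[i] -> V) k c N : (0 < k)%N ->
  (forall n, F n 0 = 0) ->
  \sum_(1 <= n < N.+1) F n (dshift k c n) =
  \sum_(1 <= n < (N %/ k).+1) F (k * n)%N (c n).
Proof.
move=> k0 F0; elim: N => [|N IH]; first by rewrite div0n !big_geq.
rewrite big_nat_recr //= IH /dshift divnS//.
case: ifP => kN; last by rewrite F0 addr0 add0n.
have E : (k * (N %/ k).+1)%N = N.+1.
  by have := divnK kN; rewrite divnS// kN add1n mulnC.
by rewrite kN !add1n [RHS]big_nat_recr //= E.
Qed.

Lemma sqsum_le_dshift k c M : (0 < k)%N -> sqsum_le c M -> sqsum_le (dshift k c) M.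
Proof.
move=> k0 cM N.
rewrite (@dshift_sum _ (fun _ x => normc x ^+ 2))// => n.
by rewrite normc0 expr0n.
Qed.

Lemma l2_dshift k c : (0 < k)%N -> l2 c -> l2 (dshift k c).
Proof. by move=> k0 [M cM]; exists M; exact: sqsum_le_dshift. Qed.

Lemma is_ser_dshift k c chi l : (0 < k)%N -> is_char chi ->
  is_ser c chi l -> is_ser (dshift k c) chi (chi k * l).
Proof.
move=> k0 [_ chiM] cl; rewrite /is_ser.
have -> : (fun N => \sum_(1 <= n < N.+1) dshift k c n * chi n) =
    (fun N => chi k * \sum_(1 <= n < (N %/ k).+1) c n * chi n).
  apply/funext => N; rewrite (@dshift_sum _ (fun n x => x * chi n))//; last first.
    by move=> n; rewrite mul0r.
  rewrite mulr_sumr; apply: eq_big_nat => n /andP[n0 _].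
  by rewrite chiM// mulrCA.
apply: cvgCZ; apply: (cvg_comp (fun N => N %/ k)%N _ _ cl).
apply/cvgnyPge => A; exists (A * k)%N => // N /= AN.
by rewrite leq_divRL.
Qed.

(** The coefficients of the product of [\sum_n b_n n^{-s}] and the finite
series [\sum_{k <= K} c_k k^{-s}]. *)
Definition dconv b (K : nat) c : nat -> R[i] :=
  fun n => \sum_(1 <= k < K.+1) c k * dshift k b n.

Lemma dconv0 b c : dconv b 0 c = 0.
Proof. by apply/funext => n; rewrite /dconv big_geq. Qed.

Lemma dconvS b K c : dconv b K.+1 c = dconv b K c + c K.+1 *: dshift K.+1 b.
Proof. by apply/funext => n; rewrite /dconv big_nat_recr. Qed.

Lemma l2_dconv b K c : l2 b -> l2 (dconv b K c).
Proof.
move=> b2; elim: K => [|K IH]; first by rewrite dconv0; exact: l20.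
by rewrite dconvS; apply/l2D/l2Z/l2_dshift.
Qed.

Lemma is_ser0 chi : is_ser 0 chi 0.
Proof.
rewrite /is_ser (_ : (fun N => _) = (fun=> 0 : R[i]^o)); first exact: cvg_cst.
by apply/funext => N; rewrite big1// => n _; rewrite mul0r.
Qed.

(** Multiplicativity of [chi] turns every shift into the factor [chi k]; only
finitely many terms are rearranged, so no absolute convergence is involved. *)
Lemma is_ser_dconv b K c chi l : is_char chi -> is_ser b chi l ->
  is_ser (dconv b K c) chi (l * \sum_(1 <= k < K.+1) c k * chi k).
Proof.
move=> chiM bl; elim: K => [|K IH].
  by rewrite dconv0 big_geq ?mulr0; [exact: is_ser0|].
have -> : \sum_(1 <= k < K.+2) c k * chi k =
    \sum_(1 <= k < K.+1) c k * chi k + c K.+1 * chi K.+1.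
  by rewrite big_nat_recr.
rewrite dconvS mulrDr; apply: is_serD; first exact: IH.
by rewrite mulrCA [l * _]mulrC; apply/is_serZ/is_ser_dshift.
Qed.

End CharacterSeries.

(** * The characters [n^{-s}] and uniqueness of coefficients *)

Section PowerCharacter.
Variable R : realType.
Implicit Types (s z w : R[i]).

Lemma cexpD z w : cexp (z + w) = cexp z * cexp w.
Proof.
case: z => x y; case: w => x' y'; rewrite /cexp /= expRD cosD sinD.
by simpc; congr (_ +i* _); ring.
Qed.

Lemma cexp0 : cexp (0 : R[i]) = 1.
Proof. by rewrite /cexp /= expR0 cos0 sin0 mul1r. Qed.

Lemma normc_cexp z : normc (cexp z) = expR (complex.Re z).
Proof.
rewrite /cexp normcM normc_real ger0_norm ?expR_ge0//= cos2Dsin2 sqrtr1.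
by rewrite mulr1.
Qed.

Lemma nat_cpow_is_char s : is_char (fun n => nat_cpow n s).
Proof.
split=> [|k n k0 n0]; first by rewrite /nat_cpow ln1 mulr0 cexp0.
rewrite /nat_cpow -cexpD natrM lnM ?posrE ?ltr0n//.
by rewrite -mulrDr -rmorphD.
Qed.

Lemma normc_nat_cpow n s :
  normc (nat_cpow n s) = expR (complex.Re s * ln n%:R).
Proof. by case: s => x y; rewrite /nat_cpow normc_cexp /= mulr0 subr0. Qed.

(** Sorting [2, ..., 2N+1] into consecutive even-odd pairs gives
[S (2N+1) <= 1 + 2 q(2) S N], which bounds the partial sums when [2 q(2) < 1];
for [q n = n^{-p}] this is the condition [p > 1]. *)
Lemma dyadic_sum_bound (q : nat -> R) : (forall n, 0 <= q n) -> q 1%N = 1 ->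
  (forall n, (0 < n)%N -> q (2 * n)%N = q 2%N * q n) ->
  (forall n, (0 < n)%N -> q n.+1 <= q n) -> 2 * q 2%N < 1 ->
  forall N, \sum_(1 <= n < N.+1) q n <= (1 - 2 * q 2%N)^-1.
Proof.
move=> q0 q1 qM qd q2 N.
have double M : \sum_(1 <= n < (M.*2.+1).+1) q n <=
    1 + 2 * q 2%N * \sum_(1 <= n < M.+1) q n.
  elim: M => [|M IH]; first by rewrite [X in _ * X]big_geq// mulr0 addr0 big_nat1 q1.
  rewrite doubleS big_nat_recr// big_nat_recr//= (@big_nat_recr _ _ _ M.+1)//=.
  have E : q M.*2.+2 = q 2%N * q M.+1 by rewrite -qM// mul2n.
  have : q M.*2.+3 <= q M.*2.+2 by exact: qd.
  by move: IH; rewrite E; set A := \sum_(_ <= _ < _) _; set B := \sum_(_ <= _ < _) _; lra.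
have mono : \sum_(1 <= n < N.+1) q n <= \sum_(1 <= n < (N.*2.+1).+1) q n.
  rewrite [leRHS](@big_cat_nat _ _ _ N.+1) //=; last by lia.
  by rewrite lerDl; apply: sumr_ge0.
rewrite -[leRHS]mul1r ler_pdivlMr ?subr_gt0//.
have := double N; move: mono.
by set A := \sum_(_ <= _ < _) _; set B := \sum_(_ <= _ < _) _; lra.
Qed.

Lemma l2_nat_cpow s : half_plane s -> l2 (fun n => nat_cpow n (- s)).
Proof.
move=> hs; pose q n : R := normc (nat_cpow n (- s)) ^+ 2.
exists (1 - 2 * q 2%N)^-1 => N; apply: (@dyadic_sum_bound q).
- by move=> n; exact: sqr_ge0.
- by rewrite /q (nat_cpow_is_char (- s)).1 normc1 expr1n.
- by move=> n n0; rewrite /q (nat_cpow_is_char (- s)).2// normcM exprMn.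
- move=> n n0; rewrite /q lerXn2r ?nnegrE ?normc_ge0// !normc_nat_cpow.
  have s0 : 0 <= complex.Re s by apply: ltW; apply: lt_trans hs; rewrite invr_gt0.
  case: (s) s0 => x y /= s0; rewrite ler_expR !mulNr lerN2 ler_wpM2l//.
  by rewrite ler_ln ?posrE ?ltr0n// ler_nat.
- rewrite /q normc_nat_cpow; move: hs; rewrite /half_plane /=.
  case: (s) => x y /= hs; rewrite -expRM_natl -[X in X * _](@lnK _ 2) ?posrE//.
  rewrite -expRD -[ltRHS]expR0 ltr_expR.
  have := @ln_gt0 R 2; rewrite ltr1n => /(_ isT); nra.
Qed.

Lemma nat_cpow_nat n j : (0 < n)%N ->
  nat_cpow n (- j%:R) = ((n%:R^-1) ^+ j)%:C :> R[i].
Proof.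
move=> n0; rewrite /nat_cpow.
have -> : - j%:R * (ln n%:R)%:C = (- (j%:R * ln n%:R) : R)%:C :> R[i].
  by rewrite -(rmorph_nat (real_complex R)) -rmorphN -rmorphM /= mulNr.
rewrite /cexp /= cos0 sin0 -[1 +i* 0]/(1 : R[i]) mulr1.
by rewrite expRN expRM_natl lnK ?posrE ?ltr0n// exprVn.
Qed.

Lemma half_plane_nat j : (0 < j)%N -> half_plane (j%:R : R[i]).
Proof.
move=> j0; rewrite /half_plane /= -(rmorph_nat (real_complex R)) /=.
rewrite (@lt_le_trans _ _ 1) ?ler1n//.
by rewrite invf_lt1 ?ltr1n.
Qed.

End PowerCharacter.

Section Vanishing.
Variable R : realType.
Implicit Types (c : nat -> R[i]).

Let D c j := ser c (fun n => nat_cpow n (- j%:R)).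

(** After multiplication by [L^j], the character takes the values [(L / n)^j] for
[n >= L]; they are at most [(L / n)^2], hence square-summable uniformly in [j]. *)
Lemma dirichlet_growth c L : (0 < L)%N -> l2 c ->
  (forall n, (0 < n < L)%N -> c n = 0) ->
  exists B, forall j, (2 <= j)%N -> normc (D c j) * L%:R ^+ j <= B.
Proof.
move=> L0 [M cM] c0.
have [M' hM'] := l2_nat_cpow (@half_plane_nat R 2 isT).
exists (2^-1 * (M + (L%:R ^+ 2) ^+ 2 * M')) => j j2.
pose chi n : R[i] := if (n < L)%N then 0 else (L%:R ^+ j)%:C * nat_cpow n (- j%:R).
have Dchi : (L%:R ^+ j)%:C * D c j = ser c chi.
  apply/esym/is_ser_lim.
  have : is_ser ((L%:R ^+ j)%:C *: c) (fun n => nat_cpow n (- j%:R))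
      ((L%:R ^+ j)%:C * D c j).
    apply/is_serZ/is_ser_ser; first by exists M.
    by apply/l2_nat_cpow/half_plane_nat; exact: leq_trans j2.
  rewrite /is_ser; set f := (fun N => _); set g := (fun N => _).
  suff -> : f = g by [].
  apply/funext => N; apply: eq_big_nat => n /andP[n0 _].
  rewrite -[(_ *: c) n]/((L%:R ^+ j)%:C * c n) /chi.
  case: ifP => nL; last by rewrite [RHS]mulrCA [RHS]mulrA.
  by rewrite c0 ?n0// !(mulr0, mul0r).
have chiM : sqsum_le chi ((L%:R ^+ 2) ^+ 2 * M').
  apply: sqsum_le_mono (_ : sqsum_le ((L%:R ^+ 2)%:C *: (fun n => nat_cpow n (- 2%:R))) _).
    move=> n n0; rewrite /chi; case: ifPn => [_|]; first by rewrite normc0 normc_ge0.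
    rewrite -leqNgt => Ln.
    rewrite -[X in _ <= normc X]/((L%:R ^+ 2)%:C * nat_cpow n (- 2%:R)).
    rewrite !nat_cpow_nat// !normcM !normc_real.
    rewrite !ger0_norm ?exprn_ge0 ?invr_ge0// -!exprMn.
    rewrite ler_wiXn2l// ?mulr_ge0 ?invr_ge0//.
    by rewrite ler_pdivrMr ?ltr0n// mul1r ler_nat.
  by rewrite -[X in X ^+ 2 * _]ger0_norm ?exprn_ge0// -normc_real; exact: sqsum_leZ.
have -> : normc (D c j) * L%:R ^+ j = normc ((L%:R ^+ j)%:C * D c j).
  by rewrite normcM normc_real ger0_norm ?exprn_ge0// mulrC.
by rewrite Dchi; exact: normc_ser_le.
Qed.

(** If [c_n] is the first nonzero coefficient, the sum at [s = j] is [c_n n^{-j}]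
up to [O((n+1)^{-j})], which a bound [O(L^{-j})] with [n < L] contradicts. *)
Lemma dirichlet_vanish c L : l2 c ->
  (exists B, forall j, (2 <= j)%N -> normc (D c j) * L%:R ^+ j <= B) ->
  forall n, (0 < n < L)%N -> c n = 0.
Proof.
move=> c2 [B hB]; elim/ltn_ind => n IH /andP[n0 nL].
pose d m : R[i] := if m == n then c n else 0.
have d2 : l2 d.
  exists (normc (c n) ^+ 2) => N.
  apply: (@le_trans _ _ (\sum_(1 <= m < N.+1 | m == n) normc (c n) ^+ 2)).
    rewrite [leRHS]big_mkcond; apply: ler_sum => m _ /=; rewrite /d.
    by case: ifP => // _; rewrite normc0 expr0n.
  by rewrite big_nat1_eq; case: ifP => // _; exact: sqr_ge0.
have cpow2 j : (2 <= j)%N -> l2 (fun n => nat_cpow n (- j%:R) : R[i]).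
  by move=> j2; apply/l2_nat_cpow/half_plane_nat; exact: leq_trans j2.
have Dd j : (2 <= j)%N -> D d j = c n * ((n%:R^-1) ^+ j)%:C.
  move=> j2; apply: is_ser_lim; apply/cvgC_P => e e0.
  exists n => // N /= nN.
  rewrite (eq_bigr (fun m => if m == n then c n * ((n%:R^-1) ^+ j)%:C else 0)).
    by rewrite -big_mkcond big_nat1_eq n0 ltnS nN subrr normc0.
  move=> m _; rewrite /d; case: eqP => [->|_]; last by rewrite mul0r.
  by rewrite nat_cpow_nat.
have [B' hB'] : exists B, forall j, (2 <= j)%N ->
    normc (D (c - d) j) * n.+1%:R ^+ j <= B.
  apply: dirichlet_growth => //; first exact: l2B.
  move=> m /andP[m0]; rewrite ltnS leq_eqVlt => /predU1P[->|mn].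
    by rewrite !fctE /d eqxx subrr.
  by rewrite !fctE /d (ltn_eqF mn) subr0 IH// m0 (ltn_trans mn).
pose r : R := n%:R / n.+1%:R.
have r1 : `|r| < 1.
  rewrite ger0_norm ?mulr_ge0 ?invr_ge0// ltr_pdivrMr ?ltr0n// mul1r.
  by rewrite ltr_nat.
have key j : (2 <= j)%N -> normc (c n) <= (B + B') * r ^+ j.
  move=> j2.
  have Ej : c n * ((n%:R^-1) ^+ j)%:C = D c j - D (c - d) j.
    rewrite -Dd//; apply/esym; rewrite -[D (c - d) j](_ : D c j - D d j = _).
      by rewrite subKr.
    apply/esym/is_ser_lim; rewrite -[in - D d j]mulN1r; apply: is_serD.
      exact: is_ser_ser c2 (cpow2 j j2).
    by rewrite -scaleN1r; apply/is_serZ/is_ser_ser => //; exact: cpow2.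
  have Bj : normc (c n * ((n%:R^-1) ^+ j)%:C) * n.+1%:R ^+ j <= B + B'.
    rewrite Ej; apply: (@le_trans _ _
      ((normc (D c j) + normc (D (c - d) j)) * n.+1%:R ^+ j)).
      rewrite ler_wpM2r ?exprn_ge0// -[X in _ <= _ + X]normcN.
      exact: le_normcD.
    rewrite mulrDl; apply: lerD; last exact: hB'.
    apply: le_trans (hB j j2).
    by rewrite ler_wpM2l ?normc_ge0// lerXn2r ?nnegrE// ler_nat.
  move: Bj; rewrite normcM normc_real ger0_norm ?exprn_ge0 ?invr_ge0//.
  rewrite -mulrA -exprMn => Bj; rewrite /r exprMn mulrC.
  have n0' : (n%:R : R) != 0 by rewrite pnatr_eq0 -lt0n.
  rewrite -ler_pdivrMl; last by rewrite -exprMn exprn_gt0// divr_gt0 ?ltr0n.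
  by apply: le_trans Bj; rewrite mulrC -exprMn -exprVn invfM invrK.
have lim0 : (fun j => (B + B') * r ^+ j) @ \oo --> (0 : R).
  by rewrite -[X in _ --> X](mulr0 (B + B')); apply: cvgMl_tmp; exact: cvg_expr.
apply: eq0_normc; apply: le_anti; rewrite normc_ge0 andbT.
rewrite -(cvg_lim (@Rhausdorff R) lim0); apply: limr_ge; first by apply/cvg_ex; exists 0.
by exists 2%N => // j /= j2; exact: key.
Qed.

Lemma dirichlet_unique c : l2 c ->
  (forall s, half_plane s -> dirichlet_series c s = 0) ->
  forall n, (0 < n)%N -> c n = 0.
Proof.
move=> c2 c0 n n0; apply: (@dirichlet_vanish c n.+1) => //; last by rewrite n0 leqnn.
exists 0 => j j2; rewrite /D -[ser _ _]/(dirichlet_series c j%:R).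
by rewrite c0 ?normc0 ?mul0r//; apply: half_plane_nat; exact: leq_trans j2.
Qed.

End Vanishing.

(** * Monomials on the polydisc *)

Section PrimeEnumeration.

Lemma nth_prime_prime m : prime (nth_prime m).
Proof.
rewrite /nth_prime iterS /next_prime; case: ex_minnP => p /andP[_ pp] _.
exact: pp.
Qed.

Lemma ltn_nth_primeS m : (nth_prime m < nth_prime m.+1)%N.
Proof.
rewrite /nth_prime [X in (_ < X)%N]iterS {2}/next_prime.
by case: ex_minnP => p /andP[pp _] _.
Qed.

Lemma ltn_nth_prime m : (m.+1 < nth_prime m)%N.
Proof.
elim: m => [|m IH]; first exact: prime_gt1 (nth_prime_prime 0).
exact: leq_ltn_trans IH (ltn_nth_primeS m).
Qed.

Lemma nth_prime_inj : injective nth_prime.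
Proof.
apply: incn_inj; apply: leq_mono.
by apply: (homo_ltn ltn_trans); exact: ltn_nth_primeS.
Qed.

(** A prime at most [p_(m+1)] and above [p_m] is [p_(m+1)], the least such. *)
Lemma nth_prime_surj p : prime p -> exists m, p = nth_prime m.
Proof.
move=> pp; suff h m : (p <= nth_prime m)%N -> exists k, p = nth_prime k.
  by apply: (h p); rewrite ltnW// (ltn_trans _ (ltn_nth_prime p)).
elim: m => [|m IH] pm.
  exists 0%N; apply/eqP; rewrite eqn_leq pm /= /nth_prime /= /next_prime.
  by case: ex_minnP => q _ /(_ p) -> //; rewrite pp prime_gt0.
have [/IH//|mp] := leqP p (nth_prime m).
exists m.+1; apply/eqP; rewrite eqn_leq pm /= [nth_prime _]iterS /next_prime.
by case: ex_minnP => q _ /(_ p) -> //; rewrite pp mp.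
Qed.

End PrimeEnumeration.

Section BohrCharacters.
Variable R : realType.
Implicit Types (z : nat -> R[i]) (chi psi : nat -> R[i]).

(** The prime of rank [m] exceeds [m + 1], so the variables of rank at least [n]
do not occur in the monomial of [n]; a common range makes monomials multiply. *)
Lemma bohr_monomial_widen n N z : (0 < n)%N -> (n <= N)%N ->
  bohr_monomial n z = \prod_(m < N) z m ^+ logn (nth_prime m) n.
Proof.
move=> n0 nN; rewrite /bohr_monomial.
rewrite -(big_mkord xpredT (fun m => z m ^+ logn (nth_prime m) n)).
rewrite -(big_mkord xpredT (fun m => z m ^+ logn (nth_prime m) n)).
rewrite (@big_cat_nat _ _ _ n 0 N)//= [X in _ = _ * X]big_nat [X in _ = _ * X]big1 ?mulr1//.
move=> m /andP[nm _]; rewrite (_ : logn _ n = 0%N) ?expr0//.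
apply/eqP; rewrite -leqn0 leqNgt logn_gt0 mem_primes n0 nth_prime_prime /=.
apply/negP => /dvdn_leq => /(_ n0); apply/negP; rewrite -ltnNge.
by apply: leq_ltn_trans nm (ltn_trans (ltnSn m) (ltn_nth_prime m)).
Qed.

Lemma bohr_monomial_is_char z : is_char (fun n => bohr_monomial n z).
Proof.
split=> [|k n k0 n0]; first by rewrite /bohr_monomial big_ord1 logn1 expr0.
rewrite (@bohr_monomial_widen k (k * n))// ?leq_pmulr//.
rewrite (@bohr_monomial_widen n (k * n))// ?leq_pmull//.
by rewrite -big_split; apply: eq_bigr => m _; rewrite lognM// exprD.
Qed.

Lemma bohr_monomial_prime m z : bohr_monomial (nth_prime m) z = z m.
Proof.
have mp : (m < nth_prime m)%N by exact: ltn_trans (ltnSn m) (ltn_nth_prime m).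
rewrite /bohr_monomial (bigD1 (Ordinal mp))//= logn_prime ?nth_prime_prime//.
rewrite eqxx expr1 big1 ?mulr1// => i im.
rewrite logn_prime ?nth_prime_prime//; case: eqP => [/nth_prime_inj e|//].
by move/eqP: im; case; apply/val_inj.
Qed.

Lemma char_prime_ext chi psi : is_char chi -> is_char psi ->
  (forall p, prime p -> chi p = psi p) -> forall n, (0 < n)%N -> chi n = psi n.
Proof.
move=> [chi1 chiM] [psi1 psiM] h; elim/ltn_ind => n IH n0.
have [n1|n1] := leqP n 1.
  by have -> : n = 1%N by [apply/eqP; rewrite eqn_leq n1]; rewrite chi1 psi1.
have p0 := pdiv_gt0 n; have pp := pdiv_prime n1.
have q0 : (0 < n %/ pdiv n)%N by rewrite divn_gt0// dvdn_leq// pdiv_dvd.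
rewrite -(divnK (pdiv_dvd n)) chiM// psiM// (h (pdiv n))//; congr (_ * _).
by apply: IH => //; rewrite ltn_Pdiv// prime_gt1.
Qed.

Lemma bohr_monomial_nat_cpow n s : (0 < n)%N ->
  bohr_monomial n (fun m => nat_cpow (nth_prime m) (- s)) =
  nat_cpow n (- s) :> R[i].
Proof.
apply: (@char_prime_ext (fun n => bohr_monomial n _) (fun n => nat_cpow n _));
  [exact: bohr_monomial_is_char|exact: nat_cpow_is_char|].
by move=> _ /nth_prime_surj[m ->]; rewrite bohr_monomial_prime.
Qed.

(** Since [p_m > m + 1], the moduli [p_m^{-Re s}] are dominated by
[(m+1)^{-Re s}]. *)
Lemma polydisc_nat_cpow (s : R[i]) : half_plane s ->
  polydisc_l2 (fun m => nat_cpow (nth_prime m) (- s)).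
Proof.
move=> hs; have s0 : 0 < complex.Re s by apply: lt_trans hs; rewrite invr_gt0.
have pow_le (m n : nat) : (0 < n)%N -> (n <= m)%N ->
    normc (nat_cpow m (- s)) <= normc (nat_cpow n (- s)).
  move=> n0 nm; rewrite !normc_nat_cpow ler_expR.
  case: (s) s0 => x y /= s0; rewrite !mulNr lerN2; apply: ler_wpM2l; first exact: ltW.
  by rewrite ler_ln ?posrE ?ltr0n ?(leq_trans n0)// ler_nat.
split=> [m|].
  rewrite normc_nat_cpow; case: (s) s0 => x y /= s0.
  rewrite mulNr expRN invf_lt1 ?expR_gt0// -[ltLHS]expR0 ltr_expR mulr_gt0//.
  by rewrite ln_gt0// ltr1n prime_gt1// nth_prime_prime.
have [M hM] := l2_nat_cpow hs; apply: (@le_lt_trans _ _ M%:E); last exact: ltry.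
apply: lime_le.
  by apply: is_cvg_nneseries => // n _ _; rewrite lee_fin sqr_ge0.
apply: nearW => N; rewrite sumEFin lee_fin; apply: le_trans (hM N).
rewrite big_add1 /=; apply: ler_sum => m _.
rewrite lerXn2r ?nnegrE ?normc_ge0//; apply: pow_le => //.
by rewrite ltnW// ltn_nth_prime.
Qed.

End BohrCharacters.

Section BohrSquareSummable.
Variable R : realType.
Implicit Types (z : nat -> R[i]).

Let q z m : R := normc (z m) ^+ 2.

(** Weierstrass' inequality keeps the partial products of [1 - q_m] away from
zero, from a rank on where the tail of [\sum q_m] is below 1/2. *)
Lemma prod_1sub_ge (u : nat -> R) (B : R) :
  (forall m, 0 <= u m < 1) -> (forall N, \sum_(0 <= m < N) u m <= B) ->
  exists2 d : R, 0 < d & forall N, d <= \prod_(0 <= m < N) (1 - u m).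
Proof.
move=> u01 uB.
have u0 m : 0 <= u m by case/andP: (u01 m).
have v0 m : 0 < 1 - u m by rewrite subr_gt0; case/andP: (u01 m).
have v1 m : 1 - u m <= 1 by rewrite gerBl.
have nd : nondecreasing_seq (fun N => \sum_(0 <= m < N) u m).
  by apply/nondecreasing_seqP => N; rewrite big_nat_recr//= lerDl.
have cv : cvgn (fun N => \sum_(0 <= m < N) u m).
  by apply: nondecreasing_is_cvgn => //; exists B => _ [N _ <-].
have [k hk] : exists k, forall N, \sum_(k <= m < N) u m <= 2^-1.
  have h2 : (0 : R) < 2^-1 by rewrite invr_gt0.
  have /cvgrPdist_lt/(_ _ h2)[k _ hk] := cv; exists k => N.
  have [kN|Nk] := leqP k N; last by rewrite big_geq ?invr_ge0// ltnW.
  have := hk k (leqnn k); have /= := nondecreasing_cvgn_le nd cv N.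
  rewrite (@big_cat_nat _ _ _ k 0 N)//=; set l := limn _.
  by move=> h1; rewrite ltr_norml => /andP[_ h3]; move: h1 h3; lra.
have P0 a b : 0 < \prod_(a <= m < b) (1 - u m) by apply: prodr_gt0.
have tail N : 1 - \sum_(k <= m < N) u m <= \prod_(k <= m < N) (1 - u m).
  elim: N => [|N IH]; first by rewrite !big_geq// subr0.
  have [kN|Nk] := leqP k N; last by rewrite !big_geq// subr0.
  rewrite !big_nat_recr//= mulrBr mulr1 opprD addrA lerB//.
  have : \prod_(k <= m < N) (1 - u m) <= 1.
    by apply: prodr_ile1 => m _; rewrite (ltW (v0 m)) v1.
  by move=> h; rewrite ler_piMl.
exists (2^-1 * \prod_(0 <= m < k) (1 - u m)).
  by rewrite mulr_gt0// invr_gt0.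
move=> N; have [kN|Nk] := leqP k N.
  rewrite (@big_cat_nat _ _ _ k 0 N)//= mulrC ler_pM2l//.
  by have := hk N; have := tail N; lra.
rewrite (@big_cat_nat _ _ _ N 0 k) ?(ltnW Nk)//= mulrCA ler_piMr ?ltW//.
have : \prod_(N <= m < k) (1 - u m) <= 1.
  by apply: prodr_ile1 => m _; rewrite (ltW (v0 m)) v1.
by have := P0 N k; lra.
Qed.

(** Euler's product, as an inequality obtained by adding the coordinates one by
one: an integer is either prime to [p_M] or [p_M] times another one, so that
the partial sums [S_M] over the integers built from the first [M] primes satisfy
[S_(M+1) <= S_M + q_M S_(M+1)]. *)
Lemma l2_bohr_monomial z : polydisc_l2 z -> l2 (fun n => bohr_monomial n z).
Proof.
move=> [z1 zsum].
have [||d d0 hd] := @prod_1sub_ge (q z) (fine (\sum_(0 <= m <oo) (q z m)%:E)%E).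
- by move=> m; rewrite /q sqr_ge0 /= exprn_ilt1 ?normc_ge0.
- move=> N; rewrite -lee_fin fineK; last first.
    rewrite ge0_fin_numE//; apply: nneseries_ge0 => n _ _.
    by rewrite lee_fin sqr_ge0.
  rewrite -sumEFin; apply: nneseries_lim_ge => m _ _.
  by rewrite lee_fin sqr_ge0.
(* Setting to 0 the variables from rank [M] on leaves the integers built from
   the first [M] primes. *)
pose zt M m : R[i] := if (m < M)%N then z m else 0.
pose S M N : R := \sum_(1 <= n < N.+1) normc (bohr_monomial n (zt M)) ^+ 2.
have S0 M N : 0 <= S M N by apply: sumr_ge0 => n _; exact: sqr_ge0.
have step M N : S M.+1 N * (1 - q z M) <= S M N.
  rewrite mulrBr mulr1 lerBlDr.
  pose p := nth_prime M; have pp : prime p := nth_prime_prime M.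
  pose b := fun n => bohr_monomial n (zt M.+1).
  apply: (@le_trans _ _ (\sum_(1 <= n < N.+1)
    (normc (bohr_monomial n (zt M)) ^+ 2 + q z M * normc (dshift p b n) ^+ 2))).
    rewrite /S !big_nat; apply: ler_sum => n /andP[n0 _].
    have [pn|pn] := boolP (p %| n)%N.
      rewrite /dshift pn -{1}(divnK pn) mulnC (bohr_monomial_is_char _).2//.
      + by rewrite bohr_monomial_prime /zt ltnSn normcM exprMn lerDr sqr_ge0.
      + exact: prime_gt0.
      + by rewrite divn_gt0 ?prime_gt0// dvdn_leq.
    rewrite (_ : bohr_monomial n (zt M.+1) = bohr_monomial n (zt M)).
      by rewrite lerDl mulr_ge0 ?sqr_ge0.
    apply: eq_bigr => m _; have [->|mM] := eqVneq (m : nat) M.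
      rewrite (_ : logn _ n = 0%N) ?expr0//; apply/eqP.
      by rewrite -leqn0 leqNgt logn_gt0 mem_primes n0 pp.
    by rewrite /zt ltnS leq_eqVlt (negPf mM).
  rewrite big_split /= lerD// -mulr_sumr mulrC ler_wpM2r ?sqr_ge0//.
  rewrite (@dshift_sum _ _ (fun _ x => normc x ^+ 2)) ?prime_gt0//; last first.
    by move=> n; rewrite normc0 expr0n.
  rewrite /S [leRHS](@big_cat_nat _ _ _ (N %/ p).+1) //=.
    by rewrite lerDl; apply: sumr_ge0 => n _; exact: sqr_ge0.
  by rewrite ltnS leq_div.
have SM M N : S M N * \prod_(0 <= m < M) (1 - q z m) <= 1.
  elim: M => [|M IH].
    rewrite big_geq// mulr1 /S.
    apply: (@le_trans _ _ (\sum_(1 <= n < N.+1 | n == 1%N) (1 : R))).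
      rewrite [leRHS]big_mkcond !big_nat; apply: ler_sum => n /andP[n0 _].
      case: eqP => [->|/eqP n1].
        by rewrite (bohr_monomial_is_char _).1 normc1 expr1n.
      have n1' : (1 < n)%N by rewrite ltn_neqAle eq_sym n1.
      have [m em] := nth_prime_surj (pdiv_prime n1').
      have k0 : (0 < n %/ pdiv n)%N by rewrite divn_gt0 ?pdiv_gt0// dvdn_leq// pdiv_dvd.
      rewrite -(divnK (pdiv_dvd n)) (bohr_monomial_is_char _).2 ?pdiv_gt0//.
      by rewrite em bohr_monomial_prime /zt mulr0 normc0 expr0n.
    by rewrite big_nat1_eq; case: ifP.
  rewrite big_nat_recr//= [X in _ * X]mulrC mulrA.
  apply: le_trans IH; rewrite ler_wpM2r// prodr_ge0// => m _.
  by rewrite subr_ge0 expr_le1 ?normc_ge0// ltW.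
exists d^-1 => N.
have -> : \sum_(1 <= n < N.+1) normc (bohr_monomial n z) ^+ 2 = S N N.
  apply: eq_big_nat => n /andP[_ nN]; congr (normc _ ^+ 2).
  by apply: eq_bigr => m _; rewrite /zt (leq_trans (ltn_ord m)).
rewrite -[leRHS]mul1r ler_pdivlMr//; apply: le_trans (SM N N).
by rewrite ler_wpM2l.
Qed.

End BohrSquareSummable.

Section CoordinatePolynomials.
Variable R : realType.
Implicit Types (z c : nat -> R[i]).

Lemma finite_bohr_polynomial (K : nat) c :
  coord_polynomial (fun z => \sum_(1 <= k < K.+1) c k * bohr_monomial k z).
Proof.
exists K; exists (\sum_(1 <= k < K.+1) c k *:
  \prod_(i < K) (mpolyX R[i] (mnm1 i)) ^+ logn (nth_prime i) k).
apply/funext => z; rewrite rmorph_sum /=; apply: eq_big_nat => k /andP[k0 kK].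
rewrite mevalZ rmorph_prod (@bohr_monomial_widen _ k K)//.
by congr (_ * _); apply: eq_bigr => i _; rewrite rmorphXn /= mevalXU.
Qed.

(** Unique factorization: the monomial with exponents [m i] is that of the integer
[\prod_i p_i ^ m i]. *)
Lemma coord_polynomialP (P : (nat -> R[i]) -> R[i]) : coord_polynomial P ->
  exists K c, forall z, P z = \sum_(1 <= k < K.+1) c k * bohr_monomial k z.
Proof.
move=> [n [p ->]].
pose A (F : (nat -> R[i]) -> R[i]) :=
  exists K c, forall z, F z = \sum_(1 <= k < K.+1) c k * bohr_monomial k z.
have A0 : A (fun=> 0) by exists 0%N, 0 => z; rewrite big_geq.
have Aext F K c K' : (forall z, F z = \sum_(1 <= k < K.+1) c k * bohr_monomial k z) ->
    (K <= K')%N -> exists c', forall z, F z =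
       \sum_(1 <= k < K'.+1) c' k * bohr_monomial k z.
  move=> hF KK; exists (fun k => if (k <= K)%N then c k else 0) => z.
  rewrite hF (@big_cat_nat _ _ _ K.+1 1 K'.+1)//= [X in _ = _ + X]big_nat.
  rewrite [X in _ = _ + X]big1 ?addr0; last first.
    by move=> k /andP[Kk _]; rewrite leqNgt Kk mul0r.
  by apply: eq_big_nat => k /andP[_ kK]; rewrite -ltnS kK.
have AD F G : A F -> A G -> A (fun z => F z + G z).
  move=> [K [c hF]] [K' [c' hG]].
  have [d hd] := Aext _ _ _ (maxn K K') hF (leq_maxl _ _).
  have [d' hd'] := Aext _ _ _ (maxn K K') hG (leq_maxr _ _).
  exists (maxn K K'), (fun k => d k + d' k) => z.
  by rewrite hd hd' -big_split; apply: eq_bigr => k _; rewrite mulrDl.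
have Amon (a : R[i]) N : (0 < N)%N -> A (fun z => a * bohr_monomial N z).
  move=> N0; exists N, (fun k => if k == N then a else 0) => z.
  rewrite (eq_bigr (fun k => if k == N then a * bohr_monomial N z else 0)).
    by rewrite -big_mkcond big_nat1_eq N0 ltnSn.
  by move=> k _; case: eqP => [->//|_]; rewrite mul0r.
have prodchar z (m : 'I_n -> nat) (s : seq 'I_n) :
    bohr_monomial (\prod_(i <- s) nth_prime i ^ m i)%N z =
      \prod_(i <- s) z i ^+ m i.
  have [h1 hM] := bohr_monomial_is_char z.
  have p0 (i : nat) : (0 < nth_prime i)%N by rewrite prime_gt0// nth_prime_prime.
  elim: s => [|i s IH]; first by rewrite !big_nil h1.
  rewrite !big_cons hM ?expn_gt0 ?p0//; last first.
    by rewrite prodn_gt0// => j; rewrite expn_gt0 p0.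
  rewrite IH; congr (_ * _); elim: (m i) => [|e IHe]; first by rewrite expn0 h1.
  by rewrite expnS exprS hM ?expn_gt0 ?p0// IHe bohr_monomial_prime.
suff : A (fun z => \sum_(m <- msupp p)
    mcoeff m p * \prod_(i < n) z i ^+ m i).
  by move=> [K [c h]]; exists K, c => z; rewrite mevalE h.
elim: (msupp _) => [|m s IH].
  by have [K [c h]] := A0; exists K, c => z; rewrite big_nil -h.
have := AD _ _ (Amon (mcoeff m p) (\prod_(i < n) nth_prime i ^ m i)%N _) IH.
case=> [|K [c h]].
  by rewrite prodn_gt0// => j; rewrite expn_gt0 prime_gt0// nth_prime_prime.
by exists K, c => z; rewrite big_cons -h prodchar.
Qed.

End CoordinatePolynomials.

(** * Dirichlet convolution and boundedness of multipliers *)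

Section DirichletConvolution.
Variable R : realType.
Implicit Types (f g mu nu : nat -> R[i]) (M C : R).

(** The Dirichlet convolution [\sum_(k | n) f k * g (n / k)]; the divisors of [n]
are among [1, ..., n], whence the cut-off of [dconv] at [n]. *)
Definition dmul f g : nat -> R[i] := fun n => dconv g n f n.

Lemma dshift_gt0 k g n : (0 < n < k)%N -> dshift k g n = 0.
Proof.
move=> /andP[n0 nk]; rewrite /dshift ifF//; apply/negP => /(dvdn_leq n0).
by rewrite leqNgt nk.
Qed.

Lemma dconv_dmul f g n K : (0 < n)%N -> (forall k, (K < k)%N -> f k = 0) ->
  dconv g K f n = dmul f g n.
Proof.
move=> n0 fK; rewrite /dmul /dconv.
have ext m : (m <= maxn n K)%N ->
    (forall k, (m < k <= maxn n K)%N -> f k * dshift k g n = 0) ->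
    \sum_(1 <= k < m.+1) f k * dshift k g n =
    \sum_(1 <= k < (maxn n K).+1) f k * dshift k g n.
  move=> mK h; rewrite [RHS](@big_cat_nat _ _ _ m.+1)//=.
  by rewrite [X in _ + X]big_nat [X in _ + X]big1 ?addr0.
rewrite !ext ?leq_maxl ?leq_maxr// => k /andP[hk _].
  by rewrite dshift_gt0 ?mulr0// n0.
by rewrite fK ?mul0r.
Qed.

Lemma dmulC f g n : (0 < n)%N -> dmul f g n = dmul g f n.
Proof.
move=> n0; rewrite /dmul /dconv.
have E u v : \sum_(1 <= k < n.+1) u k * dshift k v n =
    \sum_(1 <= k < n.+1) \sum_(1 <= l < n.+1)
       (if (k * l)%N == n then u k * v l else 0) :> R[i].
  apply: eq_big_nat => k /andP[k0 _]; rewrite /dshift; case: ifPn => kn.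
    rewrite (eq_big_nat _ _ (F2 := fun l => if l == (n %/ k)%N then
        u k * v (n %/ k)%N else 0)); last first.
      move=> l _; rewrite -(divnK kn) mulnC eqn_mul2r mulnK// (gtn_eqF k0) /=.
      by case: eqP => [->//|].
    rewrite -big_mkcond big_nat1_eq divn_gt0// dvdn_leq//= ltnS leq_div//.
  rewrite mulr0 big1// => l _; case: eqP => // e.
  by rewrite -e dvdn_mulr in kn.
rewrite !E exchange_big; apply: eq_bigr => k _; apply: eq_bigr => l _.
by rewrite mulnC mulrC.
Qed.

Lemma dmulDl f g nu n : dmul (f + g) nu n = dmul f nu n + dmul g nu n.
Proof.
by rewrite /dmul /dconv -big_split /=; apply: eq_bigr => k _; rewrite -mulrDl.
Qed.

Lemma dmulZl (a : R[i]) f nu n : dmul (a *: f) nu n = a * dmul f nu n.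
Proof.
by rewrite /dmul /dconv mulr_sumr; apply: eq_bigr => k _; rewrite mulrA.
Qed.

Lemma dmul_eql f g nu n : (forall k, (0 < k <= n)%N -> f k = g k) ->
  dmul f nu n = dmul g nu n.
Proof. by move=> h; apply: eq_big_nat => k hk; rewrite h. Qed.

(** Finitely many coordinates of [f] contribute boundedly to the convolution by a
square-summable [nu]; the bound is uniform in [f]. *)
Lemma sqsum_le_dconv_coef L : forall nu M, sqsum_le nu M ->
  exists2 C : R, 0 <= C & forall f M', sqsum_le f M' -> sqsum_le (dconv nu L f) (C * M').
Proof.
move=> nu M hM; elim: L => [|L [C C0 IH]].
  by exists 0 => // f M' _; rewrite dconv0 mul0r; exact: sqsum_le0.
exists (2 * C + 2 * M).
  by have M0 := sqsum_le_ge0 hM; rewrite addr_ge0 ?mulr_ge0.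
move=> f M' hf; rewrite dconvS mulrDl -!mulrA; apply: sqsum_leD; first exact: IH.
have fL : normc (f L.+1) ^+ 2 <= M'.
  apply: le_trans (hf L.+1); rewrite big_nat_recr//= lerDr.
  by apply: sumr_ge0 => n _; exact: sqr_ge0.
apply: (@sqsum_le_le _ _ (normc (f L.+1) ^+ 2 * M)).
  by rewrite mulrC ler_wpM2l//; exact: sqsum_le_ge0 hM.
by apply: sqsum_leZ; exact: sqsum_le_dshift.
Qed.

(** Here the finite combination of shifts is fixed, and the bound is uniform in the
sequence [nu] that is shifted. *)
Lemma sqsum_le_dconv f L : exists2 C : R, 0 <= C & forall nu M, sqsum_le nu M ->
  sqsum_le (dconv nu L f) (C * M).
Proof.
elim: L => [|L [C C0 IH]].
  by exists 0 => // nu M _; rewrite dconv0 mul0r; exact: sqsum_le0.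
exists (2 * C + 2 * normc (f L.+1) ^+ 2).
  by apply: addr_ge0; apply: mulr_ge0 => //; exact: sqr_ge0.
move=> nu M hM; rewrite dconvS mulrDl -[2 * C * M]mulrA -[2 * (_ ^+ 2) * M]mulrA.
apply: sqsum_leD; first exact: IH.
by apply: sqsum_leZ; exact: sqsum_le_dshift.
Qed.

Definition upto L f : nat -> R[i] := fun k => if (k <= L)%N then f k else 0.

Lemma sqsum_le_tail L f M : sqsum_le f M -> sqsum_le (f - upto L f) M.
Proof.
apply: sqsum_le_mono => n _; rewrite /upto !fctE.
by case: ifP => _; rewrite ?subr0// subrr normc0 normc_ge0.
Qed.

Lemma l2_tail f (e : R) : l2 f -> 0 < e -> exists L, sqsum_le (f - upto L f) e.
Proof.
move=> [M fM] e0; pose S N : R := \sum_(1 <= n < N.+1) normc (f n) ^+ 2.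
have nd : nondecreasing_seq S.
  by apply/nondecreasing_seqP => N; rewrite /S [leRHS]big_nat_recr//= lerDl sqr_ge0.
have cv : cvgn S.
  by apply: nondecreasing_is_cvgn => //; exists M => _ [N _ <-]; exact: fM.
have /cvgrPdist_lt/(_ _ e0)[L _ hL] := cv; exists L => N.
apply: (@le_trans _ _ (S (maxn L N) - S L)); last first.
  have := hL L (leqnn L); have := nondecreasing_cvgn_le nd cv (maxn L N).
  by rewrite ltr_norml => h1 /andP[_ h2]; move: h1 h2 => /=; lra.
rewrite /S (@big_cat_nat _ _ _ L.+1 1 (maxn L N).+1) ?ltnS ?leq_maxl//=.
rewrite addrAC subrr add0r.
apply: (@le_trans _ _ (\sum_(1 <= n < (maxn L N).+1)
    normc ((f - upto L f) n) ^+ 2)).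
  rewrite [leRHS](@big_cat_nat _ _ _ N.+1)//= ?ltnS ?leq_maxr//.
  by rewrite lerDl; apply: sumr_ge0 => n _; exact: sqr_ge0.
rewrite (@big_cat_nat _ _ _ L.+1 1 (maxn L N).+1) ?ltnS ?leq_maxl//=.
rewrite big_nat big1 ?add0r; last first.
  by move=> n /andP[_ nL]; rewrite !fctE /upto -ltnS nL subrr normc0 expr0n.
rewrite !big_nat; apply: ler_sum => n /andP[Ln _].
by rewrite !fctE /upto leqNgt Ln subr0.
Qed.

End DirichletConvolution.

Section Boundedness.
Variable R : realType.
Implicit Types (f g x y : nat -> R[i]) (M C : R).

(** A gliding hump: were [f |-> f * mu] unbounded, it would be unbounded on the
sequences supported beyond any given rank, since finitely many coordinates
contribute boundedly.  Adding up such finitely supported sequences, each one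
starting after the end of the previous ones and with an image large compared to
theirs, produces a square-summable sequence whose image is not. *)
Lemma dmul_bounded (mu : nat -> R[i]) : l2 mu ->
  (forall f, l2 f -> l2 (dmul f mu)) ->
  exists2 C : R, 0 <= C & forall L f,
    \sum_(1 <= n < L.+1) normc (dmul f mu n) ^+ 2 <=
    C * \sum_(1 <= n < L.+1) normc (f n) ^+ 2.
Proof.
move=> [Mmu hmu] Tl2; pose S f L : R := \sum_(1 <= n < L.+1) normc (f n) ^+ 2.
have S0 f L : 0 <= S f L by apply: sumr_ge0 => n _; exact: sqr_ge0.
(* Bounds on initial segments with the same [L] on both sides are possible
   because the convolution at [n] only involves indices up to [n]. *)
pose bdd := exists2 C : R, 0 <= C &
  forall L f, S (dmul f mu) L <= C * S f L.
suff : bdd by [].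
apply: contrapT => nbdd.
have nbdd_tail N C : 0 <= C -> exists L y,
    [/\ (forall k, (k <= N)%N -> y k = 0),
        (forall k, (L < k)%N -> y k = 0) & C * S y L < S (dmul y mu) L].
  move=> C0; apply: contrapT => nex; apply: nbdd.
  have [C' C'0 hC'] := sqsum_le_dconv_coef N hmu.
  exists (2 * C' + 2 * C); first by rewrite addr_ge0 ?mulr_ge0.
  move=> L f; pose hf := upto L f.
  have hfS : sqsum_le hf (S f L).
    move=> K; rewrite /S; have [KL|LK] := leqP K L.
      rewrite [leRHS](@big_cat_nat _ _ _ K.+1)//=.
      apply: (@le_trans _ _ (\sum_(1 <= n < K.+1) normc (f n) ^+ 2)).
        rewrite !big_nat; apply: ler_sum => n /andP[_ nK].
        by rewrite /hf /upto (leq_trans _ KL).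
      by rewrite lerDl; apply: sumr_ge0 => n _; exact: sqr_ge0.
    rewrite (@big_cat_nat _ _ _ L.+1)//=; last by rewrite ltnW.
    rewrite [X in _ + X]big_nat [X in _ + X]big1 ?addr0.
      rewrite !big_nat; apply: ler_sum => n /andP[_ nK].
      by rewrite /hf /upto -ltnS nK.
    by move=> n /andP[Ln _]; rewrite /hf /upto leqNgt Ln normc0 expr0n.
  have b1 : S (dmul (upto N hf) mu) L <= C' * S f L.
    apply: le_trans (hC' _ _ hfS L); rewrite /S !big_nat.
    apply: ler_sum => n /andP[n0 _].
    rewrite -(@dconv_dmul _ _ _ _ N)//; last first.
      by move=> k Nk; rewrite /upto leqNgt Nk.
    rewrite (_ : dconv mu N (upto N hf) n = dconv mu N hf n)//.
    by apply: eq_big_nat => k /andP[_ kN]; rewrite {1}/upto -ltnS kN.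
  have b2 : S (dmul (hf - upto N hf) mu) L <= C * S f L.
    rewrite leNgt; apply/negP => lt; apply: nex; exists L, (hf - upto N hf); split.
    - by move=> k kN; rewrite !fctE /upto kN subrr.
    - move=> k Lk; rewrite !fctE /upto; case: ifP => _; rewrite /hf /upto.
        by rewrite leqNgt Lk subrr.
      by rewrite leqNgt Lk subr0.
    - apply: le_lt_trans lt; rewrite ler_wpM2l//.
      by apply: le_trans (sqsum_le_tail N hfS L).
  have Tf n : (0 < n <= L)%N -> dmul f mu n =
      dmul (upto N hf) mu n + dmul (hf - upto N hf) mu n.
    move=> /andP[n0 nL]; rewrite -dmulDl; apply: dmul_eql => k /andP[_ kn].
    by rewrite !fctE addrC subrK /hf /upto (leq_trans kn nL).
  apply: (@le_trans _ _ (2 * S (dmul (upto N hf) mu) L +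
      2 * S (dmul (hf - upto N hf) mu) L)).
    rewrite /S !mulr_sumr -big_split /= !big_nat.
    by apply: ler_sum => n hn; rewrite Tf//; exact: sqr_normcD.
  by move: b1 b2; lra.
(* A state is a finitely supported sequence together with the end of its
   support.  Square norms are kept below 2 by giving each new hump half of the
   room left. *)
pose inv (s : nat * (nat -> R[i])) :=
  (exists2 m : R, m < 2 & sqsum_le s.2 m) /\ forall k, (s.1 < k)%N -> s.2 k = 0.
pose next (s s' : {s | inv s}) := [/\ ((sval s).1 < (sval s').1)%N,
  (forall k, (k <= (sval s).1)%N -> (sval s').2 k = (sval s).2 k) &
  (sval s).1%:R <= S (dmul (sval s').2 mu) (sval s').1].
have step s : exists s', next s s'.
  case: s => -[N y] ps; have [[m m2 /= ym] /= yN] := ps.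
  have [My hMy] : l2 (dmul y mu) by apply: Tl2; exists m.
  pose e : R := (2 - m) / 2; have e0 : 0 < e by rewrite divr_gt0// subr_gt0.
  pose D : R := 2 * N%:R + 2 * My.
  have My0 := sqsum_le_ge0 hMy.
  have D0 : 0 <= D by rewrite addr_ge0 ?mulr_ge0.
  have [L [x [xN xL hx]]] := nbdd_tail N (D / e) (divr_ge0 D0 (ltW e0)).
  have Sx0 : 0 < S x L.
    rewrite lt_neqAle S0 andbT; apply/eqP => Sx.
    have x0 k : (0 < k <= L)%N -> x k = 0.
      move=> /andP[k0 kL]; apply: eq0_normc; apply/eqP.
      rewrite -sqrf_eq0.
      move/esym/eqP: Sx; rewrite /S psumr_eq0; last by move=> n _; exact: sqr_ge0.
      move/allP/(_ k); rewrite mem_index_iota k0 ltnS kL => /(_ isT).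
      by [].
    move: hx; rewrite -Sx mulr0 /S big_nat big1 ?ltxx// => n /andP[n0 nL].
    rewrite (@dmul_eql _ _ 0); last first.
      by move=> k /andP[k0 kn]; rewrite x0// k0 (leq_trans kn).
    rewrite /dmul /dconv big1 ?normc0 ?expr0n// => k _.
    by rewrite mul0r.
  (* The hump is normalized to have square norm [e]. *)
  pose t := Num.sqrt (e / S x L).
  have t2 : t ^+ 2 = e / S x L by rewrite sqr_sqrtr// divr_ge0// ltW.
  pose xt := t%:C *: x; pose y' := y + xt.
  have xtS : sqsum_le xt e.
    have -> : e = normc t%:C ^+ 2 * S x L.
      by rewrite normc_real real_normK ?num_real// t2 divfK ?gt_eqF.
    apply: sqsum_leZ => K; rewrite /S.
    have [KL|LK] := leqP K L.
      rewrite [leRHS](@big_cat_nat _ _ _ K.+1)//= lerDl.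
      by apply: sumr_ge0 => n _; exact: sqr_ge0.
    rewrite (@big_cat_nat _ _ _ L.+1)//=; last by rewrite ltnW.
    rewrite [X in _ + X]big_nat [X in _ + X]big1 ?addr0//.
    by move=> n /andP[Ln _]; rewrite xL// normc0 expr0n.
  pose N' := (maxn N L).+1.
  have inv' : inv (N', y').
    split=> /=.
      exists (m + e); first by rewrite /e; lra.
      move=> K; apply: le_trans (lerD (ym K) (xtS K)); rewrite -big_split /=.
      apply: ler_sum => k _; have [kN|Nk] := leqP k N.
        by rewrite /y' /xt !fctE xN// scaler0 addr0 lerDl sqr_ge0.
      by rewrite /y' !fctE yN// add0r lerDr sqr_ge0.
    move=> k N'k.
    have [Nk Lk] : (N < k)%N /\ (L < k)%N by move: N'k; rewrite /N'; lia.
    by rewrite /y' /xt !fctE yN// xL// scaler0 addr0.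
  exists (exist _ (N', y') inv'); split => /=.
  - by rewrite /N' ltnS leq_maxl.
  - by move=> k kN; rewrite /y' /xt !fctE xN// scaler0 addr0.
  have big_xt : D < S (dmul xt mu) L.
    have -> : S (dmul xt mu) L = t ^+ 2 * S (dmul x mu) L.
      rewrite /S mulr_sumr; apply: eq_bigr => n _.
      by rewrite dmulZl normcM exprMn normc_real real_normK ?num_real.
    rewrite t2 mulrAC ltr_pdivlMr// mulrC -ltr_pdivrMl//.
    by have -> : e^-1 * (S x L * D) = D / e * S x L by ring.
  have LN' : (L <= N')%N by rewrite /N' ltnW// ltnS leq_maxr.
  have le1 : S (dmul y' mu) L <= S (dmul y' mu) N'.
    rewrite /S [leRHS](@big_cat_nat _ _ _ L.+1)//= lerDl.
    by apply: sumr_ge0 => n _; exact: sqr_ge0.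
  have le2 : S (dmul xt mu) L <= 2 * S (dmul y' mu) L + 2 * S (dmul y mu) L.
    rewrite /S !mulr_sumr -big_split /=; apply: ler_sum => n _.
    have -> : dmul xt mu n = dmul y' mu n + - dmul y mu n.
      by rewrite dmulDl addrAC subrr add0r.
    by rewrite -[X in _ <= _ + 2 * X ^+ 2]normcN; exact: sqr_normcD.
  have := hMy L; rewrite -/(S (dmul y mu) L); move: big_xt le1 le2; rewrite /D.
  lra.
have inv0 : inv (0%N, 0).
  by split => /=; [exists 0 => //; exact: sqsum_le0|].
have [s [s0 hs]] := @dependent_choice _ next (fun s => cid (step s)) (exist _ _ inv0).
pose N j := (sval (s j)).1; pose y j := (sval (s j)).2.
have Nge j : (j <= N j)%N.
  by elim: j => // j IH; have [h _ _] := hs j; exact: leq_ltn_trans IH h.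
have Nmono i j : (i <= j)%N -> (N i <= N j)%N.
  move=> ij; rewrite -(subnK ij); elim: (j - i)%N => // d IH.
  by rewrite addSn; have [h _ _] := hs (d + i)%N; apply: leq_trans IH (ltnW h).
have agree i j k : (i <= j)%N -> (k <= N i)%N -> y j k = y i k.
  move=> ij kN; rewrite -(subnK ij); elim: (j - i)%N => // d IH.
  rewrite addSn; have [_ h _] := hs (d + i)%N; rewrite -IH; apply: h.
  by apply: leq_trans kN _; apply: Nmono; rewrite leq_addl.
(* The limit sequence agrees with [y j] up to [N j], and [j <= N j]. *)
pose x k := y k k.
have xy j k : (k <= N j)%N -> x k = y j k.
  move=> kN; rewrite /x; have [jk|kj] := leqP j k; first exact: agree.
  by apply/esym/agree => //; exact: ltnW.
have x2 : l2 x.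
  exists 2 => K; have [[m m2 ym] _] := svalP (s K).
  apply: le_trans (ltW m2); apply: le_trans (ym K).
  rewrite !big_nat; apply: ler_sum => n /andP[_ nK].
  by rewrite (xy K)// (leq_trans _ (Nge K)).
have [B hB] := Tl2 _ x2.
have B0 := sqsum_le_ge0 hB.
pose j := (Num.truncn B).+1.
have := hB (N j.+1); rewrite leNgt => /negP; apply.
have [_ _ h] := hs j; apply: lt_le_trans (truncnS_gt B) _.
apply: (@le_trans _ _ (N j)%:R); first by rewrite ler_nat Nge.
apply: (le_trans h); rewrite /S !big_nat; apply: ler_sum => n /andP[_ nN].
rewrite (@dmul_eql _ x (y j.+1))// => k /andP[_ kn].
by apply: xy; apply: leq_trans kn _.
Qed.

End Boundedness.

(** * Cesaro means of a multiplier *)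

Section IntegerGrading.

(** The sum of the prime factors with multiplicity: unlike [Omega] it has finite
level sets, so that truncating at a given degree leaves finitely many integers,
and unlike the logarithm it is integer-valued, as Cesaro means require. *)
Definition sopfr (n : nat) : nat := \sum_(p < n.+1) p * logn p n.

Lemma sopfr_widen n N : (0 < n <= N)%N -> sopfr n = (\sum_(p < N.+1) p * logn p n)%N.
Proof.
move=> /andP[n0 nN]; rewrite /sopfr.
rewrite -(big_mkord xpredT (fun p => p * logn p n)%N).
rewrite -(big_mkord xpredT (fun p => p * logn p n)%N).
rewrite (@big_cat_nat _ _ _ n.+1 0 N.+1)//= [X in _ = (_ + X)%N]big_nat.
rewrite [X in _ = (_ + X)%N]big1 ?addn0// => p /andP[np _].
by rewrite lognE gtnNdvd// !andbF muln0.
Qed.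

Lemma sopfrM k n : (0 < k)%N -> (0 < n)%N ->
  sopfr (k * n) = (sopfr k + sopfr n)%N.
Proof.
move=> k0 n0.
rewrite (@sopfr_widen k (k * n)) ?k0 ?leq_pmulr//.
rewrite (@sopfr_widen n (k * n)) ?n0 ?leq_pmull//.
rewrite /sopfr -big_split /=.
by apply: eq_bigr => p _; rewrite lognM// mulnDr.
Qed.

Lemma sopfr_prime p : prime p -> sopfr p = p.
Proof.
move=> pp; rewrite /sopfr big_ord_recr /= logn_prime// eqxx muln1.
rewrite big1 ?add0n// => q _; rewrite lognE.
case: ifP; rewrite ?muln0// => /and3P[qq _].
by rewrite dvdn_prime2// => /eqP e; have := ltn_ord q; rewrite -[X in (_ < X)%N]e ltnn.
Qed.

(** Finiteness of the level sets, from [p <= 2 ^ p]. *)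
Lemma leq_exp2_sopfr n : (0 < n)%N -> (n <= 2 ^ sopfr n)%N.
Proof.
elim/ltn_ind: n => n IH n0; have [n1|n1] := leqP n 1.
  by apply: leq_trans n1 _; rewrite expn_gt0.
have p0 := pdiv_gt0 n; have pp := pdiv_prime n1.
have q0 : (0 < n %/ pdiv n)%N by rewrite divn_gt0// dvdn_leq// pdiv_dvd.
have e := divnK (pdiv_dvd n).
have h : (n %/ pdiv n <= 2 ^ sopfr (n %/ pdiv n))%N.
  by apply: IH => //; rewrite ltn_Pdiv// prime_gt1.
rewrite -e sopfrM// (sopfr_prime pp) expnD leq_mul//.
exact: ltnW (ltn_expl _ _).
Qed.

End IntegerGrading.

Section Cesaro.
Variable R : realType.
Implicit Types (f mu c : nat -> R[i]) (M C e : R).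

(** The coefficients of degree [d] are multiplied by [max(0, 1 - d / N)], the
coefficients of the Fejer kernel. *)
Definition cesaro (N : nat) mu : nat -> R[i] :=
  fun n => ((N - sopfr n)%N%:R / N%:R)%:C * mu n.

(** The condition is [t - N < sopfr k <= t], free of truncated subtraction. *)
Definition window (N t : nat) f : nat -> R[i] :=
  fun k => if (sopfr k <= t < sopfr k + N)%N then f k else 0.

Lemma sum_window (V : nmodType) (F : nat -> V) a N T : (a + N <= T)%N ->
  \sum_(0 <= t < T) (if (a <= t < a + N)%N then F t else 0) =
  \sum_(0 <= i < N) F (a + i)%N.
Proof.
move=> aNT; have aT : (a <= T)%N by rewrite (leq_trans _ aNT)// leq_addr.
rewrite (@big_cat_nat _ _ _ a)//= [X in X + _]big_nat [X in X + _]big1 ?add0r.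
  rewrite (@big_cat_nat _ _ _ (a + N))//= ?leq_addr//.
  rewrite [X in _ + X]big_nat [X in _ + X]big1 ?addr0.
    rewrite -{1}(add0n a) big_addn addKn; apply: eq_big_nat => i /andP[_ iN].
    by rewrite leq_addl addnC ltn_add2l iN.
  by move=> t /andP[h _]; rewrite ltnNge h andbF.
by move=> t /andP[_ h]; rewrite leqNgt h.
Qed.

(** Among the [N] windows that contain the degree of [n], those that also contain
the degree of a divisor [k] are in number [max(0, N - d)], where [d] is the
degree of [n / k]. *)
Lemma cesaro_dmul N f mu n : (0 < N)%N -> (0 < n)%N ->
  (N%:R)%:C * dmul f (cesaro N mu) n =
  \sum_(0 <= i < N) dmul (window N (sopfr n + i) f) mu n.
Proof.
move=> N0 n0; rewrite /dmul /dconv mulr_sumr exchange_big /=.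
apply: eq_big_nat => k /andP[k0 _]; rewrite /dshift; case: ifPn => kn; last first.
  by rewrite !mulr0 big1// => i _; rewrite mulr0.
have e : sopfr n = (sopfr k + sopfr (n %/ k))%N.
  by rewrite -sopfrM ?divn_gt0 ?(dvdn_leq _ kn)// mulnC divnK.
set d := sopfr (n %/ k) in e *.
transitivity (\sum_(0 <= i < N) (if (i < N - d)%N then f k * mu (n %/ k)%N else 0)).
  rewrite (@big_cat_nat _ _ _ (N - d))//= ?leq_subr//.
  rewrite [X in _ + X]big_nat [X in _ + X]big1 ?addr0; last first.
    by move=> i /andP[h _]; rewrite ltnNge h.
  rewrite (eq_big_nat _ _ (F2 := fun=> f k * mu (n %/ k)%N)); last first.
    by move=> i /andP[_ ->].
  rewrite sumr_const_nat subn0 /cesaro -/d.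
  rewrite rmorphM /= fmorphV !rmorph_nat.
  have N0' : N%:R != 0 :> R[i] by rewrite pnatr_eq0 -lt0n.
  by rewrite -[RHS]mulr_natl; field.
apply: eq_bigr => i _; rewrite /window e -addnA leq_addr /= ltn_add2l.
by rewrite ltn_subRL; case: ifP => //; rewrite mul0r.
Qed.

Lemma sqr_sum_le (n : nat) (x : nat -> R) :
  (\sum_(0 <= i < n) x i) ^+ 2 <= n%:R * \sum_(0 <= i < n) x i ^+ 2.
Proof.
elim: n => [|[|n] IH]; first by rewrite !big_geq// expr0n mul0r.
  by rewrite !big_nat1 mul1r.
rewrite big_nat_recr//= [X in _ <= _ * X]big_nat_recr//= -[X in _ <= X * _]natr1.
move: IH; set a := \sum_(_ <= _ < _) _; set A := \sum_(_ <= _ < _) _.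
set b := x _; set m := n.+1%:R => IH.
have m0 : 0 < m by rewrite ltr0n.
have : 0 <= (a - m * b) ^+ 2 by exact: sqr_ge0.
have : 2 * a * b <= A + m * b ^+ 2.
  rewrite -(ler_pM2l m0); have : 0 <= (a - m * b) ^+ 2 by exact: sqr_ge0.
  by move: IH; nra.
by move: IH; nra.
Qed.

(** Cesaro means do not increase the norm of the convolution operator: up to the
factor [N^-1], the operator of [cesaro N mu] is the sum over [t] of the
compressions of that of [mu] to the windows of degrees in [(t - N, t]], and
every degree lies in exactly [N] windows. *)
Lemma cesaro_bounded mu C :
  (forall L f, \sum_(1 <= n < L.+1) normc (dmul f mu n) ^+ 2 <=
    C * \sum_(1 <= n < L.+1) normc (f n) ^+ 2) ->
  forall N L f, (0 < N)%N ->
    \sum_(1 <= n < L.+1) normc (dmul f (cesaro N mu) n) ^+ 2 <=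
    C * \sum_(1 <= n < L.+1) normc (f n) ^+ 2.
Proof.
move=> hC N L f N0; pose T := (N + \sum_(1 <= n < L.+1) sopfr n)%N.
have hT n : (0 < n <= L)%N -> (sopfr n + N <= T)%N.
  move=> /andP[n0 nL]; rewrite /T addnC leq_add2l.
  rewrite (@big_cat_nat _ _ _ n.+1)//= (@big_nat_recr _ _ _ n)//=.
  by rewrite -addnA addnCA leq_addr.
have N0' : (0 : R) < N%:R by rewrite ltr0n.
rewrite -(ler_pM2l (exprn_gt0 2 N0')).
pose G t n := normc (dmul (window N t f) mu n) ^+ 2.
apply: (@le_trans _ _ (N%:R * \sum_(1 <= n < L.+1) \sum_(0 <= t < T) G t n)).
  rewrite !mulr_sumr !big_nat; apply: ler_sum => n /andP[n0 nL].
  rewrite -exprMn -{1}(ger0_norm (ltW N0')) -normc_real -normcM cesaro_dmul//.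
  apply: (@le_trans _ _ ((\sum_(0 <= i < N)
      normc (dmul (window N (sopfr n + i) f) mu n)) ^+ 2)).
    rewrite lerXn2r ?nnegrE ?normc_ge0 ?ler_normc_sum//.
    by apply: sumr_ge0 => i _; exact: normc_ge0.
  apply: le_trans (sqr_sum_le _ _) _; rewrite ler_pM2l//.
  rewrite -(@sum_window _ (fun t => G t n) (sopfr n) N T); last first.
    by apply: hT; rewrite n0.
  by apply: ler_sum => t _; case: ifP => // _; exact: sqr_ge0.
rewrite exchange_big /= [N%:R ^+ 2]expr2 -mulrA ler_pM2l//.
apply: (@le_trans _ _ (\sum_(0 <= t < T)
    C * \sum_(1 <= n < L.+1) normc (window N t f n) ^+ 2)).
  by apply: ler_sum => t _; exact: hC.
rewrite -mulr_sumr exchange_big /= mulrCA le_eqVlt; apply/orP; left; apply/eqP.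
congr (C * _); rewrite mulr_sumr; apply: eq_big_nat => n /andP[n0 nL].
rewrite (eq_bigr (fun t => if (sopfr n <= t < sopfr n + N)%N
    then normc (f n) ^+ 2 else 0)); last first.
  by move=> t _; rewrite /window; case: ifP => // _; rewrite normc0 expr0n.
rewrite (@sum_window _ (fun=> normc (f n) ^+ 2)) ?hT ?n0//.
by rewrite sumr_const_nat subn0 mulr_natl.
Qed.

(** The tail of [mu] is small, and on the finitely many remaining coefficients,
whose degrees are at most [W], the weight differs from 1 by at most [W / N]. *)
Lemma cesaro_cvg mu e : l2 mu -> 0 < e ->
  exists2 N, (0 < N)%N & sqsum_le (cesaro N mu - mu) e.
Proof.
move=> mu2 e0; have [M hM] := mu2; have M0 := sqsum_le_ge0 hM.
have e40 : 0 < e / 4 by rewrite divr_gt0.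
have [Q hQ] := l2_tail mu2 e40.
(* An upper bound for the degrees of the integers up to [Q]. *)
pose W := (\sum_(1 <= n < Q.+1) sopfr n)%N.
have hW n : (0 < n <= Q)%N -> (sopfr n <= W)%N.
  move=> /andP[n0 nQ]; rewrite /W (@big_cat_nat _ _ _ n.+1)//=.
  by rewrite (@big_nat_recr _ _ _ n)//= -addnA addnCA leq_addr.
pose N := (Num.truncn (W%:R ^+ 2 * M / (e / 4))).+1.
have N0 : (0 : R) < N%:R by rewrite ltr0n.
exists N => //.
have diff n : normc ((cesaro N mu - mu) n) =
    (1 - (N - sopfr n)%N%:R / N%:R) * normc (mu n).
  rewrite !fctE /cesaro -[X in _ - X]mul1r -mulrBl normcM.
  rewrite -(rmorph1 (real_complex R)) -rmorphB normc_real distrC ger0_norm//.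
  by rewrite subr_ge0 ler_pdivrMr// mul1r ler_nat leq_subr.
have -> : cesaro N mu - mu =
    upto Q (cesaro N mu - mu) + ((cesaro N mu - mu) - upto Q (cesaro N mu - mu)).
  by rewrite [RHS]addrC subrK.
have -> : e = 2 * (e / 4) + 2 * (e / 4) by lra.
apply: sqsum_leD; last first.
  apply: sqsum_le_mono hQ => n _; rewrite !fctE /upto; case: ifP => _.
    by rewrite !subrr normc0.
  rewrite !subr0; have := diff n; rewrite !fctE => ->.
  by rewrite ler_piMl ?normc_ge0// gerBl divr_ge0.
apply: (@sqsum_le_le _ _ ((W%:R / N%:R) ^+ 2 * M)).
  rewrite exprMn mulrAC exprVn ler_pdivrMr ?exprn_gt0//.
  have := truncnS_gt (W%:R ^+ 2 * M / (e / 4)); rewrite -/N ltr_pdivrMr//.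
  move=> /ltW h; apply: (le_trans h); rewrite mulrC ler_pM2l// expr2.
  by rewrite ler_peMr ?ler0n// ler1n.
have -> : (W%:R / N%:R) ^+ 2 = normc ((W%:R / N%:R : R)%:C) ^+ 2.
  by rewrite normc_real real_normK ?num_real.
apply: sqsum_le_mono (sqsum_leZ _ hM) => n n0; rewrite /upto; case: ifP => nQ; last first.
  by rewrite normc0 normc_ge0.
rewrite diff -[(_ *: _) n]/(_ * _) normcM normc_real.
rewrite ler_wpM2r ?normc_ge0// ger0_norm ?divr_ge0//.
rewrite lerBlDr -mulrDl ler_pdivlMr// mul1r -natrD ler_nat.
by have := hW n; rewrite n0 nQ => /(_ isT); lia.
Qed.

Lemma cesaro_support N mu k : (2 ^ N < k)%N -> cesaro N mu k = 0.
Proof.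
move=> Nk; rewrite /cesaro (_ : (N - sopfr k)%N = 0%N) ?mul0r ?rmorph0 ?mul0r//.
apply/eqP; rewrite subn_eq0 -(leq_exp2l _ _ (isT : (1 < 2)%N)).
by apply: leq_trans (ltnW Nk) (leq_exp2_sopfr _); exact: leq_ltn_trans Nk.
Qed.

(** Convolution by the Cesaro means is bounded uniformly, so convergence has only
to be checked on a finite truncation of [f], where it is that of the
coefficients.  The means have finite support, hence produce finite
combinations of shifts of [f]. *)
Lemma dmul_approx mu f e : l2 mu ->
  (forall g, l2 g -> l2 (dmul g mu)) -> l2 f -> 0 < e ->
  exists K c, sqsum_le (dmul f mu - dconv f K c) e.
Proof.
move=> mu2 Tl2 f2 e0.
have [C C0 hC] := dmul_bounded mu2 Tl2.
have bnd (nu : nat -> R[i]) :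
    (forall L f, \sum_(1 <= n < L.+1) normc (dmul f nu n) ^+ 2 <=
      C * \sum_(1 <= n < L.+1) normc (f n) ^+ 2) ->
    forall g M, sqsum_le g M -> sqsum_le (dmul g nu) (C * M).
  by move=> h g M gM N; apply: le_trans (h _ _) _; rewrite ler_wpM2l.
have C10 : 0 < C + 1 by rewrite ltr_wpDl.
(* The convolutions of the tail of [f] by [mu] and by its mean each cost [e/16],
   that of the head by their difference [e/4]. *)
have [L hL] := l2_tail f2 (divr_gt0 e0 (mulr_gt0 (ltr0Sn R 15) C10)).
have [C' C'0 hC'] := sqsum_le_dconv f L.
have C'10 : 0 < C' + 1 by rewrite ltr_wpDl.
have [N N0 hN] := cesaro_cvg mu2 (divr_gt0 e0 (mulr_gt0 (ltr0Sn R 3) C'10)).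
pose c := cesaro N mu; exists (2 ^ N)%N, c.
pose r := f - upto L f.
have share (D k : R) : 0 <= D -> 0 < k -> D * (e / (k * (D + 1))) <= e / k.
  move=> D0 k0; rewrite mulrA ler_pdivrMr ?mulr_gt0 ?ltr_wpDl//.
  by rewrite mulrA divfK ?gt_eqF//; move: e0; nra.
have h1 : sqsum_le (dmul r mu) (e / 16).
  apply: sqsum_le_le (bnd _ hC _ _ hL); exact: share.
have h2 : sqsum_le (dmul r c) (e / 16).
  apply: sqsum_le_le (bnd _ (fun L f => cesaro_bounded hC L f N0) _ _ hL).
  exact: share.
have h3 : sqsum_le (dconv (c - mu) L f) (e / 4).
  apply: sqsum_le_le (hC' _ _ hN); exact: share.
have -> : e = 2 * (2 * (e / 16) + 2 * (e / 16)) + 2 * (e / 4) by lra.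
apply: sqsum_le_eq (sqsum_leD (sqsum_leD h1 (sqsum_leN h2)) (sqsum_leN h3)) => n n0.
rewrite !fctE (dconv_dmul _ n0 (@cesaro_support N mu)) (@dmulC _ _ f)//.
have E nu : dmul f nu n = dmul r nu n + dconv nu L f n.
  have -> : dconv nu L f n = dconv nu L (upto L f) n.
    by apply: eq_big_nat => k /andP[_ kL]; rewrite /upto -ltnS kL.
  rewrite (@dconv_dmul _ (upto L f))//; last first.
    by move=> k Lk; rewrite /upto leqNgt Lk.
  by rewrite -dmulDl /r subrK.
have -> : dconv (c - mu) L f n = dconv c L f n - dconv mu L f n.
  rewrite /dconv -sumrB; apply: eq_bigr => k _; rewrite /dshift.
  by case: ifP => _; rewrite -mulrBr ?subrr.
by rewrite !E; ring.
Qed.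

End Cesaro.

(** * Holomorphy of finite Dirichlet series *)

Section Holomorphy.
Variable R : realType.
Implicit Types (z w s : R[i]).

Lemma taylor1 (g : R -> R) (d e : R) : is_derive (0 : R) (1 : R) g d -> 0 < e ->
  exists2 r : R, 0 < r & forall t, `|t| < r -> `|g t - g 0 - d * t| <= e * `|t|.
Proof.
move=> gd e0; have gdv : derivable g 0 1 by [].
have /cvgrPdist_le/(_ _ e0) := gdv.
rewrite -[lim _]/('D_1 g 0) derive_val /dnbhs /within /=.
move=> /nbhs_ballP[r /= r0 hr]; exists r => // t tr.
have [->|t0] := eqVneq t 0; first by rewrite subrr mulr0 subrr normr0 mulr0.
have := hr t; rewrite /ball /= sub0r normrN => /(_ tr t0).
rewrite addr0 [t%:A]mulr1 distrC => h.
have -> : g t - g 0 - d * t = (t^-1 * (g t - g 0) - d) * t.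
  by rewrite mulrBl mulrAC mulVf// mul1r.
by rewrite normrM ler_wpM2r.
Qed.

(** Real differentiability of [expR], [cos] and [sin] at 0 gives the complex
derivative of the exponential at 0, and [cexpD] transports it elsewhere. *)
Lemma cexp_near0 (e : R) : 0 < e -> exists2 r : R, 0 < r &
  forall w, normc w < r -> normc (cexp w - 1 - w) <= e * normc w.
Proof.
move=> e0; pose e1 := Num.min (e / 10) 1.
have e10 : 0 < e1 by rewrite lt_min ltr01 divr_gt0.
have e1e : e1 <= e / 10 by rewrite ge_min lexx.
have e11 : e1 <= 1 by rewrite ge_min lexx orbT.
have [r1 r10 h1] := taylor1 (is_derive_expR (0 : R)) e10.
have [r2 r20 h2] := taylor1 (is_derive_cos (0 : R)) e10.
have [r3 r30 h3] := taylor1 (is_derive_sin (0 : R)) e10.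
pose r := Num.min (Num.min r1 r2) (Num.min r3 (e1 / 2)).
exists r; first by rewrite !lt_min r10 r20 r30 divr_gt0.
case=> x y wr; have xw := normc_Re (x +i* y); have yw := normc_Im (x +i* y).
have {xw} xn : `|x| <= normc (x +i* y) := xw.
have {yw} yn : `|y| <= normc (x +i* y) := yw.
move: xn yn wr; set n := normc _ => xn yn.
rewrite !lt_min => /andP[/andP[n1 n2] /andP[n3 n4]].
have := h1 x (le_lt_trans xn n1); have := h2 y (le_lt_trans yn n2).
have := h3 y (le_lt_trans yn n3).
rewrite expR0 cos0 sin0 oppr0 mul0r !(subr0, addr0) !mul1r.
have n0 : 0 <= n by exact: normc_ge0.
set X := expR x; set Cy := cos y; set Sy := sin y => hS hC hX.
apply: le_trans (normc_ReIm _) _.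
have -> : complex.Re (cexp (x +i* y) - 1 - (x +i* y)) = X * (Cy - 1) + (X - 1 - x).
  by rewrite /cexp /= -/X -/Cy -/Sy mul0r subr0; ring.
have -> : complex.Im (cexp (x +i* y) - 1 - (x +i* y)) = X * (Sy - y) + (X - 1) * y.
  by rewrite /cexp /= -/X -/Cy -/Sy mul0r addr0; ring.
have hX' : `|X - 1| <= 2 * n.
  have -> : X - 1 = (X - 1 - x) + x by ring.
  apply: le_trans (ler_normD _ _) _.
  have : e1 * `|x| <= 1 * n by apply: ler_pM => //; exact: ltW.
  by move: hX xn; lra.
have X2 : `|X| <= 2.
  have -> : X = (X - 1) + 1 by ring.
  by apply: le_trans (ler_normD _ _) _; rewrite normr1; move: hX' n4 e11; lra.
apply: le_trans (lerD (ler_normD _ _) (ler_normD _ _)) _; rewrite !normrM.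
have b1 : `|X| * `|Cy - 1| <= 2 * (e1 * n).
  apply: ler_pM => //; apply: le_trans hC _; rewrite ler_wpM2l// ltW//.
have b2 : `|X - 1 - x| <= e1 * n.
  by apply: le_trans hX _; rewrite ler_wpM2l// ltW.
have b3 : `|X| * `|Sy - y| <= 2 * (e1 * n).
  by apply: ler_pM => //; apply: le_trans hS _; rewrite ler_wpM2l// ltW.
have b4 : `|X - 1| * `|y| <= 2 * n * (e1 / 2).
  by apply: ler_pM => //; apply: le_trans yn _; exact: ltW.
have b5 : e1 * n <= e / 10 * n by rewrite ler_wpM2r.
have b6 : 0 <= e * n by rewrite mulr_ge0// ltW.
by move: b1 b2 b3 b4 b5 b6; lra.
Qed.

Lemma derivable_cexp_scale (k s : R[i]) :
  derivable ((fun z => cexp (k * z)) : R[i]^o -> R[i]^o) s 1.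
Proof.
apply/cvg_ex; exists (k * cexp (k * s) : R[i]^o).
apply/cvgrPdist_le => e e0.
have /complex_realP[e' ee'] : e \is Num.real by rewrite gtr0_real.
have e'0 : 0 < e' by rewrite ee' ltcR in e0.
pose A := normc (cexp (k * s)) * normc k + 1.
have A0 : 0 < A by rewrite ltr_wpDl// mulr_ge0 ?normc_ge0.
have [r r0 hr] := cexp_near0 (divr_gt0 e'0 A0).
pose d := r / (normc k + 1).
have k10 : 0 < normc k + 1 by rewrite ltr_wpDl ?normc_ge0.
have d0 : 0 < d by rewrite divr_gt0.
rewrite /dnbhs /within /=; apply/nbhs_ballP; exists d%:C => /=.
  by rewrite ltcR.
move=> h; rewrite /ball /= sub0r normrN normcE_norm ltcR => hd h0.
rewrite -[_ *: _]/(h^-1 * (cexp (k * (h *: 1 + s)) - cexp (k * s))).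
have -> : h *: (1 : R[i]^o) = h by rewrite /GRing.scale /= mulr1.
rewrite [k * (h + s)]mulrDr cexpD normcE_norm ee' lecR.
have -> : k * cexp (k * s) - h^-1 * (cexp (k * h) * cexp (k * s) - cexp (k * s)) =
   - (h^-1 * (cexp (k * s) * (cexp (k * h) - 1 - k * h))).
  by field.
have kh : normc (k * h) < r.
  rewrite normcM; apply: (@le_lt_trans _ _ ((normc k + 1) * normc h)).
    by rewrite ler_wpM2r ?normc_ge0// lerDl.
  by rewrite mulrC -ltr_pdivlMr.
rewrite normcN (normcM h^-1) (normcM (cexp (k * s))) normcV.
have nh0 : 0 < normc h.
  rewrite lt_neqAle normc_ge0 andbT eq_sym; apply/eqP => /eq0_normc.
  by apply/eqP.
rewrite mulrC ler_pdivrMr//.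
have := hr _ kh; rewrite normcM => hh.
apply: (@le_trans _ _ (normc (cexp (k * s)) * (e' / A * (normc k * normc h)))).
  by rewrite ler_wpM2l ?normc_ge0.
rewrite [X in X <= _](_ : _ = e' * normc h * ((A - 1) / A)); last first.
  by rewrite /A; ring.
rewrite ler_piMr ?mulr_ge0 ?normc_ge0 ?(ltW e'0)//.
by rewrite ler_pdivrMr// mul1r gerBl.
Qed.

Lemma finite_dirichlet_holomorphic g : @finite_dirichlet R g ->
  holomorphic_half_plane g.
Proof.
move=> [N [c ->]] s _; elim: N => [|N IH].
  rewrite (_ : (fun s : R[i] => _) = (cst 0 : R[i]^o -> R[i]^o)).
    exact: derivable_cst.
  by apply/funext => z; rewrite big_geq.
rewrite (_ : (fun s : R[i] => _) =
    ((fun s : R[i] => \sum_(1 <= n < N.+1) c n * nat_cpow n (- s)) :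
      R[i]^o -> R[i]^o) +
    c N.+1 *: ((fun s : R[i] => nat_cpow N.+1 (- s)) : R[i]^o -> R[i]^o)).
  apply: (@derivableD _ R[i]^o R[i]^o); first exact: IH.
  apply: (@derivableZ _ R[i]^o R[i]^o).
  rewrite (_ : (fun s : R[i] => _) =
      (fun z => cexp ((- (ln N.+1%:R)%:C) * z) : R[i]^o)).
    exact: derivable_cexp_scale.
  by apply/funext => z; rewrite /nat_cpow mulrC mulrN mulNr.
by apply/funext => z; rewrite big_nat_recr.
Qed.

End Holomorphy.

(** * Cyclicity in the space of Dirichlet series *)

Section HardySpace.
Variable R : realType.
Implicit Types (f g m : R[i] -> R[i]) (a b c d : nat -> R[i]).

Lemma is_coef_l2 f c : is_coef f c -> l2 c.
Proof. by case=> /coef_sqnorm_ltP. Qed.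

Lemma is_coef_ser f c s : is_coef f c -> half_plane s ->
  is_ser c (fun n => nat_cpow n (- s)) (f s).
Proof.
move=> fc hs; rewrite (fc.2 _ hs).
by apply: is_ser_ser; [exact: is_coef_l2 fc|exact: l2_nat_cpow].
Qed.

Lemma is_coefI f c : l2 c -> (forall s, half_plane s ->
  is_ser c (fun n => nat_cpow n (- s)) (f s)) -> is_coef f c.
Proof.
move=> c2 h; split; first exact/coef_sqnorm_ltP.
by move=> s hs; apply/esym/is_ser_lim; exact: h.
Qed.

Lemma is_coef_dirichlet c : l2 c -> is_coef (dirichlet_series c) c.
Proof.
move=> c2; apply: is_coefI => // s hs; apply: is_ser_ser => //.
exact: l2_nat_cpow.
Qed.

Lemma is_coef_eq f c d : is_coef f c -> (forall n, (0 < n)%N -> c n = d n) ->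
  is_coef f d.
Proof.
move=> fc cd; apply: is_coefI.
  by have [M hM] := is_coef_l2 fc; exists M; apply: sqsum_le_eq hM => n /cd.
move=> s hs; apply: is_ser_eq (is_coef_ser fc hs) => // n n0; exact: cd.
Qed.

Lemma is_coefP f g c d (k : R[i]) : is_coef f c -> is_coef g d ->
  is_coef (k *: f + g) (k *: c + d).
Proof.
move=> fc gd; apply: is_coefI.
  by apply: l2D; [apply: l2Z; exact: is_coef_l2 fc|exact: is_coef_l2 gd].
move=> s hs; apply: is_serD; last exact: is_coef_ser gd hs.
by apply: is_serZ; exact: is_coef_ser fc hs.
Qed.

Lemma is_coefB f g c d : is_coef f c -> is_coef g d -> is_coef (f - g) (c - d).
Proof.
have -> : f - g = (-1) *: g + f by rewrite (scaleN1r g) addrC.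
have -> : c - d = (-1) *: d + c by rewrite (scaleN1r d) addrC.
by move=> fc gd; apply: is_coefP.
Qed.

Lemma is_coef_dconv f b K c : is_coef f b ->
  is_coef (f \* (fun s => \sum_(1 <= n < K.+1) c n * nat_cpow n (- s)))
    (dconv b K c).
Proof.
move=> fb; apply: is_coefI; first by apply: l2_dconv; exact: is_coef_l2 fb.
move=> s hs; apply: is_ser_dconv (is_coef_ser fb hs).
exact: nat_cpow_is_char.
Qed.

(** Linearity reduces this to a Dirichlet series that vanishes on the half-plane. *)
Lemma is_coef_unique f c d : is_coef f c -> is_coef f d ->
  forall n, (0 < n)%N -> c n = d n.
Proof.
move=> fc fd n n0; apply/eqP; rewrite -subr_eq0; apply/eqP.
have fcd := is_coefB fc fd.
apply: (@dirichlet_unique _ (c - d)) => //; first exact: is_coef_l2 fcd.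
by move=> s hs; rewrite -fcd.2// !fctE subrr.
Qed.

Lemma coefP f : Hspace f -> is_coef f (coef f).
Proof. by move=> [c fc]; rewrite /coef; case: xgetP => [y -> //|/(_ c)]. Qed.

Lemma sqsum_le_Hnorm f c : is_coef f c -> sqsum_le c (Hnorm f ^+ 2).
Proof.
move=> fc; have fcf : is_coef f (coef f) by apply: coefP; exists c.
apply: sqsum_le_eq (_ : sqsum_le (coef f) _); first exact: is_coef_unique fc fcf.
rewrite /Hnorm sqr_sqrtr ?fine_ge0 ?coef_sqnorm_ge0//; apply/coef_sqnorm_leP.
by rewrite fineK// ge0_fin_numE ?coef_sqnorm_ge0//; exact: fcf.1.
Qed.

Lemma Hnorm_le f c M : is_coef f c -> sqsum_le c M -> Hnorm f <= Num.sqrt M.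
Proof.
move=> fc cM; have fcf : is_coef f (coef f) by apply: coefP; exists c.
rewrite /Hnorm ler_wsqrtr// -lee_fin fineK; last first.
  by rewrite ge0_fin_numE ?coef_sqnorm_ge0//; exact: fcf.1.
by apply/coef_sqnorm_leP; apply: sqsum_le_eq cM; exact: is_coef_unique fcf fc.
Qed.

(** The factor 1/2 makes room for the strict inequality. *)
Lemma Hnorm_lt f c (e : R) : 0 < e -> is_coef f c -> sqsum_le c (e ^+ 2 / 2) ->
  Hnorm f < e.
Proof.
move=> e0 fc ce; apply: le_lt_trans (Hnorm_le fc ce) _.
rewrite -[ltRHS](gtr0_norm e0) -sqrtr_sqr ltr_sqrt ?exprn_gt0//.
by rewrite ltr_pdivrMr// mulr_natr mulr2n ltrDl exprn_gt0.
Qed.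

(** The common form on coefficients of all the conditions to be compared. *)
Definition cyclic_seq a := forall b, l2 b -> forall e : R, 0 < e ->
  exists K c, sqsum_le (b - dconv a K c) e.

Lemma cyclic_H_seq a : l2 a -> cyclic_H (dirichlet_series a) <-> cyclic_seq a.
Proof.
move=> a2; have fa := is_coef_dirichlet a2; split=> [[_ dense] b b2 e e0|cyc].
  have bH : Hspace (dirichlet_series b) by exists b; exact: is_coef_dirichlet.
  have se0 : 0 < Num.sqrt e by rewrite sqrtr_gt0.
  have [_ [g [K [c ->]] <-] he] := dense _ bH _ se0.
  exists K, c.
  have := sqsum_le_Hnorm (is_coefB (is_coef_dirichlet b2) (is_coef_dconv K c fa)).
  apply: sqsum_le_le; rewrite -[leRHS](sqr_sqrtr (ltW e0)).
  by rewrite lerXn2r ?nnegrE ?sqrtr_ge0// ltW.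
split=> [_ [g [K [c ->]] <-]|f [b fb] e e0].
  by exists (dconv a K c); exact: is_coef_dconv.
have [|K [c hc]] := cyc b (is_coef_l2 fb) (e ^+ 2 / 2).
  by rewrite divr_gt0// exprn_gt0.
eexists; first by eexists; [exists K, c; reflexivity|reflexivity].
exact: Hnorm_lt (is_coefB fb (is_coef_dconv K c fa)) hc.
Qed.

Lemma finite_dirichlet_multiplier g : @finite_dirichlet R g -> multiplier g.
Proof.
move=> hg; split; first exact: finite_dirichlet_holomorphic.
move=> f [b fb]; have [K [c ->]] := hg; exists (dconv b K c).
rewrite (_ : _ \* f = f \* (fun s => \sum_(1 <= n < K.+1) c n * nat_cpow n (- s))).
  exact: is_coef_dconv.
by apply/funext => s /=; rewrite mulrC.
Qed.

(** The coefficients [mu] of [m] are those of [m * 1].  For the coefficients up to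
[n] of [m f], subtract from [f] its first [n] terms: the product of [m] by the
remainder is [O(1) O((n+1)^{-j})] at [s = j], so that [dirichlet_vanish] applies
to its coefficients [c - dconv mu n b].  No series are multiplied together. *)
Lemma multiplier_coef m : multiplier m -> exists2 mu, is_coef m mu &
  forall f b, is_coef f b -> is_coef (m \* f) (dmul b mu).
Proof.
move=> [_ mH].
have oneH : Hspace (cst 1 : R[i] -> R[i]).
  exists (fun n => if n == 1%N then 1 else 0); apply: is_coefI.
    exists 1 => N; rewrite (eq_bigr (fun n => if n == 1%N then 1 else 0)).
      by rewrite -big_mkcond big_nat1_eq; case: ifP.
    by move=> n _; case: eqP; rewrite ?normc1 ?normc0 ?expr1n ?expr0n.
  move=> s hs; apply/cvgC_P => e e0; exists 1%N => // N /= N1.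
  rewrite (eq_bigr (fun n => if n == 1%N then 1 else 0)).
    by rewrite -big_mkcond big_nat1_eq /= ltnS N1 subrr normc0.
  move=> n _; case: eqP => [->|_]; last by rewrite mul0r.
  by rewrite mul1r (nat_cpow_is_char _).1.
have [mu hmu] := mH _ oneH.
have mmu : is_coef m mu.
  by rewrite (_ : m = m \* cst 1)//; apply/funext => s /=; rewrite mulr1.
exists mu => // f b fb.
have [c hc] := mH f (ex_intro _ b fb).
apply: (is_coef_eq hc) => n n0; apply/eqP; rewrite -subr_eq0; apply/eqP.
rewrite /dmul; pose r := b - upto n b.
have r2 : l2 r.
  by have [M hM] := is_coef_l2 fb; exists M; exact: sqsum_le_tail.
have [B hB] := @dirichlet_growth _ mu 1 isT (is_coef_l2 mmu)
  ltac:(by case).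
have [B' hB'] := @dirichlet_growth _ r n.+1 isT r2
  ltac:(by move=> k /andP[_ kn]; rewrite /r !fctE /upto -ltnS kn subrr).
apply: (@dirichlet_vanish _ (c - dconv mu n b) n.+1).
- by apply: l2B; [exact: is_coef_l2 hc|apply: l2_dconv; exact: is_coef_l2 mmu].
- exists (B * B') => j j2; have hj : half_plane (j%:R : R[i]).
    by apply: half_plane_nat; exact: leq_trans j2.
  set chi := fun k => nat_cpow k (- j%:R).
  have -> : ser (c - dconv mu n b) chi = ser mu chi * ser r chi.
    have Em : ser mu chi = m j%:R by apply: is_ser_lim; exact: is_coef_ser.
    apply: is_ser_lim.
    have h1 := is_coef_ser (is_coefB hc (is_coef_dconv n b mmu)) hj.
    rewrite (_ : ser mu chi * ser r chi =
      (m \* f - m \* (fun s => \sum_(1 <= k < n.+1) b k * nat_cpow k (- s))) j%:R).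
      exact: h1.
    rewrite !fctE Em -mulrBr; congr (_ * _); apply: is_ser_lim.
    apply: is_serD (is_coef_ser fb hj) _; rewrite -[- upto n b]scaleN1r.
    rewrite -[- \sum_(_ <= _ < _) _]mulN1r.
    apply: is_serZ; apply/cvgC_P => e e0; exists n => // N /= nN.
    rewrite [X in _ - X](_ : _ = \sum_(1 <= k < n.+1) b k * chi k).
      by rewrite subrr normc0.
    rewrite (@big_cat_nat _ _ _ n.+1)//= [X in _ + X]big_nat.
    rewrite [X in _ + X]big1 ?addr0; last first.
      by move=> k /andP[nk _]; rewrite /upto leqNgt nk mul0r.
    by apply: eq_big_nat => k /andP[_ kn]; rewrite /upto -ltnS kn.
  have := hB j j2; have := hB' j j2; rewrite expr1n mulr1 normcM => h1 h2.
  rewrite -mulrA; apply: ler_pM => //; rewrite ?mulr_ge0 ?normc_ge0//.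
- by rewrite n0 ltnSn.
Qed.

(** Finite Dirichlet series are multipliers, which gives one direction; the other
is the approximation of multiples by finite multiples, [dmul_approx]. *)
Lemma multiples_dense_seq a : l2 a ->
  multiples_dense (dirichlet_series a) <-> cyclic_seq a.
Proof.
move=> a2; have fa := is_coef_dirichlet a2; split=> [[_ dense] b b2 e e0|cyc].
  have bH : Hspace (dirichlet_series b) by exists b; exact: is_coef_dirichlet.
  have se0 : 0 < Num.sqrt (e / 4) by rewrite sqrtr_gt0 divr_gt0.
  have [_ [m mm <-] he] := dense _ bH _ se0.
  have [mu mmu hm] := multiplier_coef mm.
  have Tl2 c : l2 c -> l2 (dmul c mu).
    by move=> c2; exact: is_coef_l2 (hm _ _ (is_coef_dirichlet c2)).
  have [|K [c hc]] := @dmul_approx _ mu a (e / 4) (is_coef_l2 mmu) Tl2 a2.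
    by rewrite divr_gt0.
  exists K, c.
  have E : dirichlet_series a \* m = m \* dirichlet_series a.
    by apply/funext => s /=; rewrite mulrC.
  rewrite E in he.
  have := sqsum_le_Hnorm (is_coefB (is_coef_dirichlet b2) (hm _ _ fa)).
  have : Hnorm (dirichlet_series b - (m \* dirichlet_series a)) ^+ 2 <= e / 4.
    have e40 : 0 <= e / 4 by rewrite divr_ge0// ltW.
    rewrite -[leRHS](sqr_sqrtr e40).
    by rewrite lerXn2r ?nnegrE ?sqrtr_ge0// ltW.
  move=> /sqsum_le_le h /h h'.
  have -> : e = 2 * (e / 4) + 2 * (e / 4) by lra.
  have -> : b - dconv a K c = (b - dmul a mu) + (dmul a mu - dconv a K c).
    by rewrite addrA subrK.
  exact: sqsum_leD.
have [_ dense] := (cyclic_H_seq a2).2 cyc; split.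
  move=> _ [m [_ mH] <-].
  rewrite (_ : _ \* m = m \* dirichlet_series a); first by apply: mH; exists a.
  by apply/funext => s /=; rewrite mulrC.
move=> f fH e e0; have [_ [g hg <-] h] := dense f fH e e0.
exists (dirichlet_series a \* g) => //; exists g => //.
exact: finite_dirichlet_multiplier.
Qed.

End HardySpace.

(** * Cyclicity on the polydisc *)

Section FiniteMultiples.
Variable R : realType.
Implicit Types (a c d : nat -> R[i]).

Definition finite_multiple a c := exists K d, c = dconv a K d.

Lemma dconv_upto a K K' d : (K <= K')%N -> dconv a K d = dconv a K' (upto K d).
Proof.
move=> KK; apply/funext => n; rewrite /dconv.
rewrite [RHS](@big_cat_nat _ _ _ K.+1)//= [X in _ = _ + X]big_nat.
rewrite [X in _ = _ + X]big1 ?addr0; last first.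
  by move=> k /andP[Kk _]; rewrite /upto leqNgt Kk mul0r.
by apply: eq_big_nat => k /andP[_ kK]; rewrite /upto -ltnS kK.
Qed.

Lemma finite_multiple_lin a (k : R[i]) c d :
  finite_multiple a c -> finite_multiple a d -> finite_multiple a (k *: c + d).
Proof.
move=> [K [u ->]] [L [v ->]].
exists (maxn K L), (k *: upto K u + upto L v).
rewrite (dconv_upto a u (leq_maxl K L)) (dconv_upto a v (leq_maxr K L)).
apply/funext => n; rewrite !fctE /dconv scaler_sumr -big_split /=.
by apply: eq_bigr => l _; rewrite -[_ *: _]/(k * _) mulrA -mulrDl.
Qed.

(** [dshift k] after [dshift l] is [dshift (k l)]. *)
Lemma finite_multiple_dshift a k c : (0 < k)%N ->
  finite_multiple a c -> finite_multiple a (dshift k c).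
Proof.
move=> k0 [K [u ->]]; exists (k * K)%N, (dshift k u); apply/funext => n.
rewrite /dconv; transitivity (\sum_(1 <= l < K.+1) u l * dshift (k * l) a n).
  rewrite /dshift; case: ifPn => kn.
    apply: eq_bigr => l _; rewrite -(divnMA n k l).
    by rewrite dvdn_divRL// mulnC.
  rewrite big1// => l _; case: ifPn => [kln|]; last by rewrite mulr0.
  by rewrite (dvdn_trans _ kln) ?dvdn_mulr in kn.
rewrite (@dshift_sum _ _ (fun l x => x * dshift l a n))//; last first.
  by move=> l; rewrite mul0r.
by rewrite mulKn.
Qed.

Lemma finite_multiple_dconv a c K d :
  finite_multiple a c -> finite_multiple a (dconv c K d).
Proof.
move=> ac; elim: K => [|K IH]; first by exists 0%N, 0; rewrite !dconv0.
by rewrite dconvS addrC; apply: finite_multiple_lin => //; exact: finite_multiple_dshift.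
Qed.

Lemma dconvBl b c K d n : dconv (b - c) K d n = dconv b K d n - dconv c K d n :> R[i].
Proof.
rewrite /dconv -sumrB; apply: eq_bigr => k _; rewrite -mulrBr /dshift.
by case: ifP => _; rewrite ?subrr.
Qed.

End FiniteMultiples.

Section HardyPolydisc.
Variable R : realType.
Implicit Types (F G : (nat -> R[i]) -> R[i]) (f g : R[i] -> R[i]).
Implicit Types (a b c d z : nat -> R[i]).

(** The analogue of [is_coef] on the polydisc, free of the choice of a Dirichlet
series of which the function is the lift. *)
Definition is_coef2 G c := l2 c /\
  forall z, polydisc_l2 z -> is_ser c (fun n => bohr_monomial n z) (G z).

Lemma bohr_is_ser f c z : is_coef f c -> polydisc_l2 z ->
  is_ser c (fun n => bohr_monomial n z) (bohr f z).
Proof.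
move=> fc hz; have fcf : is_coef f (coef f) by apply: coefP; exists c.
apply: (@is_ser_eq _ (coef f) c _ (fun n => bohr_monomial n z)) => //.
  exact: is_coef_unique fcf fc.
by apply: is_ser_ser; [exact: is_coef_l2 fcf|exact: l2_bohr_monomial].
Qed.

Lemma is_coef2_lift G f c : is_bohr_lift G f -> is_coef f c -> is_coef2 G c.
Proof.
move=> [_ hG] fc; split; first exact: is_coef_l2 fc.
by move=> z hz; rewrite hG//; exact: bohr_is_ser.
Qed.

Lemma lift_is_coef2 G c : is_coef2 G c -> is_bohr_lift G (dirichlet_series c).
Proof.
move=> [c2 hG]; have fc := is_coef_dirichlet c2; split; first by exists c.
by move=> z hz; apply: cvgC_unique (hG z hz) (bohr_is_ser fc hz).
Qed.

(** A function on the polydisc determines its coefficients since its values at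
the points [(p_m^{-s})_m] are those of the Dirichlet series. *)
Lemma is_coef2_unique G c d : is_coef2 G c -> is_coef2 G d ->
  forall n, (0 < n)%N -> c n = d n.
Proof.
move=> [c2 hc] [d2 hd]; apply: (@is_coef_unique _ (dirichlet_series c)).
  exact: is_coef_dirichlet.
apply: is_coefI => // s hs; have hz := polydisc_nat_cpow hs.
have e n : (0 < n)%N ->
    bohr_monomial n (fun m => nat_cpow (nth_prime m) (- s)) = nat_cpow n (- s) :> R[i].
  exact: bohr_monomial_nat_cpow.
rewrite (_ : dirichlet_series c s = G (fun m => nat_cpow (nth_prime m) (- s))).
  by apply: is_ser_eq (hd _ hz) => // n n0; rewrite e.
by apply: is_ser_lim; apply: is_ser_eq (hc _ hz) => // n n0; rewrite e.
Qed.

Lemma is_coef2_H2 G c : is_coef2 G c -> H2 G.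
Proof. by move=> Gc; exists (dirichlet_series c); exact: lift_is_coef2. Qed.

Lemma H2_coef2 G : H2 G -> exists c, is_coef2 G c.
Proof.
move=> [f hf]; exists (coef f); apply: (is_coef2_lift hf); apply: coefP.
by case: hf.
Qed.

(** The norm is defined through a chosen lift; by uniqueness of the coefficients
the choice is immaterial. *)
Lemma H2_norm_coef2 G c : is_coef2 G c ->
  exists2 g, is_coef g c & H2_norm G = Hnorm g.
Proof.
move=> Gc; rewrite /H2_norm.
have h : is_bohr_lift G (xget (cst 0) (is_bohr_lift G)).
  by case: xgetP => [y -> //|/(_ (dirichlet_series c))[]]; exact: lift_is_coef2.
exists (xget (cst 0) (is_bohr_lift G)) => //.
apply: (is_coef_eq (coefP h.1)); apply: is_coef2_unique Gc.
by apply: (is_coef2_lift h); apply: coefP; exact: h.1.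
Qed.

Lemma sqsum_le_H2_norm G c : is_coef2 G c -> sqsum_le c (H2_norm G ^+ 2).
Proof. by move=> /H2_norm_coef2[g gc ->]; exact: sqsum_le_Hnorm. Qed.

Lemma H2_norm_lt G c (e : R) : 0 < e -> is_coef2 G c -> sqsum_le c (e ^+ 2 / 2) ->
  H2_norm G < e.
Proof. by move=> e0 /H2_norm_coef2[g gc ->]; exact: Hnorm_lt. Qed.

Lemma is_coef2_lin (k : R[i]) F G c d : is_coef2 F c -> is_coef2 G d ->
  is_coef2 (k *: F + G) (k *: c + d).
Proof.
move=> [c2 hF] [d2 hG]; split; first by apply: l2D => //; exact: l2Z.
move=> z hz; apply: is_serD; last exact: hG.
by apply: is_serZ; exact: hF.
Qed.

Lemma is_coef2B F G c d : is_coef2 F c -> is_coef2 G d -> is_coef2 (F - G) (c - d).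
Proof.
have -> : F - G = (-1) *: G + F by rewrite (scaleN1r G) addrC.
have -> : c - d = (-1) *: d + c by rewrite (scaleN1r d) addrC.
by move=> Fc Gd; apply: is_coef2_lin.
Qed.

Lemma is_coef2_dconv G c K d : is_coef2 G c ->
  is_coef2 ((fun z => \sum_(1 <= k < K.+1) d k * bohr_monomial k z) \* G)
    (dconv c K d).
Proof.
move=> [c2 hG]; split; first exact: l2_dconv.
move=> z hz; rewrite [X in is_ser _ _ X]mulrC.
by apply: is_ser_dconv (hG z hz); exact: bohr_monomial_is_char.
Qed.

Lemma is_coef2_0 : is_coef2 0 0.
Proof. by split; [exact: l20|move=> z _; exact: is_ser0]. Qed.

(** The functions whose coefficients are limits of finite multiples of [a] form a
closed invariant subspace containing the given one: if it is cyclic, they are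
everything.  Conversely every closed invariant subspace that contains it
contains the finite multiples, hence their limits. *)
Lemma cyclic_H2_seq a : l2 a -> cyclic_H2 (bohr (dirichlet_series a)) <-> cyclic_seq a.
Proof.
move=> a2; have fa := is_coef_dirichlet a2.
set F := bohr (dirichlet_series a).
have Fa : is_coef2 F a by split => // z hz; exact: bohr_is_ser.
split=> [cycF|cyc].
  (* The closed invariant subspace generated by the given function. *)
  pose E G := exists2 c, is_coef2 G c & forall e : R, 0 < e ->
    exists2 v, finite_multiple a v & sqsum_le (c - v) e.
  have EH2 : @H2 R `<=` E.
    rewrite -cycF; apply: smallest_sub; last first.
      move=> _ ->; exists a => // e e0; exists a.
        exists 1%N, (fun=> 1); apply/funext => n; rewrite /dconv big_nat1 mul1r.
        by rewrite /dshift dvd1n divn1.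
      by rewrite subrr; apply: sqsum_le0; exact: ltW.
    split; first split.
    - by move=> G [c Gc _]; exact: is_coef2_H2 Gc.
    - exists 0; first exact: is_coef2_0.
      move=> e e0; exists 0; first by exists 0%N, 0; rewrite dconv0.
      by rewrite subrr; apply: sqsum_le0; exact: ltW.
    - move=> k G G' [c Gc hc] [c' Gc' hc']; exists (k *: c + c').
        exact: is_coef2_lin.
      move=> e e0; have k0 : 0 < 2 * normc k ^+ 2 + 1.
        by rewrite ltr_wpDl// mulr_ge0// sqr_ge0.
      have [v av hv] := hc (e / 2 / (2 * normc k ^+ 2 + 1))
        (divr_gt0 (divr_gt0 e0 (ltr0Sn R 1)) k0).
      have [v' av' hv'] := hc' (e / 4) (divr_gt0 e0 (ltr0Sn R 3)).
      exists (k *: v + v'); first exact: finite_multiple_lin.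
      have -> : k *: c + c' - (k *: v + v') = k *: (c - v) + (c' - v').
        by rewrite scalerBr opprD addrACA.
      apply: sqsum_le_le (sqsum_leD (sqsum_leZ k hv) hv').
      have : 2 * normc k ^+ 2 * (e / 2 / (2 * normc k ^+ 2 + 1)) <= e / 2.
        rewrite mulrA ler_pdivrMr// mulrC ler_pM2l ?divr_gt0//.
        by rewrite lerDl.
      by rewrite -mulrA; lra.
    - move=> G GH2 hG; have [c Gc] := H2_coef2 GH2; exists c => // e e0.
      have [|G' [c' Gc' hc'] hGG'] := hG (Num.sqrt (e / 4)).
        by rewrite sqrtr_gt0 divr_gt0.
      have [v av hv] := hc' (e / 4) (divr_gt0 e0 (ltr0Sn R 3)).
      exists v => //.
      have h1 := sqsum_le_H2_norm (is_coef2B Gc Gc').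
      have h2 : H2_norm (G - G') ^+ 2 <= e / 4.
        have e40 : 0 <= e / 4 by rewrite divr_ge0// ltW.
        rewrite -[leRHS](sqr_sqrtr e40).
        rewrite lerXn2r ?nnegrE ?sqrtr_ge0//; last exact: ltW.
      have -> : e = 2 * (e / 4) + 2 * (e / 4) by lra.
      have -> : c - v = (c - c') + (c' - v) by rewrite addrA subrK.
      by apply: sqsum_leD => //; exact: sqsum_le_le h1.
    - move=> P G /coord_polynomialP[K [d hP]] [c Gc hc].
      have -> : P = (fun z => \sum_(1 <= k < K.+1) d k * bohr_monomial k z).
        by apply/funext.
      exists (dconv c K d); first exact: is_coef2_dconv.
      have [C C0 hC] := sqsum_le_dconv d K.
      move=> e e0; have C10 : 0 < C + 1 by rewrite ltr_wpDl.
      have [v av hv] := hc _ (divr_gt0 e0 C10).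
      exists (dconv v K d); first exact: finite_multiple_dconv.
      apply: sqsum_le_eq (sqsum_le_le _ (hC _ _ hv)) => [n _|].
        by rewrite dconvBl.
      by rewrite mulrA ler_pdivrMr// mulrC ler_pM2l// lerDl.
  move=> b b2 e e0.
  have hb := is_coef_dirichlet b2.
  have Gb : is_coef2 (bohr (dirichlet_series b)) b.
    by split => // z hz; exact: bohr_is_ser.
  have [c Gc hc] := EH2 _ (is_coef2_H2 Gb).
  have [_ [K [d ->]] hv] := hc e e0; exists K, d.
  by apply: sqsum_le_eq hv => n n0; rewrite !fctE (is_coef2_unique Gb Gc).
rewrite /cyclic_H2; apply/seteqP; split.
  apply: smallest_sub; last by move=> _ ->; exact: is_coef2_H2 Fa.
  split; first split => //.
  - exact: is_coef2_H2 is_coef2_0.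
  - move=> k G G' /H2_coef2[c Gc] /H2_coef2[c' Gc'].
    exact: is_coef2_H2 (is_coef2_lin k Gc Gc').
  - move=> P G /coord_polynomialP[K [d hP]] /H2_coef2[c Gc].
    have -> : P = (fun z => \sum_(1 <= k < K.+1) d k * bohr_monomial k z).
      by apply/funext.
    exact: is_coef2_H2 (is_coef2_dconv K d Gc).
move=> G GH2 E [[[_ _ _ Eclosed] Einv] FE]; have [c Gc] := H2_coef2 GH2.
apply: Eclosed => // e e0.
have [|K [d hd]] := cyc c Gc.1 (e ^+ 2 / 2); first by rewrite divr_gt0// exprn_gt0.
exists ((fun z => \sum_(1 <= k < K.+1) d k * bohr_monomial k z) \* F).
  by apply: Einv; [exact: finite_bohr_polynomial|exact: FE].
exact: H2_norm_lt (is_coef2B Gc (is_coef2_dconv K d Fa)) hd.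
Qed.

End HardyPolydisc.

(** * Orthonormality of the sines *)

Section SineOrthonormality.
Variable R : realType.
Notation mu := (@lebesgue_measure R).
Notation D := (`]0%R, 1%R[%classic : set R).
Implicit Types (f g : R -> R) (r : nat -> R) (x : R).

Definition sqint f : \bar R := (\int[mu]_(x in D) (f x ^+ 2)%:E)%E.

Definition rsine (n : nat) x : R := Num.sqrt 2 * sin (n%:R * pi * x).

Definition rsine_sum (N : nat) r x : R := \sum_(1 <= n < N.+1) r n * rsine n x.

Lemma sin_natpi (n : nat) : sin (n%:R * pi) = 0 :> R.
Proof.
elim: n => [|n IH]; first by rewrite mul0r sin0.
by rewrite -natr1 mulrDl mul1r sinDpi IH oppr0.
Qed.

Lemma is_derive_bigsum (s : seq nat) (F dF : nat -> R -> R) x :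
  (forall i, is_derive x (1 : R) (F i) (dF i x)) ->
  is_derive x (1 : R) (fun y => \sum_(i <- s) F i y) (\sum_(i <- s) dF i x).
Proof.
move=> h; elim: s => [|i s IH].
  rewrite big_nil (_ : (fun _ => _) = cst 0); last first.
    by apply/funext => y; rewrite big_nil.
  exact: is_derive_cst.
rewrite big_cons (_ : (fun _ => _) = F i + (fun y => \sum_(i <- s) F i y)).
  exact: is_deriveD.
by apply/funext => y; rewrite big_cons.
Qed.

Lemma is_derive_sinM (k x : R) :
  is_derive x (1 : R) (fun y => sin (k * y)) (k * cos (k * x)).
Proof.
have h : is_derive x (1 : R) (fun y => k * y) k.
  have := @is_deriveZ _ _ _ (@id R) k x 1 1 (is_derive_id _ _).
  by rewrite /GRing.scale /= mulr1.
have := @is_derive1_comp _ (@sin R) (fun y => k * y) x (cos (k * x)) k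
  (is_derive_sin _) h.
by rewrite mulrC.
Qed.

Let prim (k : R) (x : R) : R := if k == 0 then x else (k * pi)^-1 * sin (k * pi * x).

Let is_derive_prim k x : is_derive x (1 : R) (prim k) (cos (k * pi * x)).
Proof.
rewrite /prim; case: eqP => [->|/eqP k0].
  by rewrite !mul0r cos0; exact: is_derive_id.
have kpi : k * pi != 0 by rewrite mulf_neq0// gt_eqF// pi_gt0.
have := @is_deriveZ _ _ _ (fun y => sin (k * pi * y)) (k * pi)^-1 x 1 _
  (is_derive_sinM (k * pi) x).
by rewrite /GRing.scale /= mulrA mulVf// mul1r.
Qed.

Let prim0 k : prim k 0 = 0.
Proof. by rewrite /prim; case: ifP => //; rewrite mulr0 sin0 mulr0. Qed.

Let prim1 k : sin (k * pi) = 0 -> prim k 1 = (k == 0)%:R.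
Proof. by rewrite /prim; case: ifP => // _; rewrite mulr1 => ->; rewrite mulr0. Qed.

Lemma rsine_mul n m x : rsine n x * rsine m x =
  cos ((n%:R - m%:R) * pi * x) - cos ((n%:R + m%:R) * pi * x).
Proof.
have -> : (n%:R - m%:R) * pi * x = n%:R * pi * x - m%:R * pi * x by ring.
have -> : (n%:R + m%:R) * pi * x = n%:R * pi * x + m%:R * pi * x by ring.
rewrite cosB cosD /rsine; set a := sin _; set b := sin _.
have -> : Num.sqrt 2 * a * (Num.sqrt 2 * b) = Num.sqrt 2 ^+ 2 * (a * b) :> R by ring.
by rewrite sqr_sqrtr//; ring.
Qed.

Lemma derivable_rsine_sum N r x : derivable (rsine_sum N r) x 1.
Proof.
have := @is_derive_bigsum (index_iota 1 N.+1) (fun n y => r n * rsine n y)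
  (fun n y => r n * Num.sqrt 2 * (n%:R * pi * cos (n%:R * pi * y))) x.
suff h n : is_derive x (1 : R) (fun y => r n * rsine n y)
    (r n * Num.sqrt 2 * (n%:R * pi * cos (n%:R * pi * x))) by move=> /(_ h).
rewrite (_ : (fun y => _) = (r n * Num.sqrt 2) *: (fun y => sin (n%:R * pi * y))).
  exact: (@is_deriveZ _ _ _ (fun y => sin (n%:R * pi * y)) (r n * Num.sqrt 2) x 1 _
    (is_derive_sinM (n%:R * pi) x)).
by apply/funext => y; rewrite /rsine mulrA.
Qed.

Lemma continuous_rsine_sum N r : continuous (rsine_sum N r).
Proof.
move=> x; apply: differentiable_continuous.
by apply/derivable1_diffP; exact: derivable_rsine_sum.
Qed.

Lemma measurable_rsine_sum N r (A : set R) : measurable_fun A (rsine_sum N r).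
Proof.
by apply: measurable_funTS; apply: continuous_measurable_fun; exact: continuous_rsine_sum.
Qed.

(** Parseval for a finite sum, without orthogonality integrals one by one: the
square of the sum is a combination of cosines, with an explicit primitive to
which the fundamental theorem of calculus applies at once.  At [x = 1] the
primitive of [cos(k pi x)], [k] an integer, is 1 if [k = 0] and 0 otherwise. *)
Lemma sqint_rsine_sum N r : sqint (rsine_sum N r) = (\sum_(1 <= n < N.+1) r n ^+ 2)%:E.
Proof.
pose F x := \sum_(1 <= n < N.+1) \sum_(1 <= m < N.+1)
  r n * r m * (prim (n%:R - m%:R) x - prim (n%:R + m%:R) x).
have dF x : is_derive x (1 : R) F (rsine_sum N r x ^+ 2).
  have -> : rsine_sum N r x ^+ 2 = \sum_(1 <= n < N.+1)
      (fun y => \sum_(1 <= m < N.+1)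
       (fun z => r n * r m * (cos ((n%:R - m%:R) * pi * z) -
          cos ((n%:R + m%:R) * pi * z))) y) x.
    rewrite expr2 {1}/rsine_sum mulr_suml; apply: eq_bigr => n _.
    rewrite /rsine_sum mulr_sumr; apply: eq_bigr => m _ /=.
    by rewrite -rsine_mul; ring.
  pose f n m z : R := r n * r m *
    (prim (n%:R - m%:R) z - prim (n%:R + m%:R) z).
  pose g n m z : R := r n * r m *
    (cos ((n%:R - m%:R) * pi * z) - cos ((n%:R + m%:R) * pi * z)).
  apply: (@is_derive_bigsum (index_iota 1 N.+1)
    (fun n y => \sum_(1 <= m < N.+1) f n m y)
    (fun n y => \sum_(1 <= m < N.+1) g n m y)) => n.
  apply: (@is_derive_bigsum (index_iota 1 N.+1) (f n) (g n)) => m.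
  have := @is_deriveZ _ _ _ (prim (n%:R - m%:R) - prim (n%:R + m%:R))
    (r n * r m) x 1 _ (is_deriveB (is_derive_prim _ _) (is_derive_prim _ _)).
  by [].
have dFx x : derivable F x 1 by [].
have cF : continuous F.
  by move=> x; apply: differentiable_continuous; exact/derivable1_diffP.
rewrite /sqint -(@integral_itv_bndoo _ 0 1 _ true false); last first.
  apply/measurable_EFinP; apply: measurable_funX; exact: measurable_rsine_sum.
rewrite (@continuous_FTC2 _ (fun x => rsine_sum N r x ^+ 2) F 0 1) ?ltr01//.
- have F0 : F 0 = 0.
    by rewrite /F big1// => n _; rewrite big1// => m _; rewrite !prim0 subrr mulr0.
  rewrite F0 sube0 /F; congr (_%:E); apply: eq_big_nat => n /andP[n0 nN].
  rewrite (eq_big_nat _ _ (F2 := fun m => if m == n then r n ^+ 2 else 0)).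
    by rewrite -big_mkcond big_nat1_eq n0 nN.
  move=> m /andP[m0 _]; rewrite !prim1.
  - have -> : (n%:R + m%:R == 0 :> R) = false.
      by rewrite -natrD pnatr_eq0 addn_eq0 !eqn0Ngt n0 m0.
    rewrite subr_eq0 eqr_nat eq_sym subr0; case: eqP => [->|_]; last by rewrite mulr0.
    by rewrite mulr1 expr2.
  - by rewrite mulrDl sinD !sin_natpi mul0r mulr0 addr0.
  - by rewrite mulrBl sinB !sin_natpi mul0r mulr0 subrr.
- apply: continuous_subspaceT => x.
  by apply: (@continuous_comp _ _ _ (rsine_sum N r) (fun y => y ^+ 2));
    [exact: continuous_rsine_sum|exact: exprn_continuous].
- split.
  + by move=> x _; exact: dFx.
  + by apply: cvg_at_right_filter; exact: cF.
  + by apply: cvg_at_left_filter; exact: cF.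
- by move=> x _; rewrite derive1E; have := dF x => ?; rewrite derive_val.
Qed.

End SineOrthonormality.

(** * Square-integrable functions and dilations *)

Section AffineChange.
Variable R : realType.
Notation mu := (@lebesgue_measure R).
Implicit Types (G : R -> \bar R) (a b : R).

Let affine a b (x : measurableTypeR R) : measurableTypeR R := a * x + b.

Let measurable_affine a b : measurable_fun setT (affine a b).
Proof.
by apply: measurable_funD; [exact: measurable_funM|exact: measurable_cst].
Qed.

(** The measure [A |-> a * mu ((x |-> a x + b)^-1 A)] is Lebesgue's: it agrees with
it on intervals. *)
Let scaled_measure a b : 0 < a -> exists nu : {measure set (measurableTypeR R) -> \bar R},
  (forall A, measurable A -> mu A = nu A) /\
  forall G, measurable_fun setT G -> (forall x, 0 <= G x)%E ->
    (\int[nu]_x G x = a%:E * \int[mu]_x G (a * x + b)%R)%E.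
Proof.
move=> a0.
have [k kE] : exists k : {nonneg R}, k%:num = a by exists (NngNum (ltW a0)).
have [nu nuE] : exists nu : {measure set (measurableTypeR R) -> \bar R},
    nu = pushforward mu (affine a b) :> (set _ -> \bar R).
  unshelve (eexists; reflexivity).
  exact: measurable_affine.
exists (mscale k nu); split=> [A mA|G mG G0]; last first.
  rewrite ge0_integral_mscale// kE; congr (_ * _)%E.
  have := ge0_integral_pushforward (measurable_affine a b) mu measurableT mG
    (fun x _ => G0 x).
  rewrite preimage_setT => <-.
  by apply: eq_measure_integral => A mA _; rewrite nuE.
have mE X : mscale k nu X = (a%:E * mu (affine a b @^-1` X))%E.
  by rewrite /mscale nuE kE.
apply: lebesgue_measure_unique => // _ [[u v] _ <-].
transitivity (a%:E * mu (affine a b @^-1` `]u, v]%classic))%E; last exact/esym/mE.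
rewrite (_ : affine a b @^-1` _ = `](u - b) / a, (v - b) / a]%classic).
  rewrite !lebesgue_measure_itv /= !lte_fin ltr_pM2r ?invr_gt0// ltrD2r.
  case: ifP => _; last by rewrite mule0.
  by rewrite -!EFinD -EFinM; congr EFin; field; rewrite gt_eqF.
apply/seteqP; split=> x /=; rewrite !in_itv /= /affine;
  by rewrite ltr_pdivrMr// ler_pdivlMr// [x * a]mulrC ltrBlDr lerBrDr.
Qed.

(** The change of variables multiplies the integral by [1 / a <= 1]. *)
Lemma ge0_integral_affine_le G a b : 1 <= a -> measurable_fun setT G ->
  (forall x, 0 <= G x)%E ->
  (\int[mu]_x G (a * x + b)%R <= \int[mu]_x G x)%E.
Proof.
move=> a1 mG G0; have a0 : 0 < a by exact: lt_le_trans a1.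
have [nu [nuE nuG]] := scaled_measure b a0.
have -> : (\int[mu]_x G x = a%:E * \int[mu]_x G (a * x + b)%R)%E.
  rewrite -(nuG G mG G0); apply: eq_measure_integral => A mA _.
  exact: nuE.
by rewrite lee_pemull ?lee_fin// integral_ge0.
Qed.

Lemma ge0_integralN G : measurable_fun setT G -> (forall x, 0 <= G x)%E ->
  (\int[mu]_x G (- x)%R = \int[mu]_x G x)%E.
Proof.
move=> mG G0.
transitivity (\int[pushforward mu (-%R : R -> measurableTypeR R)]_x G x)%E.
  by rewrite ge0_integral_pushforward.
by apply: eq_measure_integral => A mA _; exact: lebesgue_measureN.
Qed.

End AffineChange.

Section ComplexL2.
Variable R : realType.
Notation mu := (@lebesgue_measure R).
Notation D := (`]0%R, 1%R[%classic : set R).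
Implicit Types (f g : R -> R[i]) (k : R[i]).

Definition measurableC f := measurable_fun D (fun x => complex.Re (f x)) /\
  measurable_fun D (fun x => complex.Im (f x)).

Lemma measurableC_sqr f : measurableC f ->
  measurable_fun D (fun x => (normc (f x) ^+ 2)%:E).
Proof.
move=> [mr mi]; apply/measurable_EFinP.
rewrite (_ : (fun x => _) =
    (fun x => complex.Re (f x) ^+ 2 + complex.Im (f x) ^+ 2)); last first.
  by apply/funext => x; exact: sqr_normcE.
by apply: measurable_funD; apply: measurable_funX.
Qed.

Lemma measurableCD f g : measurableC f -> measurableC g -> measurableC (f + g).
Proof.
move=> [fr fi] [gr gi]; split.
  rewrite (_ : (fun x => _) = (fun x => complex.Re (f x) + complex.Re (g x))).
    exact: measurable_funD.
  by apply/funext => x; rewrite !fctE raddfD.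
rewrite (_ : (fun x => _) = (fun x => complex.Im (f x) + complex.Im (g x))).
  exact: measurable_funD.
by apply/funext => x; rewrite !fctE raddfD.
Qed.

Lemma measurableCZ k f : measurableC f -> measurableC (k *: f).
Proof.
move=> [fr fi]; case: k => u v; split.
  rewrite (_ : (fun x => _) =
    (fun x => u * complex.Re (f x) - v * complex.Im (f x))).
    by apply: measurable_funB; apply: measurable_funM => //; exact: measurable_cst.
  by apply/funext => x; rewrite !fctE; case: (f x).
rewrite (_ : (fun x => _) =
  (fun x => u * complex.Im (f x) + v * complex.Re (f x))).
  by apply: measurable_funD; apply: measurable_funM => //; exact: measurable_cst.
by apply/funext => x; rewrite !fctE; case: (f x).
Qed.

(** As for sequences, bounds on the square of the norm are carried along with
measurability. *)
Definition sqint_le f (M : R) := measurableC f /\ (L2_sqnorm f <= M%:E)%E.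

Lemma L2_sqnorm_ge0 f : (0 <= L2_sqnorm f)%E.
Proof. by apply: integral_ge0 => x _; rewrite lee_fin sqr_ge0. Qed.

Lemma sqint_le_le f M M' : M <= M' -> sqint_le f M -> sqint_le f M'.
Proof. by move=> MM [mf h]; split => //; rewrite (le_trans h)// lee_fin. Qed.

Lemma L2_sqint_le f : L2 f <-> exists M, sqint_le f M.
Proof.
split=> [[mr mi fin]|[M [[mr mi] h]]]; last first.
  by split => //; exact: le_lt_trans h (ltry _).
exists (fine (L2_sqnorm f)); split => //.
by rewrite fineK// ge0_fin_numE// L2_sqnorm_ge0.
Qed.

Lemma sqint_leD f g M M' : sqint_le f M -> sqint_le g M' -> sqint_le (f + g) (2 * M + 2 * M').
Proof.
move=> [mf hf] [mg hg]; split; first exact: measurableCD.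
have mf2 := measurableC_sqr mf; have mg2 := measurableC_sqr mg.
have c2 : (0 <= 2%:E :> \bar R)%E by rewrite lee_fin.
apply: (@le_trans _ _ (2%:E * L2_sqnorm f + 2%:E * L2_sqnorm g)%E); last first.
  by rewrite (EFinD (2 * M)) (EFinM 2 M) (EFinM 2 M') leeD// lee_wpmul2l.
rewrite /L2_sqnorm -!ge0_integralZl//; last 2 first.
- by move=> x _; rewrite lee_fin sqr_ge0.
- by move=> x _; rewrite lee_fin sqr_ge0.
rewrite -ge0_integralD//; last 4 first.
- by move=> x _; rewrite -EFinM lee_fin mulr_ge0// sqr_ge0.
- by apply: emeasurable_funM => //; exact: measurable_cst.
- by move=> x _; rewrite -EFinM lee_fin mulr_ge0// sqr_ge0.
- by apply: emeasurable_funM => //; exact: measurable_cst.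
apply: ge0_le_integral => //.
- by move=> x _; rewrite lee_fin sqr_ge0.
- exact: (measurableC_sqr (measurableCD mf mg)).
- by apply: emeasurable_funD; apply: emeasurable_funM => //; exact: measurable_cst.
- by move=> x _; rewrite -!EFinM -EFinD lee_fin; exact: sqr_normcD.
Qed.

Lemma sqint_leZ k f M : sqint_le f M -> sqint_le (k *: f) (normc k ^+ 2 * M).
Proof.
move=> [mf hf]; split; first exact: measurableCZ.
rewrite EFinM; apply: (@le_trans _ _ ((normc k ^+ 2)%:E * L2_sqnorm f)%E); last first.
  by rewrite lee_wpmul2l// lee_fin sqr_ge0.
rewrite /L2_sqnorm -ge0_integralZl ?lee_fin ?sqr_ge0//; last 2 first.
- exact: measurableC_sqr.
- by move=> x _; rewrite lee_fin sqr_ge0.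
rewrite le_eqVlt; apply/orP; left; apply/eqP; apply: eq_integral => x _.
by rewrite -EFinM -exprMn -normcM.
Qed.

Lemma sqint_le0 M : 0 <= M -> sqint_le 0 M.
Proof.
move=> M0; split; first by split; exact: measurable_cst.
rewrite (_ : L2_sqnorm 0 = 0%E) ?lee_fin//; apply: integral0_eq => x _.
by rewrite -[X in normc X]/(0 : R[i]) normc0 expr0n.
Qed.

Lemma sqint_le_eq f g M : {in D, f =1 g} -> sqint_le g M -> sqint_le f M.
Proof.
move=> fg [[mr mi] h]; split.
  by split; [apply: eq_measurable_fun mr|apply: eq_measurable_fun mi] => x xD;
    rewrite fg.
rewrite (_ : L2_sqnorm f = L2_sqnorm g)//; apply: eq_integral => x xD.
by rewrite fg.
Qed.

Lemma sqint_leB f g M M' : sqint_le f M -> sqint_le g M' -> sqint_le (f - g) (2 * M + 2 * M').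
Proof.
move=> hf hg; apply: sqint_leD => //.
have -> : - g = (-1) *: g by rewrite (scaleN1r g).
have -> : M' = normc (-1 : R[i]) ^+ 2 * M' by rewrite normcN normc1 expr1n mul1r.
exact: sqint_leZ.
Qed.

Lemma L2_lin k f g : L2 f -> L2 g -> L2 (k *: f + g).
Proof.
move=> /L2_sqint_le[M hf] /L2_sqint_le[M' hg]; apply/L2_sqint_le; eexists.
by apply: sqint_leD hg; exact: sqint_leZ hf.
Qed.

Lemma L2_norm_lt f (e : R) : 0 < e -> sqint_le f (e ^+ 2 / 2) -> L2_norm f < e.
Proof.
move=> e0 fe; have /L2_sqint_le[_ _ fin] : exists M, sqint_le f M by eexists; exact: fe.
apply: (@le_lt_trans _ _ (Num.sqrt (e ^+ 2 / 2))).
  rewrite /L2_norm ler_wsqrtr// -lee_fin fineK; first exact: fe.2.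
  by rewrite ge0_fin_numE// L2_sqnorm_ge0.
rewrite -[ltRHS](gtr0_norm e0) -sqrtr_sqr ltr_sqrt ?exprn_gt0//.
by rewrite ltr_pdivrMr// mulr_natr mulr2n ltrDl exprn_gt0.
Qed.

Lemma sqint_le_L2_norm f : L2 f -> sqint_le f (L2_norm f ^+ 2).
Proof.
move=> [mr mi fin]; split => //.
rewrite /L2_norm sqr_sqrtr ?fine_ge0 ?L2_sqnorm_ge0//.
by rewrite fineK// ge0_fin_numE// L2_sqnorm_ge0.
Qed.

End ComplexL2.

Section Dilation.
Variable R : realType.
Notation mu := (@lebesgue_measure R).
Notation D := (`]0%R, 1%R[%classic : set R).
Implicit Types (f g phi : R -> R[i]) (k : nat).

Let onD phi (y : R) : R[i] := if 0 < y < 1 then phi y else 0.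

Let measurable_onD (p : R[i] -> R) phi : p 0 = 0 ->
  measurable_fun D (fun x => p (phi x)) ->
  measurable_fun setT (fun x => p (onD phi x)).
Proof.
move=> p0 mphi.
rewrite (_ : (fun x => _) = (fun x => p (phi x)) \_ D).
  by apply/(measurable_restrictT _ _).1 => //.
apply/funext => x; rewrite /onD patchE; case: ifPn => [h|h].
  by rewrite mem_set//= in_itv.
by rewrite memNset//= in_itv; apply/negP.
Qed.

(** The image of the interval under [x |-> a x + b] may leave the interval, which
is why the function is first extended by 0. *)
Let sqint_le_affine phi (M a b : R) : 1 <= a -> sqint_le phi M ->
  sqint_le (fun x => onD phi (a * x + b)) M /\
  sqint_le (fun x => onD phi (- (a * x + b))) M.
Proof.
move=> a1 [[mr mi] h].
have mA : measurable_fun setT (fun x : R => a * x + b).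
  by apply: measurable_funD; [exact: measurable_funM|exact: measurable_cst].
have mN : measurable_fun setT (fun x : R => - (a * x + b)).
  exact: measurableT_comp.
have mR := measurable_onD (erefl : complex.Re 0 = 0) mr.
have mI := measurable_onD (erefl : complex.Im 0 = 0) mi.
pose G x := (normc (onD phi x) ^+ 2)%:E.
have mG : measurable_fun setT G.
  apply/measurable_EFinP; rewrite (_ : (fun x => _) =
    (fun x => complex.Re (onD phi x) ^+ 2 + complex.Im (onD phi x) ^+ 2)); last first.
    by apply/funext => x; exact: sqr_normcE.
  by apply: measurable_funD; apply: measurable_funX.
have G0 x : (0 <= G x)%E by rewrite lee_fin sqr_ge0.
have GM : (\int[mu]_x G x <= M%:E)%E.
  apply: le_trans h; rewrite /L2_sqnorm [leRHS]integral_mkcond.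
  rewrite le_eqVlt; apply/orP; left; apply/eqP; apply: eq_integral => x _.
  rewrite /G /onD patchE; case: ifPn => [hx|hx].
    by rewrite mem_set//= in_itv.
  by rewrite memNset ?normc0 ?expr0n//= in_itv; apply/negP.
have sub (H : R -> \bar R) : measurable_fun setT H -> (forall x, 0 <= H x)%E ->
    (\int[mu]_(x in D) H x <= \int[mu]_x H x)%E.
  by move=> mH H0; apply: ge0_subset_integral.
split; split.
- split; apply: measurable_funTS.
    exact: (measurableT_comp mR mA).
  exact: (measurableT_comp mI mA).
- apply: le_trans GM; apply: le_trans (ge0_integral_affine_le b a1 mG G0).
  exact: (sub (fun x => G (a * x + b)) (measurableT_comp mG mA) (fun x => G0 _)).
- split; apply: measurable_funTS.
    exact: (measurableT_comp mR mN).
  exact: (measurableT_comp mI mN).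
- apply: le_trans GM; rewrite -ge0_integralN//.
  have mGN : measurable_fun setT (fun x : R => G (- x)).
    exact: (measurableT_comp mG (@oppr_measurable R setT)).
  apply: le_trans (ge0_integral_affine_le b a1 mGN _) => //.
  exact: (sub (fun x => G (- (a * x + b))) (measurableT_comp mG mN) (fun x => G0 _)).
Qed.

(** On [[j/k, (j+1)/k]] the dilate is an affine copy of [phi], reflected and
negated for odd [j]. *)
Let piece phi k (j : nat) (x : R) : R[i] :=
  if odd j then - onD phi (j.+1%:R - k%:R * x) else onD phi (k%:R * x - j%:R).

(** At a given [x] the only nonzero piece is that of [j = floor(k x)]; at the
multiples of [1/k] all of them vanish, as the odd periodic extension does at
the integers. *)
Let dilateE phi k x : (0 < k)%N -> D x ->
  dilate phi k x = \sum_(0 <= j < k) piece phi k j x.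
Proof.
move=> k0; rewrite /= in_itv /= => /andP[x0 x1].
rewrite /dilate /piece; set y := k%:R * x.
have kR0 : (0 : R) < k%:R by rewrite ltr0n.
have y0 : 0 < y by rewrite mulr_gt0.
have yk : y < k%:R by rewrite /y -[ltRHS]mulr1 ltr_pM2l.
pose j := Num.truncn y.
have /andP[jy yj] : j%:R <= y < j.+1%:R by rewrite truncn_itv// ltW.
have jk : (j < k)%N by rewrite -(ltr_nat R) (le_lt_trans jy).
have uniq_j i : i%:R < y < i.+1%:R -> i = j.
  move=> /andP[h1 h2]; apply/eqP; rewrite eqn_leq -ltnS -(ltr_nat R).
  rewrite (lt_trans h1 yj) /= -ltnS -(ltr_nat R).
  exact: le_lt_trans jy h2.
rewrite (eq_big_nat _ _ (F2 := fun i => if i == j then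
    (if odd j then - onD phi (j.+1%:R - y) else onD phi (y - j%:R)) else 0)).
  rewrite -big_mkcond big_nat1_eq /= jk /odd_periodic_ext.
  have jE : j%:R = (odd j)%:R + 2 * (j./2)%:R :> R.
    by rewrite -{1}(odd_double_half j) natrD -muln2 natrM mulrC.
  have fl : Num.floor (y / 2) = (j./2)%:Z.
    apply/eqP; rewrite floor_eq ler_pdivlMr// ltr_pdivrMr//.
    have o01 : 0 <= ((odd j)%:R : R) <= 1 by rewrite ler0n lern1 leq_b1.
    rewrite intrD -!pmulrn; move: jy yj o01; rewrite -natr1 jE.
    by move=> h1 h2 /andP[h3 h4]; apply/andP; split; lra.
  rewrite fl; set y' := y - _.
  have y'E : y' = y - j%:R + (odd j)%:R.
    by rewrite /y' jE; ring.
  rewrite /onD; have [oj|oj] := boolP (odd j); rewrite ?oj ?(negPf oj) /= in y'E *.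
    rewrite ifF; last by apply/negP => /andP[_]; rewrite y'E; move: jy; lra.
    have -> : j.+1%:R - y = 2 - y' by rewrite y'E -natr1; ring.
    have -> : (0 < 2 - y' < 1) = (1 < y' < 2).
      by apply/idP/idP => /andP[h1 h2]; apply/andP; split; lra.
    by case: ifP; rewrite ?oppr0.
  have -> : y - j%:R = y' by rewrite y'E addr0.
  case: ifPn => // h; rewrite ifF//; apply/negP => /andP[h1 _].
  by move: yj h1; rewrite y'E -natr1; lra.
move=> i _; case: eqP => [->//|ij]; rewrite /onD.
case: (odd i); rewrite ifF ?oppr0//; apply/negP => /andP[h1 h2]; apply: ij;
  apply: uniq_j; apply/andP; move: h1 h2; rewrite -natr1; split; lra.
Qed.

(** The constant, which depends on [k] only, comes from adding up [k] pieces. *)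
Lemma sqint_le_dilate k : (0 < k)%N -> exists2 C : R, 0 <= C &
  forall phi M, sqint_le phi M -> sqint_le (dilate phi k) (C * M).
Proof.
move=> k0.
suff [C C0 hC] : exists2 C : R, 0 <= C & forall phi M, sqint_le phi M ->
    sqint_le (fun x => \sum_(0 <= j < k) piece phi k j x) (C * M).
  exists C => // phi M hphi; apply: sqint_le_eq (hC _ _ hphi) => x.
  by rewrite inE; exact: dilateE.
have k1 : (1 : R) <= k%:R by rewrite ler1n.
have hp phi M j : sqint_le phi M -> sqint_le (piece phi k j) M.
  move=> hphi; have [h1 _] := sqint_le_affine (- j%:R) k1 hphi.
  have [_ h2] := sqint_le_affine (- j.+1%:R) k1 hphi.
  rewrite /piece; case: (odd j); last exact: h1.
  have -> : M = normc (-1 : R[i]) ^+ 2 * M by rewrite normcN normc1 expr1n mul1r.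
  apply: sqint_le_eq (sqint_leZ (-1) h2) => x _.
  by rewrite !fctE opprB addrC -[_ *: _]/(_ * _) mulN1r [- _ + _]addrC.
elim: (k in index_iota 0 k) => [|n [C C0 IH]].
  exists 0 => // phi M _; rewrite mul0r; apply: sqint_le_eq (@sqint_le0 R 0 (lexx 0)) => x _.
  by rewrite big_geq.
exists (2 * C + 2 * 1); first by rewrite addr_ge0// mulr_ge0.
move=> phi M hphi; rewrite mulrDl -!mulrA mul1r.
apply: sqint_le_eq (sqint_leD (IH _ _ hphi) (hp phi M n hphi)) => x _.
by rewrite big_nat_recr.
Qed.

Lemma dilate_lin (c : R[i]) f g k :
  dilate (c *: f + g) k = c *: dilate f k + dilate g k.
Proof.
apply/funext => x; rewrite /dilate !fctE /odd_periodic_ext.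
case: ifP => // _; case: ifP => _; first by rewrite opprD scalerN.
by rewrite scaler0 addr0.
Qed.

End Dilation.

(** * Sine expansions *)

Section SineExpansions.
Variable R : realType.
Notation mu := (@lebesgue_measure R).
Notation D := (`]0%R, 1%R[%classic : set R).
Implicit Types (phi psi : R -> R[i]) (b c d : nat -> R[i]).

Definition sine_sum (N : nat) c (x : R) : R[i] := \sum_(1 <= n < N.+1) c n * sine_term n x.

Lemma sine_sumE N c : \sum_(1 <= n < N.+1) c n *: @sine_term R n = sine_sum N c.
Proof. by apply/funext => x; rewrite /sine_sum fct_sumE. Qed.

Lemma sine_termE n x : @sine_term R n x = (rsine n x)%:C.
Proof. by []. Qed.

Lemma sine_sum_ReIm N c x : sine_sum N c x =
  rsine_sum N (fun n => complex.Re (c n)) x +i* rsine_sum N (fun n => complex.Im (c n)) x.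
Proof.
rewrite /sine_sum /rsine_sum; elim: N => [|N IH]; first by rewrite !big_geq.
rewrite !(@big_nat_recr _ _ _ N.+1)// IH sine_termE; case: (c N.+1) => u v /=.
by simpc.
Qed.

Lemma sqint_le_sine_sum N c : sqint_le (sine_sum N c) (\sum_(1 <= n < N.+1) normc (c n) ^+ 2).
Proof.
have mr : measurable_fun D (rsine_sum N (fun n => complex.Re (c n))).
  exact: measurable_rsine_sum.
have mi : measurable_fun D (rsine_sum N (fun n => complex.Im (c n))).
  exact: measurable_rsine_sum.
split.
  split.
    rewrite (_ : (fun x => _) = rsine_sum N (fun n => complex.Re (c n)))//.
    by apply/funext => x; rewrite sine_sum_ReIm.
  rewrite (_ : (fun x => _) = rsine_sum N (fun n => complex.Im (c n)))//.
  by apply/funext => x; rewrite sine_sum_ReIm.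
rewrite (_ : \sum_(1 <= n < N.+1) _ = \sum_(1 <= n < N.+1) complex.Re (c n) ^+ 2 +
    \sum_(1 <= n < N.+1) complex.Im (c n) ^+ 2); last first.
  by rewrite -big_split; apply: eq_bigr => n _; exact: sqr_normcE.
rewrite EFinD -!sqint_rsine_sum /sqint -ge0_integralD//; last 4 first.
- by move=> x _; rewrite lee_fin sqr_ge0.
- by apply/measurable_EFinP; exact: measurable_funX.
- by move=> x _; rewrite lee_fin sqr_ge0.
- by apply/measurable_EFinP; exact: measurable_funX.
rewrite le_eqVlt; apply/orP; left; apply/eqP; apply: eq_integral => x _.
by rewrite -EFinD sqr_normcE sine_sum_ReIm.
Qed.

Lemma sqsum_sine_sum_le N c M : sqint_le (sine_sum N c) M ->
  \sum_(1 <= n < N.+1) normc (c n) ^+ 2 <= M.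
Proof.
move=> [[mr mi] h]; rewrite -lee_fin; apply: le_trans h.
rewrite (_ : \sum_(1 <= n < N.+1) _ = \sum_(1 <= n < N.+1) complex.Re (c n) ^+ 2 +
    \sum_(1 <= n < N.+1) complex.Im (c n) ^+ 2); last first.
  by rewrite -big_split; apply: eq_bigr => n _; exact: sqr_normcE.
rewrite EFinD -!sqint_rsine_sum /sqint -ge0_integralD//; last 4 first.
- by move=> x _; rewrite lee_fin sqr_ge0.
- by apply/measurable_EFinP; apply: measurable_funX; exact: measurable_rsine_sum.
- by move=> x _; rewrite lee_fin sqr_ge0.
- by apply/measurable_EFinP; apply: measurable_funX; exact: measurable_rsine_sum.
rewrite le_eqVlt; apply/orP; left; apply/eqP; apply: eq_integral => x _.
by rewrite -EFinD sqr_normcE sine_sum_ReIm.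
Qed.

Lemma sine_sum_lin N (k : R[i]) c d : sine_sum N (k *: c + d) = k *: sine_sum N c + sine_sum N d.
Proof.
apply/funext => x; rewrite !fctE /sine_sum scaler_sumr -big_split /=.
apply: eq_bigr => n _; rewrite -[(k *: c n)]/(k * c n) -[k *: _]/(k * _).
by rewrite mulrDl mulrA.
Qed.

Let sin_period (n m : nat) (y : R) :
  sin (n%:R * pi * (y - 2 * m%:R)) = sin (n%:R * pi * y).
Proof.
have -> : n%:R * pi * (y - 2 * m%:R) = n%:R * pi * y - (2 * (n%:R * m%:R * pi)) by ring.
pose t : R := n%:R * m%:R * pi.
have st : sin t = 0 by rewrite /t -natrM sin_natpi.
have ct : cos t ^+ 2 = 1 by have := cos2Dsin2 t; rewrite st expr0n addr0.
have s2 : sin (2 * t) = 0 by rewrite mulr_natl sin_mulr2n st mulr0 mul0rn.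
have c2 : cos (2 * t) = 1 by rewrite mulr_natl cos_mulr2n ct mulr2n addrK.
by rewrite -/t sinB s2 c2 mulr0 subr0 mulr1.
Qed.

(** Sine sums are themselves odd and 2-periodic, so that their extension from the
interval changes nothing. *)
Lemma sine_term_ext N c y : 0 <= y -> odd_periodic_ext (sine_sum N c) y = sine_sum N c y.
Proof.
move=> y0; rewrite /odd_periodic_ext; set z := y - _.
have [m mE] : exists m : nat, Num.floor (y / 2) = m%:Z.
  have : 0 <= Num.floor (y / 2) by rewrite floor_ge0 divr_ge0.
  by case: (Num.floor _) => // m _; exists m.
have per x : sine_sum N c (x - 2 * m%:R) = sine_sum N c x.
  by apply: eq_bigr => n _; rewrite /sine_term sin_period.
have zE : z = y - 2 * m%:R by rewrite /z mE -pmulrn.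
have Sz : sine_sum N c z = sine_sum N c y by rewrite zE per.
have /andP[z0 z2] : 0 <= z < 2.
  have := floor_itv (y / 2); rewrite mE => /andP[].
  rewrite intrD -!pmulrn ler_pdivlMr// ltr_pdivrMr// zE => h1 h2.
  by apply/andP; split; lra.
case: ifPn => [_|h1]; first exact: Sz.
have odd_s x : sine_sum N c (2 - x) = - sine_sum N c x.
  rewrite /sine_sum -sumrN; apply: eq_bigr => n _; rewrite -mulrN /sine_term.
  have -> : n%:R * pi * (2 - x) = - (n%:R * pi * (x - 2 * 1%:R)) by ring.
  by rewrite sinN sin_period [Num.sqrt 2 * - _]mulrN rmorphN.
case: ifPn => [_|h2]; first by rewrite odd_s opprK.
rewrite -Sz; have : z = 0 \/ z = 1.
  move: h1 h2; rewrite !negb_and -!leNgt.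
  case/orP=> h1; first by left; apply: le_anti; rewrite z0 h1.
  case/orP=> h2; first by right; apply: le_anti; rewrite h1 h2.
  by move: z2; rewrite ltNge h2.
case=> ->; rewrite /sine_sum big1// => n _; rewrite /sine_term.
  by rewrite mulr0 sin0 mulr0 mulr0.
by rewrite mulr1 sin_natpi mulr0 mulr0.
Qed.

(** [sin(n pi (k x))] is the sine of index [k n] at [x]. *)
Lemma sine_sum_dshift N c k : (0 < k)%N ->
  {in D, sine_sum N (dshift k c) =1 dilate (sine_sum (N %/ k) c) k}.
Proof.
move=> k0 x; rewrite inE /= in_itv /= => /andP[x0 x1].
rewrite /dilate sine_term_ext; last by rewrite mulr_ge0// ltW.
rewrite /sine_sum (@dshift_sum _ _ (fun n u => u * sine_term n x))//; last first.
  by move=> n; rewrite mul0r.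
apply: eq_bigr => n _; rewrite /sine_term natrM.
by have -> : k%:R * n%:R * pi * x = n%:R * pi * (k%:R * x) by ring.
Qed.

(** Stated with explicit bounds rather than as a limit of norms, so that it adds up
by [sqint_leD] and transfers to and from sequences. *)
Definition expands phi b := L2 phi /\ forall e : R, 0 < e ->
  exists N0, forall N, (N0 <= N)%N -> sqint_le (phi - sine_sum N b) e.

Lemma L2_sine_sum N c : L2 (sine_sum N c).
Proof. by apply/L2_sqint_le; eexists; exact: sqint_le_sine_sum. Qed.

Lemma L2B phi psi : L2 phi -> L2 psi -> L2 (phi - psi).
Proof.
move=> h1 h2; have -> : phi - psi = (-1) *: psi + phi by rewrite (scaleN1r psi) addrC.
exact: L2_lin.
Qed.

Lemma sine_expansion_expands phi b : L2 phi -> sine_expansion phi b -> expands phi b.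
Proof.
move=> phi2 hb; split => // e e0.
have se0 : 0 < Num.sqrt e by rewrite sqrtr_gt0.
have /cvgrPdist_lt/(_ _ se0)[N0 _ hN0] := hb; exists N0 => N N0N.
have := hN0 N N0N; rewrite /= sub0r normrN sine_sumE ger0_norm ?sqrtr_ge0// => h.
have : sqint_le (phi - sine_sum N b) (L2_norm (phi - sine_sum N b) ^+ 2).
  by apply: sqint_le_L2_norm; apply: L2B => //; exact: L2_sine_sum.
apply: sqint_le_le; rewrite -[leRHS](sqr_sqrtr (ltW e0)).
by rewrite lerXn2r ?nnegrE ?sqrtr_ge0// ltW.
Qed.

Lemma expands_lin (k : R[i]) phi psi b c : expands phi b -> expands psi c ->
  expands (k *: phi + psi) (k *: b + c).
Proof.
move=> [phi2 hb] [psi2 hc]; split; first exact: L2_lin.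
move=> e e0; have k0 : 0 < 2 * normc k ^+ 2 + 1.
  by rewrite ltr_wpDl// mulr_ge0// sqr_ge0.
have [N1 h1] := hb (e / 2 / (2 * normc k ^+ 2 + 1))
        (divr_gt0 (divr_gt0 e0 (ltr0Sn R 1)) k0).
have [N2 h2] := hc (e / 4) (divr_gt0 e0 (ltr0Sn R 3)).
exists (maxn N1 N2) => N; rewrite geq_max => /andP[N1N N2N].
have -> : k *: phi + psi - sine_sum N (k *: b + c) =
    k *: (phi - sine_sum N b) + (psi - sine_sum N c).
  by rewrite sine_sum_lin scalerBr opprD addrACA.
apply: sqint_le_le (sqint_leD (sqint_leZ k (h1 N N1N)) (h2 N N2N)).
have : 2 * normc k ^+ 2 * (e / 2 / (2 * normc k ^+ 2 + 1)) <= e / 2.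
  by rewrite mulrA ler_pdivrMr// mulrC ler_pM2l ?divr_gt0// lerDl.
by rewrite -mulrA; lra.
Qed.

Lemma expands_sine_sum K c : (forall n, (K < n)%N -> c n = 0) -> expands (sine_sum K c) c.
Proof.
move=> cK; split; first exact: L2_sine_sum.
move=> e e0; exists K => N KN.
have -> : sine_sum K c - sine_sum N c = 0; last by apply: sqint_le0; exact: ltW.
apply/funext => x; rewrite !fctE /sine_sum (@big_cat_nat _ _ _ K.+1 1 N.+1)//=.
rewrite [X in _ - (_ + X)]big_nat [X in _ - (_ + X)]big1 ?addr0 ?subrr//.
by move=> n /andP[Kn _]; rewrite cK// mul0r.
Qed.

(** Dilation is bounded, and maps partial sums to partial sums by [sine_sum_dshift]. *)
Lemma expands_dilate phi b k : (0 < k)%N -> expands phi b ->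
  expands (dilate phi k) (dshift k b).
Proof.
move=> k0 [phi2 hb]; have [C C0 hC] := sqint_le_dilate R k0; split.
  by have /L2_sqint_le[M hM] := phi2; apply/L2_sqint_le; eexists; exact: hC hM.
move=> e e0; have C10 : 0 < C + 1 by rewrite ltr_wpDl.
have [N0 hN0] := hb (e / (C + 1)) (divr_gt0 e0 C10).
exists (k * N0)%N => N N0N.
have h : sqint_le (dilate (phi - sine_sum (N %/ k) b) k) (C * (e / (C + 1))).
  by apply/hC/hN0; rewrite leq_divRL// mulnC.
apply: sqint_le_le (_ : sqint_le _ (C * (e / (C + 1)))).
  by rewrite mulrA ler_pdivrMr// mulrC ler_pM2l// lerDl.
apply: sqint_le_eq h => x xD.
have -> : phi - sine_sum (N %/ k) b = (-1) *: sine_sum (N %/ k) b + phi.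
  by rewrite (scaleN1r (sine_sum _ b)) addrC.
rewrite dilate_lin !fctE sine_sum_dshift// -[_ *: _]/(_ * _) mulN1r addrC.
by rewrite [- _ + _]addrC.
Qed.

(** Bessel up to a constant: the partial sum of rank [K] has norm at most that of
[phi] plus that of the remainder. *)
Lemma expands_sqsum_le phi b M e : 0 < e -> expands phi b -> sqint_le phi M ->
  sqsum_le b (2 * M + e).
Proof.
move=> e0 [_ hb] hM N.
have [N0 hN0] := hb (e / 2) (divr_gt0 e0 (ltr0Sn R 1)).
pose K := maxn N0 N; have NK : (N <= K)%N by exact: leq_maxr.
apply: (@le_trans _ _ (\sum_(1 <= n < K.+1) normc (b n) ^+ 2)).
  rewrite [leRHS](@big_cat_nat _ _ _ N.+1)//= lerDl.
  by apply: sumr_ge0 => n _; exact: sqr_ge0.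
apply: sqsum_sine_sum_le.
have -> : sine_sum K b = phi - (phi - sine_sum K b) by rewrite subKr.
apply: sqint_le_le (sqint_leB hM (hN0 K (leq_maxl _ _))).
by lra.
Qed.

(** Parseval up to a constant, in the other direction. *)
Lemma sqsum_le_expands phi b M e : 0 < e -> expands phi b -> sqsum_le b M ->
  sqint_le phi (2 * M + e).
Proof.
move=> e0 [_ hb] hM.
have [N0 hN0] := hb (e / 2) (divr_gt0 e0 (ltr0Sn R 1)).
have -> : phi = (phi - sine_sum N0 b) + sine_sum N0 b by rewrite subrK.
apply: sqint_le_le (sqint_leD (hN0 N0 (leqnn _)) (sqint_le_sine_sum N0 b)).
by have := hM N0; lra.
Qed.

Lemma expands_l2 phi b : expands phi b -> l2 b.
Proof.
move=> h; have /L2_sqint_le[M hM] := h.1.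
by exists (2 * M + 1); exact: expands_sqsum_le hM.
Qed.

End SineExpansions.

(** * Completeness of the sines *)

Section SineCompleteness.
Variable R : realType.
Notation mu := (@lebesgue_measure R).
Notation D := (`]0%R, 1%R[%classic : set R).
Implicit Types (f h : R -> R[i]) (g w : R -> R).

Lemma sqint_le_mono f h M : measurableC f -> (forall x, D x -> normc (f x) <= normc (h x)) ->
  sqint_le h M -> sqint_le f M.
Proof.
move=> mf fh [mh hM]; split => //; apply: le_trans hM.
apply: ge0_le_integral => //.
- by move=> x _; rewrite lee_fin sqr_ge0.
- exact: measurableC_sqr.
- exact: measurableC_sqr.
- by move=> x Dx; rewrite lee_fin lerXn2r ?nnegrE ?normc_ge0// fh.
Qed.

(** Dominated convergence in L^2: [|f - f_n|^2] is dominated by [4 |h|^2]. *)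
Lemma dominated_sqint_le (f_ : nat -> R -> R[i]) f h M :
  (forall n, measurableC (f_ n)) -> measurableC f -> sqint_le h M ->
  (forall n x, D x -> normc (f_ n x) <= normc (h x)) ->
  (forall x, D x -> (fun n => normc (f x - f_ n x)) @ \oo --> (0 : R)) ->
  forall e : R, 0 < e -> exists n, sqint_le (f - f_ n) e.
Proof.
move=> mf_ mf hM f_h f_f e e0.
have mD : measurable D by exact: measurable_itv.
have mB n : measurableC (f - f_ n).
  have -> : f - f_ n = (-1) *: f_ n + f by rewrite (scaleN1r (f_ n)) addrC.
  by apply: measurableCD => //; exact: measurableCZ.
pose u n x : \bar R := (normc (f x - f_ n x) ^+ 2)%:E.
have mu_ n : measurable_fun D (u n) by exact: measurableC_sqr (mB n).
have fh x : D x -> normc (f x) <= normc (h x).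
  move=> Dx; apply/ler_addgt0Pr => d d0.
  have /cvgrPdist_lt/(_ _ d0)[n _ /(_ n (leqnn n))] := f_f x Dx.
  rewrite /= sub0r normrN ger0_norm ?normc_ge0// => /ltW hn.
  rewrite -(subrK (f_ n x) (f x)) addrC; apply: le_trans (le_normcD _ _) _.
  by rewrite lerD// f_h.
have ih : mu.-integrable D (fun x => (4 * normc (h x) ^+ 2)%:E).
  apply/integrableP; split.
    apply/measurable_EFinP; apply: measurable_funM; first exact: measurable_cst.
    by apply/measurable_EFinP; exact: (measurableC_sqr hM.1).
  apply: (@le_lt_trans _ _ (4 * M)%:E); last exact: ltry.
  rewrite (_ : (4 * M)%:E = (4%:E * M%:E)%E)//.
  apply: (@le_trans _ _ (4%:E * L2_sqnorm h)%E); last first.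
    by rewrite lee_wpmul2l ?lee_fin//; exact: hM.2.
  rewrite /L2_sqnorm -ge0_integralZl//; last 2 first.
  - exact: measurableC_sqr hM.1.
  - by move=> x _; rewrite lee_fin sqr_ge0.
  rewrite le_eqVlt; apply/orP; left; apply/eqP; apply: eq_integral => x _.
  by rewrite -EFinM gee0_abs// lee_fin mulr_ge0// sqr_ge0.
pose z : R -> \bar R := cst 0%E.
have H1 : forall x, D x -> u ^~ x @ \oo --> z x.
  move=> x Dx; rewrite /u; apply: cvg_EFin; first exact: nearW.
  by have := cvgM (f_f x Dx) (f_f x Dx); rewrite mulr0; exact.
have H2 : forall x n, D x -> (`|u n x| <= (4 * normc (h x) ^+ 2)%:E)%E.
  move=> x n Dx; rewrite gee0_abs ?lee_fin ?sqr_ge0//.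
  have h1 : normc (f x) ^+ 2 <= normc (h x) ^+ 2.
    by rewrite lerXn2r ?nnegrE ?normc_ge0// fh.
  have h2 : normc (f_ n x) ^+ 2 <= normc (h x) ^+ 2.
    by rewrite lerXn2r ?nnegrE ?normc_ge0// f_h.
  have := sqr_normcD (f x) (- f_ n x); rewrite normcN.
  by move: h1 h2; lra.
have A1 : {ae mu, forall x, D x -> u ^~ x @ \oo --> z x} by apply: aeW.
have A2 : {ae mu, forall x n, D x -> (`|u n x| <= (4 * normc (h x) ^+ 2)%:E)%E}.
  exact: aeW.
have [_ _] := @dominated_convergence _ _ R mu D mD u z _ mu_ (measurable_cst _) A1 ih A2.
have -> : (\int[mu]_(x in D) z x = 0)%E by apply: integral0_eq.
have e0' : (0 < e%:E)%E by rewrite lte_fin.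
move=> /fine_cvgP[fin] /cvgrPdist_lt/(_ _ e0)[n2 _ hn2].
have [n1 _ hn1] := fin; pose n := maxn n1 n2; exists n; split => //.
have := hn2 n (leq_maxr _ _); rewrite /= sub0r normrN.
have fn := hn1 n (leq_maxl _ _); rewrite /= in fn.
have I0 : (0 <= \int[mu]_(x in D) u n x)%E.
  by apply: integral_ge0 => x _; rewrite lee_fin sqr_ge0.
rewrite ger0_norm ?fine_ge0// => /ltW; rewrite -lee_fin fineK//.
Qed.

(** The closed linear span of the sines, as a predicate on representatives. *)
Definition spanned f := measurableC f /\
  forall e : R, 0 < e -> exists N c, sqint_le (f - sine_sum N c) e.

Lemma spanned_L2 f : spanned f -> exists M, sqint_le f M.
Proof.
move=> [mf hf]; have [N [c h]] := hf 1 ltr01; eexists.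
have -> : f = (f - sine_sum N c) + sine_sum N c by rewrite subrK.
exact: sqint_leD h (sqint_le_sine_sum N c).
Qed.

Lemma spanned_sine_sum N c : spanned (sine_sum N c).
Proof.
split; first by have [] := sqint_le_sine_sum N c.
by move=> e e0; exists N, c; rewrite subrr; apply: sqint_le0; exact: ltW.
Qed.

Lemma spanned_closed f : measurableC f ->
  (forall e : R, 0 < e -> exists2 h, spanned h & sqint_le (f - h) e) -> spanned f.
Proof.
move=> mf hf; split => // e e0; have e40 : 0 < e / 4 by rewrite divr_gt0.
have [h [_ hh] fh] := hf _ e40; have [N [c hc]] := hh _ e40; exists N, c.
have -> : f - sine_sum N c = (f - h) + (h - sine_sum N c) by rewrite addrA subrK.
by apply: sqint_le_le (sqint_leD fh hc); lra.
Qed.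

Lemma sine_sum_widen N K (c : nat -> R[i]) : (N <= K)%N -> sine_sum N c = sine_sum K (upto N c).
Proof.
move=> NK; apply/funext => x; rewrite /sine_sum [RHS](@big_cat_nat _ _ _ N.+1)//=.
rewrite [X in _ = _ + X]big_nat [X in _ = _ + X]big1 ?addr0; last first.
  by move=> k /andP[Nk _]; rewrite /upto leqNgt Nk mul0r.
by apply: eq_big_nat => k /andP[_ kN]; rewrite /upto -ltnS kN.
Qed.

Lemma spanned_lin (k : R[i]) f h : spanned f -> spanned h -> spanned (k *: f + h).
Proof.
move=> [mf hf] [mh hh]; split; first by apply: measurableCD => //; exact: measurableCZ.
move=> e e0; have k0 : 0 < 2 * normc k ^+ 2 + 1.
  by rewrite ltr_wpDl// mulr_ge0// sqr_ge0.
have [N [c hc]] := hf (e / 2 / (2 * normc k ^+ 2 + 1))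
        (divr_gt0 (divr_gt0 e0 (ltr0Sn R 1)) k0).
have [K [d hd]] := hh (e / 4) (divr_gt0 e0 (ltr0Sn R 3)).
exists (maxn N K), (k *: upto N c + upto K d).
have -> : k *: f + h - sine_sum (maxn N K) (k *: upto N c + upto K d) =
    k *: (f - sine_sum N c) + (h - sine_sum K d).
  rewrite sine_sum_lin -(sine_sum_widen c (leq_maxl N K)) -(sine_sum_widen d (leq_maxr N K)).
  by rewrite scalerBr opprD addrACA.
apply: sqint_le_le (sqint_leD (sqint_leZ k hc) hd).
have : 2 * normc k ^+ 2 * (e / 2 / (2 * normc k ^+ 2 + 1)) <= e / 2.
  by rewrite mulrA ler_pdivrMr// mulrC ler_pM2l ?divr_gt0// lerDl.
by rewrite -mulrA; lra.
Qed.

Lemma spanned0 : spanned 0.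
Proof.
have -> : 0 = sine_sum 0 (0 : nat -> R[i]); last exact: spanned_sine_sum.
by apply/funext => x; rewrite /sine_sum big_geq.
Qed.

Lemma spannedZ (k : R[i]) f : spanned f -> spanned (k *: f).
Proof. by move=> hf; rewrite -[k *: f]addr0; apply: spanned_lin => //; exact: spanned0. Qed.

Lemma spanned_eq f h : (forall x, D x -> f x = h x) -> spanned h -> spanned f.
Proof.
move=> fh [[mr mi] hh]; have mf : measurableC f.
  by split; [apply: eq_measurable_fun mr|apply: eq_measurable_fun mi] => x;
    rewrite inE => /fh ->.
apply: spanned_closed => // e e0; exists h => //.
apply: sqint_le_eq (sqint_le0 (ltW e0)) => x; rewrite inE => /fh e'.
by rewrite !fctE e' subrr.
Qed.

Lemma spanned_dominated (f_ : nat -> R -> R[i]) f h M :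
  (forall n, spanned (f_ n)) -> measurableC f -> sqint_le h M ->
  (forall n x, D x -> normc (f_ n x) <= normc (h x)) ->
  (forall x, D x -> (fun n => normc (f x - f_ n x)) @ \oo --> (0 : R)) -> spanned f.
Proof.
move=> Vf mf hM f_h f_f; apply: spanned_closed => // e e0.
have [n hn] := dominated_sqint_le (fun n => (Vf n).1) mf hM f_h f_f e0.
by exists (f_ n).
Qed.

(** These functions form an algebra closed under bounded pointwise limits.  It
contains [cos(pi x)], hence all bounded measurable functions; reaching the
indicators of Borel sets is enough. *)
Definition smult g := [/\ measurable_fun D g,
  exists B : R, forall x, D x -> `|g x| <= B &
  forall f, spanned f -> spanned (fun x => (g x)%:C * f x)].

Lemma measurableC_mul g f : measurable_fun D g -> measurableC f ->
  measurableC (fun x => (g x)%:C * f x).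
Proof.
move=> mg [mr mi]; split.
  rewrite (_ : (fun x => _) = (fun x => g x * complex.Re (f x))).
    exact: measurable_funM.
  by apply/funext => x; case: (f x) => u v /=; rewrite mul0r subr0.
rewrite (_ : (fun x => _) = (fun x => g x * complex.Im (f x))).
  exact: measurable_funM.
by apply/funext => x; case: (f x) => u v /=; rewrite mul0r addr0.
Qed.

Lemma normc_mul_le g f (B : R) x : `|g x| <= B ->
  normc ((g x)%:C * f x) <= normc ((B%:C *: f) x).
Proof.
move=> gB; rewrite -[(_ *: f) x]/(_ * _) !normcM !normc_real.
by rewrite ler_wpM2r ?normc_ge0// (le_trans gB)// ler_norm.
Qed.

Lemma smult_eq g w : (forall x, D x -> g x = w x) -> smult w -> smult g.
Proof.
move=> gw [mw [B wB] wV]; split.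
- by apply: eq_measurable_fun mw => x; rewrite inE => /gw.
- by exists B => x Dx; rewrite gw// wB.
- by move=> f /wV; apply: spanned_eq => x Dx; rewrite gw.
Qed.

Lemma smult_cst (r : R) : smult (cst r).
Proof.
split; [exact: measurable_cst|by exists (`|r|%R) |].
by move=> f Vf; exact: (spannedZ r%:C Vf).
Qed.

Lemma smultD g w : smult g -> smult w -> smult (fun x => g x + w x).
Proof.
move=> [mg [B gB] gV] [mw [B' wB] wV]; split; first exact: measurable_funD.
  by exists (B + B') => x Dx; rewrite (le_trans (ler_normD _ _))// lerD ?gB ?wB.
move=> f Vf; have := spanned_lin 1 (gV f Vf) (wV f Vf).
by apply: spanned_eq => x Dx; rewrite !fctE scale1r rmorphD mulrDl.
Qed.

Lemma smultM g w : smult g -> smult w -> smult (fun x => g x * w x).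
Proof.
move=> [mg [B gB] gV] [mw [B' wB] wV]; split; first exact: measurable_funM.
  by exists (B * B') => x Dx; rewrite normrM ler_pM ?gB ?wB.
move=> f Vf; have := gV _ (wV f Vf).
by apply: spanned_eq => x Dx; rewrite rmorphM mulrA.
Qed.

Lemma smultX g n : smult g -> smult (fun x => g x ^+ n).
Proof.
move=> Vg; elim: n => [|n IH].
  by apply: smult_eq (smult_cst 1) => x _; rewrite expr0.
by apply: smult_eq (smultM Vg IH) => x _; rewrite exprS.
Qed.

Lemma smult_sum (I : Type) (s : seq I) (F : I -> R -> R) :
  (forall i, smult (F i)) -> smult (fun x => \sum_(i <- s) F i x).
Proof.
move=> h; elim: s => [|i s IH].
  by apply: smult_eq (smult_cst 0) => x _; rewrite big_nil.
by apply: smult_eq (smultD (h i) IH) => x _; rewrite big_cons.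
Qed.

(** Dominated convergence in L^2 applied to the products [g_n f]. *)
Lemma smult_lim (g_ : nat -> R -> R) g (B : R) : (forall n, smult (g_ n)) ->
  (forall n x, D x -> `|g_ n x| <= B) ->
  (forall x, D x -> g_ ^~ x @ \oo --> g x) -> smult g.
Proof.
move=> Vg gB cvg; have mD : measurable D by exact: measurable_itv.
have mg : measurable_fun D g.
  apply: (@measurable_fun_cvg _ _ _ D g_) => //; first by move=> n; case: (Vg n).
have gB' x : D x -> `|g x| <= B.
  move=> Dx; apply/ler_addgt0Pr => d d0.
  have /cvgrPdist_lt/(_ _ d0)[n _ /(_ n (leqnn n)) /= /ltW hn] := cvg x Dx.
  rewrite -(subrK (g_ n x) (g x)) addrC; apply: le_trans (ler_normD _ _) _.
  by rewrite lerD// gB.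
split => //; first by exists B.
move=> f Vf; have [M hM] := spanned_L2 Vf.
apply: (@spanned_dominated (fun n x => (g_ n x)%:C * f x) _ (B%:C *: f)).
- by move=> n; have [_ _ h] := Vg n; exact: h.
- exact: measurableC_mul mg Vf.1.
- exact: sqint_leZ hM.
- by move=> n x Dx; apply: normc_mul_le; exact: gB.
- move=> x Dx; have -> : (fun n => normc ((g x)%:C * f x - (g_ n x)%:C * f x)) =
    (fun n => `|g x - g_ n x| * normc (f x)).
    apply/funext => n; rewrite -mulrBl normcM -normc_real.
    by rewrite -rmorphB.
  rewrite -[X in _ --> X](mul0r (normc (f x))); apply: cvgMr_tmp.
  apply/cvgrPdist_lt => d d0.
  have /cvgrPdist_lt/(_ _ d0) := cvg x Dx; apply: filterS => n.
  by rewrite sub0r normrN normr_id.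
Qed.

(** [2 cos(pi x) sin(n pi x)] is the sum of the sines of indices [n + 1] and
[n - 1]; the index 0 gives the zero function. *)
Lemma smult_cos : smult (fun x => cos (pi * x)).
Proof.
have mc : measurable_fun D (fun x : R => cos (pi * x)).
  apply: measurable_funTS; apply: continuous_measurable_fun => x.
  apply: (@continuous_comp _ _ _ (fun y : R => pi * y) cos).
    by apply: continuousM; [exact: cvg_cst|exact: cvg_id].
  exact: continuous_cos.
split => //; first by exists 1 => x _; exact: cos_max.
have Vsine n : spanned (@sine_term R n).
  apply: spanned_eq (spanned_sine_sum n (fun m => (m == n)%:R)) => x _.
  rewrite /sine_sum (eq_bigr (fun m => if m == n then sine_term n x else 0)).
    rewrite -big_mkcond big_nat1_eq ltnSn andbT; case: (n) => // .
    by rewrite /sine_term mul0r mul0r sin0 mulr0.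
  by move=> m _; case: eqP => [->|_]; rewrite ?mul1r// mul0r.
have Vcs n : spanned (fun x => (cos (pi * x))%:C * @sine_term R n.+1 x).
  apply: spanned_eq (spanned_lin (2^-1%:C) (Vsine n.+2) (spannedZ (2^-1%:C) (Vsine n))) => x _.
  rewrite !fctE -![_ *: sine_term _ x]/(_ * _) -mulrDr /sine_term -!rmorphM -rmorphD.
  rewrite -rmorphM; congr (_%:C).
  have -> : n.+2%:R * pi * x = n.+1%:R * pi * x + pi * x by rewrite -natr1; ring.
  have -> : n%:R * pi * x = n.+1%:R * pi * x - pi * x by rewrite -natr1; ring.
  by rewrite sinD sinB; field.
have Vcssum N c : spanned (fun x => (cos (pi * x))%:C * sine_sum N c x).
  elim: N => [|N IH].
    by apply: spanned_eq spanned0 => x _; rewrite /sine_sum big_geq// mulr0.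
  apply: spanned_eq (spanned_lin (c N.+1) (Vcs N) IH) => x _.
  rewrite !fctE /sine_sum (@big_nat_recr _ _ _ N.+1)// mulrDr addrC.
  by congr (_ + _); rewrite -[RHS]/(c N.+1 * _) mulrCA.
move=> f [mf hf]; apply: spanned_closed; first exact: measurableC_mul.
move=> e e0; have [N [c hc]] := hf e e0.
exists (fun x => (cos (pi * x))%:C * sine_sum N c x) => //.
apply: sqint_le_mono hc.
  have -> : (fun x => (cos (pi * x))%:C * f x) - (fun x => (cos (pi * x))%:C * sine_sum N c x)
    = (fun x => (cos (pi * x))%:C * (f - sine_sum N c) x).
    by apply/funext => x; rewrite !fctE mulrBr.
  apply: measurableC_mul => //.
  have -> : f - sine_sum N c = (-1) *: sine_sum N c + f by rewrite (scaleN1r (sine_sum N c)) addrC.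
  by apply: measurableCD => //; apply: measurableCZ; have [] := sqint_le_sine_sum N c.
move=> x _; rewrite !fctE -mulrBr normcM normc_real ler_piMl ?normc_ge0//.
exact: cos_max.
Qed.

(** The polynomials defined by [p 0 = 0] and [p (n+1) = p n + (w^2 - (p n)^2) / 2]
increase to [|w|], geometrically fast where [w] does not vanish. *)
Lemma smult_abs w : (forall x, D x -> `|w x| <= 1) -> smult w ->
  smult (fun x => `|w x|).
Proof.
move=> w1 Vw.
pose p := fix p n (x : R) : R :=
  if n is m.+1 then p m x + (w x ^+ 2 - p m x ^+ 2) / 2 else 0.
have pE n x : D x -> 0 <= p n x <= `|w x| /\
    `|w x| - p n x <= `|w x| * (1 - `|w x| / 2) ^+ n.
  move=> Dx; have a0 := normr_ge0 (w x); have a1 := w1 x Dx.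
  elim: n => [|n [/andP[p0 pw] IH]] /=; first by rewrite lexx a0 subr0 expr0 mulr1.
  rewrite -(real_normK (num_real (w x))); set a := `|w x| in a0 a1 p0 pw IH *.
  have -> : p n x + (a ^+ 2 - p n x ^+ 2) / 2 =
      a - (a - p n x) * (1 - (a + p n x) / 2) by field.
  set q := p n x in p0 pw IH *; split.
    by apply/andP; split; nra.
  rewrite subKr exprSr mulrA.
  apply: ler_pM => //; [by rewrite subr_ge0| by lra | by lra].
apply: (@smult_lim p _ 1).
- elim=> [|n IH]; first exact: smult_cst.
  apply: smultD => //.
  apply: smult_eq (smultM (smultD (smultX 2 Vw) (smultM (smult_cst (-1)) (smultX 2 IH)))
    (smult_cst 2^-1)) => x _.
  by rewrite /= mulN1r.
- move=> n x Dx; have [/andP[p0 pw] _] := pE n x Dx.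
  by rewrite ger0_norm// (le_trans pw)// w1.
- move=> x Dx; apply/cvgrPdist_le => e e0.
  have [w0|w0] := eqVneq (w x) 0.
    apply: nearW => n; have [/andP[p0 pw] _] := pE n x Dx.
    rewrite w0 normr0 in pw *; rewrite sub0r normrN ger0_norm//.
    by apply: le_trans pw _; exact: ltW.
  have a0 : 0 < `|w x| by rewrite normr_gt0.
  have r1 : `|1 - `|w x| / 2| < 1.
    by rewrite ger0_norm; have := w1 x Dx; lra.
  have /cvgrPdist_le/(_ _ e0) := cvg_expr r1; apply: filterS => n.
  rewrite sub0r normrN => hn; have [/andP[p0 pw] h] := pE n x Dx.
  rewrite ger0_norm ?subr_ge0//; apply: le_trans h _; apply: le_trans hn.
  rewrite [leRHS]ger0_norm; last by apply: exprn_ge0; have := w1 x Dx; lra.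
  rewrite ler_piMl ?w1//; apply: exprn_ge0; have := w1 x Dx; lra.
Qed.

(** With [v = max(w, 0)], the powers [(1 - v)^n] tend to the indicator of
[w <= 0]. *)
Lemma smult_pos w : (forall x, D x -> `|w x| <= 1) -> smult w ->
  smult (fun x => (0 < w x)%R%:R).
Proof.
move=> w1 Vw; pose v x := (`|w x| + w x) / 2.
have Vv : smult v by apply: smultM (smult_cst _); apply: smultD => //; exact: smult_abs.
have v01 x : D x -> 0 <= 1 - v x <= 1.
  move=> Dx; have := w1 x Dx; have := ler_norm (w x); have := ler_norm (- w x).
  by rewrite normrN /v => h1 h2 h3; apply/andP; split; lra.
apply: (@smult_lim (fun n x => 1 - (1 - v x) ^+ n) _ 1).
- move=> n; apply: smult_eq (smultD (smult_cst 1) (smultM (smult_cst (-1))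
    (smultX n (smultD (smult_cst 1) (smultM (smult_cst (-1)) Vv))))) => x _.
  by rewrite /= !mulN1r.
- move=> n x Dx; have /andP[h0 h1] := v01 x Dx.
  have h2 := exprn_ge0 n h0; have h3 := exprn_ile1 n h0 h1.
  by rewrite ger0_norm; lra.
- move=> x Dx; have /andP[h0 h1] := v01 x Dx.
  have [w0|w0] := ltP 0 (w x).
    rewrite -[X in _ --> X](subr0 (1 : R)); apply: cvgB; first exact: cvg_cst.
    apply: cvg_expr; rewrite ger0_norm// /v gtr0_norm//; lra.
  rewrite (_ : (fun n => _) = cst 0); first exact: cvg_cst.
  by apply/funext => n; rewrite /v ler0_norm// addNr mul0r subr0 expr1n subrr.
Qed.

(** The cosine decreases on [[0, pi]], so [x < t] means
[cos(pi x) - cos(pi t) > 0]. *)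
Lemma smult_ray (t : R) : smult (\1_(`]-oo, t[%classic : set R)).
Proof.
have rayE x : \1_(`]-oo, t[%classic : set R) x = (x < t)%R%:R :> R.
  by rewrite indicE; congr (nat_of_bool _)%:R; apply/idP/idP => h;
    [move: h; rewrite inE /= in_itv|rewrite inE /= in_itv].
have [t0|t0] := leP t 0.
  apply: smult_eq (smult_cst 0) => x /=; rewrite in_itv /= => /andP[x0 _].
  by rewrite rayE ltNge (le_trans t0 (ltW x0)).
have [t1|t1] := leP 1 t.
  apply: smult_eq (smult_cst 1) => x /=; rewrite in_itv /= => /andP[_ x1].
  by rewrite rayE (lt_le_trans x1 t1).
pose w x := (cos (pi * x) + - cos (pi * t)) * 2^-1.
have Vw : smult w.
  by apply: smultM (smult_cst _); apply: smultD (smult_cst _); exact: smult_cos.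
apply: smult_eq (smult_pos _ Vw) => [x|x _]; last first.
  have := cos_max (pi * x); have := cos_max (pi * t); rewrite !ler_norml /w.
  by move=> /andP[h1 h2] /andP[h3 h4]; apply/andP; split; lra.
rewrite /= in_itv /= => /andP[x0 x1]; rewrite rayE; congr (nat_of_bool _)%:R.
rewrite /w pmulr_lgt0 ?invr_gt0// subr_gt0.
rewrite ltr_cos ?ltr_pM2l ?pi_gt0//; rewrite in_itv /=.
  by rewrite mulr_ge0 ?pi_ge0 ?(ltW x0)//= ler_piMr ?pi_ge0 ?(ltW x1).
by rewrite mulr_ge0 ?pi_ge0 ?(ltW t0)//= ler_piMr ?pi_ge0 ?(ltW t1).
Qed.

(** The Borel sets with this property form a sigma-algebra that contains the rays;
countable unions are limits of [1 - \prod_(i < n) (1 - 1_(A i))]. *)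
Lemma smult_indic (A : set R) : measurable A -> smult (\1_A).
Proof.
pose E := [set A : set R | smult (\1_A)].
suff sub : (@measurable _ (measurableTypeR R)) `<=` E by exact: sub.
have -> : (@measurable _ (measurableTypeR R)) = <<s @RGenInftyO.G R >>.
  exact: RGenInftyO.measurableE.
apply: smallest_sub; last by move=> _ [t ->]; exact: smult_ray.
split.
- by apply: smult_eq (smult_cst 0) => x _; rewrite indic0.
- move=> B VB; apply: smult_eq (smultD (smult_cst 1) (smultM (smult_cst (-1)) VB)).
  move=> x _; rewrite /= setTD indicC mulN1r.
  by rewrite indicE; case: (_ \in _); rewrite ?subrr ?subr0.
- move=> B VB; pose g n x : R := 1 - \prod_(i < n) (1 - \1_(B i) x).
  apply: (@smult_lim g _ 1).
  + move=> n; suff : smult (fun x => \prod_(i < n) (1 - \1_(B i) x)).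
      move=> h; apply: smult_eq (smultD (smult_cst 1) (smultM (smult_cst (-1)) h)).
      by move=> x _; rewrite /= mulN1r.
    elim: n => [|n IH].
      by apply: smult_eq (smult_cst 1) => x _; rewrite big_ord0.
    apply: smult_eq (smultM IH (smultD (smult_cst 1) (smultM (smult_cst (-1)) (VB n)))).
    by move=> x _; rewrite big_ord_recr /= mulN1r.
  + move=> n x _; have h i : 0 <= (1 - \1_(B i) x : R) <= 1.
      by rewrite indicE; case: (_ \in _); rewrite ?subrr ?subr0 ?lexx ?ler01.
    have h0 : 0 <= \prod_(i < n) (1 - \1_(B i) x) :> R.
      by apply: prodr_ge0 => i _; case/andP: (h i).
    have h1 : \prod_(i < n) (1 - \1_(B i) x) <= 1 :> R.
      by apply: prodr_ile1 => i _; exact: h.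
    by rewrite /g ger0_norm; lra.
  + move=> x _; have [[i _ Bix]|nB] := pselect ((\bigcup_k B k) x).
      rewrite indicE mem_set; last by exists i.
      apply/cvgrPdist_le => e e0; exists i.+1 => // n /= ni.
      rewrite /g (bigD1 (Ordinal ni))//= indicE mem_set// subrr mul0r subr0 subrr normr0.
      exact: ltW.
    rewrite indicE memNset//; apply/cvgrPdist_le => e e0; apply: nearW => n.
    rewrite /g big1 ?subrr ?normr0 ?ltW// => i _.
    by rewrite indicE memNset ?subr0// => h; apply: nB; exists i.
Qed.

Import HBNNSimple.

Lemma smult_nnsfun (h : {nnsfun R >-> R}) : smult (fun x => h x).
Proof.
have hE x : D x -> (h x : R) =
    \sum_(y <- finmap.enum_fset (fset_set (range h))) y * \1_(h @^-1` [set y]) x.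
  by move=> _; rewrite fimfunE fsbig_finite.
apply: (smult_eq hE); apply: smult_sum => y; apply: smultM (smult_cst y) _.
by apply: smult_indic; exact: measurable_funPTI.
Qed.

(** As [sin(pi x) > 0] on the interval, [g] is the product of the first sine by
[q = g / sin], and [q] is an increasing limit of simple functions. *)
Lemma spanned_ge0 g M : measurable_fun D g -> (forall x, D x -> 0 <= g x) ->
  sqint_le (fun x => (g x)%:C) M -> spanned (fun x => (g x)%:C).
Proof.
move=> mg g0 hM; have mD : measurable D by exact: measurable_itv.
have s0 x : D x -> 0 < rsine 1 x.
  rewrite /= in_itv /= => /andP[x0 x1]; rewrite mulr_gt0 ?sqrtr_gt0// mul1r.
  apply: sin_gt0_pi; rewrite mulr_gt0 ?pi_gt0//=.
  by rewrite -[ltRHS]mulr1 ltr_pM2l ?pi_gt0.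
pose q x := g x * (rsine 1 x)^-1.
have q0 x : D x -> 0 <= q x.
  by move=> Dx; rewrite mulr_ge0 ?g0// invr_ge0 ltW// s0.
have mq : measurable_fun D q.
  apply: measurable_funM => //; apply: open_continuous_measurable_fun.
    exact: interval_open.
  move=> x; rewrite inE => Dx; apply: continuousV; first by rewrite gt_eqF// s0.
  apply: (@continuous_comp _ _ _ (fun y : R => 1%:R * pi * y)
    (fun z => Num.sqrt 2 * sin z)).
    by apply: continuousM; [exact: cvg_cst|exact: cvg_id].
  by apply: continuousM; [exact: cvg_cst|exact: continuous_sin].
have meq : measurable_fun D (EFin \o q) by exact/measurable_EFinP.
(* The simple functions increase to [q], so that their products with the sine
   are dominated by [g]. *)
pose h := nnsfun_approx mD meq.
have q0' x : D x -> (0 <= (EFin \o q) x)%E by move=> Dx; rewrite lee_fin q0.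
have hq n x : D x -> h n x <= q x.
  move=> Dx; rewrite -lee_fin /h nnsfun_approxE; exact: le_approx.
have hcvg x : D x -> (fun n => h n x) @ \oo --> q x.
  move=> Dx; have := cvg_nnsfun_approx mD meq q0' Dx.
  by move=> /fine_cvgP[_].
have Vs : spanned (@sine_term R 1).
  apply: spanned_eq (spanned_sine_sum 1 (fun=> 1)) => x _.
  by rewrite /sine_sum big_nat1 mul1r.
apply: (@spanned_dominated (fun n x => (h n x)%:C * sine_term 1 x) _ _ M _ _ hM).
- by move=> n; have [_ _] := smult_nnsfun (h n); exact.
- exact: hM.1.
- move=> n x Dx; rewrite sine_termE -rmorphM !normc_real.
  have hs0 : 0 <= h n x * rsine 1 x by rewrite mulr_ge0 ?(ltW (s0 x Dx))//; exact: fun_ge0.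
  rewrite (ger0_norm hs0) (ger0_norm (g0 x Dx)).
  by rewrite -ler_pdivlMr ?s0//; exact: hq.
- move=> x Dx.
  have -> : (fun n => normc ((g x)%:C - (h n x)%:C * sine_term 1 x)) =
      (fun n => `|q x - h n x| * rsine 1 x).
    apply/funext => n; rewrite sine_termE -rmorphM -rmorphB normc_real.
    rewrite -{2}(gtr0_norm (s0 x Dx)) -normrM mulrBl /q divfK//.
    by rewrite gt_eqF// s0.
  rewrite -[X in _ --> X](mul0r (rsine 1 x)); apply: cvgMr_tmp.
  apply/cvgrPdist_lt => d d0.
  have /cvgrPdist_lt/(_ _ d0) := hcvg x Dx; apply: filterS => n.
  by rewrite sub0r normrN normr_id.
Qed.

(** The real and imaginary parts, each split into positive and negative parts,
reduce this to nonnegative functions. *)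
Theorem sines_complete f : L2 f -> spanned f.
Proof.
move=> /L2_sqint_le[M hM]; have [[mr mi] _] := hM.
pose pos (u : R -> R) x := (`|u x| + u x) / 2.
have part (p : R[i] -> R) (k : R) : (forall z, `|p z| <= normc z) ->
    measurable_fun D (fun x => p (f x)) -> `|k| = 1 ->
    spanned (fun x => (pos (fun x => k * p (f x)) x)%:C).
  move=> pn mp k1; have mu_ : measurable_fun D (pos (fun x => k * p (f x))).
    apply: measurable_funM; last exact: measurable_cst.
    apply: measurable_funD.
      apply: measurableT_comp => //.
      by apply: measurable_funM => //; exact: measurable_cst.
    by apply: measurable_funM => //; exact: measurable_cst.
  have pos0 x : 0 <= pos (fun x => k * p (f x)) x.
    by rewrite /pos; have := ler_norm (- (k * p (f x))); rewrite normrN; lra.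
  apply: (@spanned_ge0 _ M) => //.
  apply: sqint_le_mono hM.
    by split; [exact: mu_|exact: measurable_cst].
  move=> x _; rewrite normc_real ger0_norm//; apply: le_trans (pn (f x)).
  rewrite /pos normrM k1 mul1r; have := ler_norm (k * p (f x)).
  by rewrite normrM k1 mul1r; lra.
have hr := @normc_Re R; have hi := @normc_Im R.
have n1 : `|(1 : R)| = 1 by exact: normr1.
have n2 : `|(-1 : R)| = 1 by rewrite normrN normr1.
have V1 := part _ 1 hr mr n1; have V2 := part _ (-1) hr mr n2.
have V3 := part _ 1 hi mi n1; have V4 := part _ (-1) hi mi n2.
have V34 := spanned_lin 'i V3 (spannedZ (- 'i) V4).
apply: spanned_eq (spanned_lin 1 V1 (spanned_lin (-1) V2 V34)) => x _.
rewrite !fctE /pos; case: (f x) => u v /=; rewrite !mul1r !mulN1r !normrN.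
simpc.
by congr (_ +i* _); field.
Qed.

End SineCompleteness.

(** * Completeness of the dilates *)

Section Completeness.
Variable R : realType.
Implicit Types (phi : R -> R[i]) (a b c d : nat -> R[i]).

Lemma expands0 : expands (0 : R -> R[i]) 0.
Proof.
have -> : 0 = sine_sum 0 (0 : nat -> R[i]) by apply/funext => x; rewrite /sine_sum big_geq.
exact: expands_sine_sum.
Qed.

Lemma expands_span phi a K d : expands phi a ->
  expands (\sum_(1 <= k < K.+1) d k *: dilate phi k) (dconv a K d).
Proof.
move=> phia; elim: K => [|K IH]; first by rewrite big_geq// dconv0; exact: expands0.
rewrite big_nat_recr//= dconvS addrC [_ + _ *: dshift _ _]addrC.
by apply: expands_lin => //; exact: expands_dilate.
Qed.

Lemma expandsB phi psi b c : expands phi b -> expands psi c ->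
  expands (phi - psi) (b - c).
Proof.
move=> hb hc; rewrite addrC [b - c]addrC -(scaleN1r psi) -(scaleN1r c).
exact: expands_lin.
Qed.

Lemma expands_upto L b : expands (sine_sum L b) (upto L b).
Proof.
rewrite (sine_sum_widen b (leqnn L)); apply: expands_sine_sum => n Ln.
by rewrite /upto leqNgt Ln.
Qed.

(** The sine expansion transports approximations in both directions: completeness
of the sines lets finite sine sums be approximated instead of arbitrary
functions. *)
Lemma complete_system_seq phi a : expands phi a ->
  complete_system (@L2_norm R) (@L2 R) (dilate phi) <-> cyclic_seq a.
Proof.
move=> phia; split=> [[_ dense] b b2 e e0|cyc].
  have [L hL] := l2_tail b2 (divr_gt0 e0 (ltr0Sn R 3)).
  (* [e = 2 (e/4) + 2 (2 (e/16) + e/8)]. *)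
  have e16 : 0 < e / 16 by rewrite divr_gt0.
  have se0 : 0 < Num.sqrt (e / 16) by rewrite sqrtr_gt0.
  have [_ [K [d ->]] fg] := dense _ (L2_sine_sum L b) _ se0.
  exists K, d; set g := \sum_(_ <= _ < _) _ in fg.
  have hg := expandsB (expands_upto L b) (expands_span K d phia).
  have h : sqint_le (sine_sum L b - g) (e / 16).
    apply: sqint_le_le (sqint_le_L2_norm hg.1).
    rewrite -[leRHS](sqr_sqrtr (ltW e16)).
    by rewrite lerXn2r ?nnegrE ?sqrtr_ge0// ltW.
  have h' := expands_sqsum_le (divr_gt0 e0 (ltr0Sn R 7)) hg h.
  have -> : b - dconv a K d = (b - upto L b) + (upto L b - dconv a K d).
    by rewrite addrA subrK.
  by apply: sqsum_le_le (sqsum_leD hL h'); lra.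
split=> [_ [K [d ->]]|f f2 e e0]; first by have [] := expands_span K d phia.
(* [e^2/2 >= 2 (e^2/8) + 2 (2 (e^2/32) + e^2/32)]. *)
have e80 : 0 < e ^+ 2 / 8 by rewrite divr_gt0// exprn_gt0.
have e32 : 0 < e ^+ 2 / 32 by rewrite divr_gt0// exprn_gt0.
have [_ /(_ _ e80)[N [c hc]]] := sines_complete f2.
have hN := expands_upto N c.
have [K [d hd]] := cyc _ (expands_l2 hN) _ e32.
exists (\sum_(1 <= k < K.+1) d k *: dilate phi k); first by exists K, d.
have hg := expandsB hN (expands_span K d phia).
have h' := sqsum_le_expands e32 hg hd.
apply: L2_norm_lt => //; set g := \sum_(_ <= _ < _) _ in hg h' *.
have -> : f - g = (f - sine_sum N c) + (sine_sum N c - g) by rewrite addrA subrK.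
apply: sqint_le_le (sqint_leD hc h').
by have := ltW e32; lra.
Qed.

End Completeness.

Theorem theorem5p5 (R : realType) (phi : R -> R[i]) (a : nat -> R[i])
    (phi_L2 : L2 phi) (phi_sine : sine_expansion phi a) (a1 : a 1%N = 1) :
  [/\ complete_system (@L2_norm R) (@L2 R) (dilate phi)
        <-> cyclic_H (dirichlet_series a),
      cyclic_H (dirichlet_series a)
        <-> multiples_dense (dirichlet_series a) &
      cyclic_H (dirichlet_series a)
        <-> cyclic_H2 (bohr (dirichlet_series a))].
Proof.
have phia := sine_expansion_expands phi_L2 phi_sine.
have a2 := expands_l2 phia.
have complete_a := complete_system_seq phia.
have H_a := cyclic_H_seq a2.
have mult_a := multiples_dense_seq a2.
have H2_a := cyclic_H2_seq a2.
by split; tauto.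
Qed.
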